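(* Let $\varphi_0:\mathbb{R}^n\to\mathbb{R}$ and $g:\mathbb{R}^n\to\mathbb{R}^m$ be $\mathcal{C}^2$-smooth, let $\psi:\mathbb{R}^m\to\overline{\mathbb{R}}$ be a proper l.s.c. convex function, and consider the composite problem of minimizing $\varphi(x):=\varphi_0(x)+\psi(g(x))$ over $x\in\mathbb{R}^n$. Let $\bar x$ be a stationary point of this problem, i.e. $0\in\partial\varphi(\bar x)$. Suppose that the first-order qualification condition $$\partial^\infty\psi(g(\bar x))\cap\ker\nabla g(\bar x)^*=\{0\}$$ holds (so that $\psi\circ g$ is strongly amenable at $\bar x$), and that the second-order qualification condition $$\partial^2\psi(g(\bar x),\bar y)(0)\cap\ker\nabla g(\bar x)^*=\{0\}\quad\text{for all }\bar y\in\Lambda(\bar x,0)$$ is satisfied. Then: (i) The variational sufficiency for local optimality holds at $\bar x$ if there exist neighborhoods $U$ of $\bar x$ and $V$ of $0$ such that $$\langle\nabla^2\varphi_0(x)w,w\rangle+\langle\nabla^2\langle y,g\rangle(x)w,w\rangle+\langle u,\nabla g(x)w\rangle\ge0$$ for all $x\in U$, $v\in V$, $y\in\Lambda(x,v)$, $u\in\partial^2\psi(g(x),y)(\nabla g(x)w)$, and $w\in\mathbb{R}^n$. (ii) For $\sigma>0$, the strong variational sufficiency for local optimality holds at $\bar x$ with modulus $\sigma$ if there exist neighborhoods $U$ of $\bar x$ and $V$ of $0$ such that $$\langle\nabla^2\varphi_0(x)w,w\rangle+\langle\nabla^2\langle y,g\rangle(x)w,w\rangle+\langle u,\nabla g(x)w\rangle\ge\sigma\|w\|^2$$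 for all $x\in U$, $v\in V$, $y\in\Lambda(x,v)$, $u\in\partial^2\psi(g(x),y)(\nabla g(x)w)$, and $w\in\mathbb{R}^n$. (iii) The strong variational sufficient condition for local optimality holds at $\bar x$ (with some modulus) if for every $\bar y\in\Lambda(\bar x,0)$ $$\langle\nabla^2\varphi_0(\bar x)w,w\rangle+\langle\nabla^2\langle\bar y,g\rangle(\bar x)w,w\rangle+\langle u,\nabla g(\bar x)w\rangle>0\quad\text{whenever } u\in\partial^2\psi(g(\bar x),\bar y)(\nabla g(\bar x)w),\ w\ne0.$$
   Context: Conventions: $\overline{\mathbb{R}}:=(-\infty,\infty]$; every extended-real-valued function is assumed proper (not identically $\infty$), $\operatorname{dom}\varphi:=\{x\mid\varphi(x)<\infty\}$; l.s.c. means lower semicontinuous; $\nabla g(x)$ is the Jacobian and $\nabla g(x)^*$ its transpose; $\nabla^2\langle y,g\rangle(x)$ is the Hessian at $x$ of the function $x\mapsto\langle y,g(x)\rangle$. Subdifferentials (for any $\varphi$, in any $\mathbb{R}^n$): for $\bar x\in\operatorname{dom}\varphi$, $$\widehat\partial\varphi(\bar x)=\Big\{v\;\Big|\;\liminf_{x\to\bar x}\frac{\varphi(x)-\varphi(\bar x)-\langle v,x-\bar x\rangle}{\|x-\bar x\|}\ge 0\Big\}.$$ The limiting subdifferential $\partial\varphi(\bar x)$ is the set of all $v$ for which there are $x_k\to\bar x$ with $\varphi(x_k)\to\varphi(\bar x)$ and $v_k\in\widehat\partial\varphi(x_k)$ with $v_k\to v$ (and $\partial\varphi(\bar x)=\emptyset$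 if $\bar x\notin\operatorname{dom}\varphi$); the singular subdifferential $\partial^\infty\varphi(\bar x)$ is the set of all $v$ for which there are $x_k\to\bar x$ with $\varphi(x_k)\to\varphi(\bar x)$, $\lambda_k\downarrow0$ and $v_k\in\widehat\partial\varphi(x_k)$ with $\lambda_kv_k\to v$. The limiting normal cone is $N_\Omega(\bar x):=\partial\delta_\Omega(\bar x)$, with $\delta_\Omega$ the indicator function. Limiting second-order subdifferential: for $(z,y)\in\operatorname{gph}\partial\psi$, $\partial^2\psi(z,y)(w):=\{u\mid(u,-w)\in N_{\operatorname{gph}\partial\psi}(z,y)\}$. Multipliers: $\Lambda(x,v):=\{y\in\mathbb{R}^m\mid v=\nabla\varphi_0(x)+\nabla g(x)^*y,\ y\in\partial\psi(g(x))\}$. Variational convexity: an l.s.c. function $\varphi$ is variationally convex at $\bar x$ for $\bar v\in\partial\varphi(\bar x)$ if for some convex neighborhood $U\times V$ of $(\bar x,\bar v)$ there exist an l.s.c. convex function $\theta\le\varphi$ on $U$ and $\epsilon>0$ such that $(U_\epsilon\times V)\cap\operatorname{gph}\partial\varphi=(U\times V)\cap\operatorname{gph}\partial\theta$ and $\varphi(x)=\theta(x)$ at the common elements $(x,v)$, where $U_\epsilon:=\{x\in U\mid\varphi(x)<\varphi(\bar x)+\epsilon\}$. It is variationally strongly convex with modulus $\sigma>0$ if this holds with $\theta-\frac\sigma2\|\cdot\|^2$ convex on $U$. The variational sufficiency (variational sufficient condition) for local optimality holds at $\bar x$ if $\varphi$ is variationally convex at $\bar x$ for $0\in\partial\varphi(\bar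 x)$; the strong variational sufficiency holds at $\bar x$ with modulus $\sigma$ if $\varphi$ is variationally strongly convex at $\bar x$ for $0$ with modulus $\sigma$. *)

(* Defs.v *)
From HB Require Import structures.
From mathcomp Require Import all_boot all_order all_algebra.
From mathcomp Require Import all_classical all_reals all_analysis.
Set Implicit Arguments.
Unset Strict Implicit.
Unset Printing Implicit Defensive.
Import Order.TTheory GRing.Theory Num.Theory.
Import numFieldNormedType.Exports.
Local Open Scope classical_set_scope.
Local Open Scope ring_scope.

(* R^n is 'rV[R]_n. The library norm `|x| on matrices is the sup norm, so the
   Euclidean inner product and norm are introduced here. *)

Definition inner (R : realType) (n : nat) (u v : 'rV[R]_n) : R :=
  \sum_(i < n) u 0 i * v 0 i.

Definition enorm (R : realType) (n : nat) (u : 'rV[R]_n) : R :=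
  Num.sqrt (inner u u).

Definition pderiv (R : realType) (n : nat) (i : 'I_n) (f : 'rV[R]_n -> R) :
    'rV[R]_n -> R :=
  'D_(delta_mx 0 i : 'rV[R]_n) f.

Definition grad (R : realType) (n : nat) (f : 'rV[R]_n -> R) (x : 'rV[R]_n) :
    'rV[R]_n :=
  \row_(i < n) pderiv i f x.

Definition hessian (R : realType) (n : nat) (f : 'rV[R]_n -> R)
    (x : 'rV[R]_n) : 'M[R]_n :=
  \matrix_(i < n, j < n) pderiv i (pderiv j f) x.

Definition C2 (R : realType) (n : nat) (f : 'rV[R]_n -> R) : Prop :=
  [/\ forall x : 'rV[R]_n, differentiable f x,
      forall (i : 'I_n) (x : 'rV[R]_n), differentiable (pderiv i f) x &
      forall i j : 'I_n, continuous (pderiv i (pderiv j f))].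

Definition C2_map (R : realType) (n m : nat) (g : 'rV[R]_n -> 'rV[R]_m) :
    Prop :=
  forall k : 'I_m, C2 (fun x => g x 0 k).

(* The library's 'J g x acts on row vectors from the right, i.e. it is the
   transpose of the usual m x n Jacobian matrix. *)

Definition jac (R : realType) (n m : nat) (g : 'rV[R]_n -> 'rV[R]_m)
    (x w : 'rV[R]_n) : 'rV[R]_m :=
  w *m 'J g x.

Definition jac_adj (R : realType) (n m : nat) (g : 'rV[R]_n -> 'rV[R]_m)
    (x : 'rV[R]_n) (y : 'rV[R]_m) : 'rV[R]_n :=
  y *m ('J g x)^T.

Definition ker_jac_adj (R : realType) (n m : nat)
    (g : 'rV[R]_n -> 'rV[R]_m) (x : 'rV[R]_n) : set 'rV[R]_m :=
  [set y | jac_adj g x y = 0].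

Section ExtendedReal.
Local Open Scope ereal_scope.

Definition proper_fun (R : realType) (n : nat) (f : 'rV[R]_n -> \bar R) :
    Prop :=
  (forall x, f x != -oo) /\ (exists x, f x < +oo).

Definition edom (R : realType) (n : nat) (f : 'rV[R]_n -> \bar R) :
    set 'rV[R]_n :=
  [set x | f x < +oo].

Definition convex_fun_on (R : realType) (n : nat) (U : set 'rV[R]_n)
    (f : 'rV[R]_n -> \bar R) : Prop :=
  forall (x y : 'rV[R]_n) (t : R), U x -> U y -> (0 <= t <= 1)%R ->
    f (t *: x + (1 - t) *: y)%R <= t%:E * f x + (1 - t)%:E * f y.

Definition regular_subdiff (R : realType) (n : nat) (f : 'rV[R]_n -> \bar R)
    (xbar : 'rV[R]_n) : set 'rV[R]_n :=
  [set v | edom f xbar /\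
    0 <= limf_einf
           (fun x => (f x - f xbar - (inner v (x - xbar)%R)%:E)
                     * ((enorm (x - xbar))^-1)%:E)
           xbar^'].

Definition limiting_subdiff (R : realType) (n : nat) (f : 'rV[R]_n -> \bar R)
    (xbar : 'rV[R]_n) : set 'rV[R]_n :=
  [set v | edom f xbar /\
    exists (x_ v_ : nat -> 'rV[R]_n),
      [/\ x_ k @[k --> \oo] --> xbar,
          f (x_ k) @[k --> \oo] --> f xbar,
          forall k, regular_subdiff f (x_ k) (v_ k) &
          v_ k @[k --> \oo] --> v]].

Definition singular_subdiff (R : realType) (n : nat) (f : 'rV[R]_n -> \bar R)
    (xbar : 'rV[R]_n) : set 'rV[R]_n :=
  [set v | edom f xbar /\
    exists (x_ v_ : nat -> 'rV[R]_n) (lambda_ : nat -> R),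
      [/\ x_ k @[k --> \oo] --> xbar,
          f (x_ k) @[k --> \oo] --> f xbar,
          (forall k, (0 < lambda_ k)%R) /\ lambda_ k @[k --> \oo] --> (0 : R)%R,
          forall k, regular_subdiff f (x_ k) (v_ k) &
          (lambda_ k *: v_ k)%R @[k --> \oo] --> v]].

Definition set_indicator (R : realType) (n : nat) (A : set 'rV[R]_n)
    (x : 'rV[R]_n) : \bar R :=
  if x \in A then 0 else +oo.

Definition normal_cone (R : realType) (n : nat) (A : set 'rV[R]_n)
    (x : 'rV[R]_n) : set 'rV[R]_n :=
  limiting_subdiff (set_indicator A) x.

Definition gph (R : realType) (n m : nat) (S : 'rV[R]_n -> set 'rV[R]_m) :
    set ('rV[R]_n * 'rV[R]_m) :=
  [set p | S p.1 p.2].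

(* Graphs are viewed inside R^(n + m) through row_mx in order to take normal
   cones. For (z, y) off gph (limiting_subdiff f) this set is empty. *)
Definition second_subdiff (R : realType) (n : nat) (f : 'rV[R]_n -> \bar R)
    (z y w : 'rV[R]_n) : set 'rV[R]_n :=
  [set u | normal_cone
             [set row_mx p.1 p.2 | p in gph (limiting_subdiff f)]
             (row_mx z y) (row_mx u (- w)%R)].

Definition variational_witness (R : realType) (n : nat)
    (f : 'rV[R]_n -> \bar R) (xbar vbar : 'rV[R]_n)
    (U V : set 'rV[R]_n) (theta : 'rV[R]_n -> \bar R) (eps : R) : Prop :=
  let Ueps := U `&` [set x | f x < f xbar + eps%:E] in
  [/\ nbhs xbar U /\ convex_set U,
      nbhs vbar V /\ convex_set V,
      [/\ proper_fun theta, lower_semicontinuous theta,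
          convex_fun_on setT theta & forall x, U x -> theta x <= f x],
      (0 < eps)%R /\
      (Ueps `*` V) `&` gph (limiting_subdiff f) =
      (U `*` V) `&` gph (limiting_subdiff theta) &
      forall x v, ((U `*` V) `&` gph (limiting_subdiff theta)) (x, v) ->
        f x = theta x].

Definition variationally_convex (R : realType) (n : nat)
    (f : 'rV[R]_n -> \bar R) (xbar vbar : 'rV[R]_n) : Prop :=
  [/\ proper_fun f, lower_semicontinuous f, limiting_subdiff f xbar vbar &
      exists (U V : set 'rV[R]_n) (theta : 'rV[R]_n -> \bar R) (eps : R),
        variational_witness f xbar vbar U V theta eps].

Definition variationally_strongly_convex (R : realType) (n : nat)
    (sigma : R) (f : 'rV[R]_n -> \bar R) (xbar vbar : 'rV[R]_n) : Prop :=
  [/\ proper_fun f, lower_semicontinuous f, limiting_subdiff f xbar vbar &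
      exists (U V : set 'rV[R]_n) (theta : 'rV[R]_n -> \bar R) (eps : R),
        variational_witness f xbar vbar U V theta eps /\
        convex_fun_on U
          (fun x => theta x - (sigma / 2 * enorm x ^+ 2)%:E)].

Definition variational_sufficiency (R : realType) (n : nat)
    (f : 'rV[R]_n -> \bar R) (xbar : 'rV[R]_n) : Prop :=
  variationally_convex f xbar 0%R.

Definition strong_variational_sufficiency (R : realType) (n : nat)
    (sigma : R) (f : 'rV[R]_n -> \bar R) (xbar : 'rV[R]_n) : Prop :=
  (0 < sigma)%R /\ variationally_strongly_convex sigma f xbar 0%R.

Definition composite (R : realType) (n m : nat) (phi0 : 'rV[R]_n -> R)
    (g : 'rV[R]_n -> 'rV[R]_m) (psi : 'rV[R]_m -> \bar R) :
    'rV[R]_n -> \bar R :=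
  fun x => (phi0 x)%:E + psi (g x).

End ExtendedReal.

Definition multipliers (R : realType) (n m : nat) (phi0 : 'rV[R]_n -> R)
    (g : 'rV[R]_n -> 'rV[R]_m) (psi : 'rV[R]_m -> \bar R)
    (x v : 'rV[R]_n) : set 'rV[R]_m :=
  [set y | v = grad phi0 x + jac_adj g x y /\
           limiting_subdiff psi (g x) y].

Definition second_order_form (R : realType) (n m : nat)
    (phi0 : 'rV[R]_n -> R) (g : 'rV[R]_n -> 'rV[R]_m)
    (x : 'rV[R]_n) (y u : 'rV[R]_m) (w : 'rV[R]_n) : R :=
  inner (w *m hessian phi0 x) w
  + inner (w *m hessian (fun x' => inner y (g x')) x) w
  + inner u (jac g x w).

(* Main.v *)
Require Import Defs.
From HB Require Import structures.
From mathcomp Require Import all_boot all_order all_algebra.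
From mathcomp Require Import all_classical all_reals all_analysis.
From mathcomp Require Import ring lra.
Set Implicit Arguments.
Unset Strict Implicit.
Unset Printing Implicit Defensive.
Import Order.TTheory GRing.Theory Num.Theory.
Import numFieldNormedType.Exports.
Local Open Scope classical_set_scope.
Local Open Scope ring_scope.

(* Write [S] for the pairs [(x, y)] with [y] a subgradient of [psi] at [g x], and
   [v = grad phi0 x + jac_adj g x y]. The first-order condition bounds the
   multipliers, so near [(xbar, 0)] the graph of the limiting subdifferential of
   [phi] is the image of [S], and [phi] is prox-regular there: it lies above
   quadratics of some modulus [s] touching it at the points of the graph.

   The second-order condition gives a multiplier rule for minimizing smooth
   functions over [S]. Applied to a barrier function along a segment joining two
   points of the graph in the Minty coordinates [x + lam *: v], it yields a mean
   value inequality whose multipliers are elements of the second subdifferential.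
   Hence the pointwise estimates of (i) and (ii) make the graph locally (strongly)
   monotone, and the estimate of (iii), made uniform by compactness, makes
   [v + s *: x] locally metrically regular for all [s >= 0].

   Prox steps turn this into quadratic growth. In (iii) one prox step improves the
   modulus [s] by a fixed amount, so finitely many steps make it negative; in (i)
   and (ii) the growth is integrated along a subdivided segment, where the error of
   [N] steps is O(1/N). The supremum [theta] of the resulting quadratic minorants
   is convex, and one more prox step shows that the graphs of the subdifferentials
   of [theta] and [phi] coincide locally. *)

(** * The Euclidean structure *)

(** The second-order condition speaks of normals to the subdifferential graph of [psi] at pairs
    [(p, q)] where [p] need not equal [g x]. Hence the first-order rule and the second-order one
    both free [p] and penalize [g x - p] quadratically: the gradient of the penalty is the
    multiplier, and the qualification conditions keep multipliers bounded in the limit.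

    For [lam * s < 1], hypomonotonicity makes [x] and [v] Lipschitz functions of the single vector
    [x + lam *: v]. A smooth barrier in that vector therefore confines a minimizer over the graph in
    both variables.

    In (iii), compactness is applied to the norm of [lag_hess + jac_adj + s *: w], not to the
    quadratic form. If [u] blows up, smallness of this vector sends the direction of [u] into the
    kernel of the adjoint Jacobian, where the second-order condition excludes it; smallness of the
    form would not. A norm bound yields only metric regularity, whence the descent through the
    moduli [s >= 0].

    All three parts meet in [prox_reg] with a nonpositive modulus: the growth inequality is at once
    a family of convex quadratic minorants, from which [theta] is built. *)

Section Inner.
Context {R : realType} {n : nat}.
Implicit Types (u v w : 'rV[R]_n) (a : R).

Lemma innerC u v : inner u v = inner v u.
Proof. by apply: eq_bigr => i _; rewrite mulrC. Qed.

Lemma innerDl u v w : inner (u + v) w = inner u w + inner v w.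
Proof. by rewrite -big_split; apply: eq_bigr => i _; rewrite !mxE mulrDl. Qed.

Lemma innerZl a u v : inner (a *: u) v = a * inner u v.
Proof. by rewrite /inner mulr_sumr; apply: eq_bigr => i _; rewrite !mxE mulrA. Qed.

Lemma innerNl u v : inner (- u) v = - inner u v.
Proof. by rewrite -scaleN1r innerZl mulN1r. Qed.

Lemma innerDr u v w : inner u (v + w) = inner u v + inner u w.
Proof. by rewrite innerC innerDl !(innerC u). Qed.

Lemma innerZr a u v : inner u (a *: v) = a * inner u v.
Proof. by rewrite innerC innerZl innerC. Qed.

Lemma innerNr u v : inner u (- v) = - inner u v.
Proof. by rewrite innerC innerNl innerC. Qed.

Lemma inner0l u : inner 0 u = 0.
Proof. by rewrite -(scale0r 0) innerZl mul0r. Qed.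

Lemma inner0r u : inner u 0 = 0.
Proof. by rewrite innerC inner0l. Qed.

Definition innerE :=
  (innerDl, innerDr, innerNl, innerNr, innerZl, innerZr, inner0l, inner0r).

Lemma inner_ge0 u : 0 <= inner u u.
Proof. by apply: sumr_ge0 => i _; rewrite -expr2 sqr_ge0. Qed.

Lemma inner_eq0 u : inner u u = 0 -> u = 0.
Proof.
move=> /eqP; rewrite psumr_eq0; last by move=> i _; rewrite -expr2 sqr_ge0.
move=> /allP u0; apply/rowP => i; rewrite mxE.
by have /u0 := mem_index_enum i; rewrite -expr2 sqrf_eq0 => /eqP.
Qed.

Lemma enorm_ge0 u : 0 <= enorm u.
Proof. exact: sqrtr_ge0. Qed.

Lemma sqr_enorm u : enorm u ^+ 2 = inner u u.
Proof. by rewrite /enorm sqr_sqrtr// inner_ge0. Qed.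

Lemma enorm0 : enorm (0 : 'rV[R]_n) = 0.
Proof. by rewrite /enorm inner0l sqrtr0. Qed.

Lemma enorm_eq0 u : enorm u = 0 -> u = 0.
Proof. by move=> u0; apply: inner_eq0; rewrite -sqr_enorm u0 expr0n. Qed.

Lemma enorm_gt0 u : u != 0 -> 0 < enorm u.
Proof.
by move=> u0; rewrite lt_neqAle enorm_ge0 andbT eq_sym; apply: contra_neq u0 => /enorm_eq0.
Qed.

Lemma enormZ a u : enorm (a *: u) = `|a| * enorm u.
Proof. by rewrite /enorm innerZl innerZr mulrA -expr2 sqrtrM ?sqr_ge0// sqrtr_sqr. Qed.

Lemma enormN u : enorm (- u) = enorm u.
Proof. by rewrite -scaleN1r enormZ normrN1 mul1r. Qed.

Lemma enormB u v : enorm (u - v) = enorm (v - u).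
Proof. by rewrite -enormN opprB. Qed.

Lemma inner_CS u v : `|inner u v| <= enorm u * enorm v.
Proof.
have [->|v0] := eqVneq v 0; first by rewrite inner0r normr0 enorm0 mulr0.
have vv : 0 < inner v v by rewrite -sqr_enorm exprn_gt0// enorm_gt0.
have := inner_ge0 (inner v v *: u - inner u v *: v).
rewrite !innerE (innerC v u) => h.
have {h} : 0 <= inner v v * (inner u u * inner v v - inner u v ^+ 2) by nra.
rewrite pmulr_rge0// subr_ge0 => h.
rewrite -ler_sqr ?nnegrE ?mulr_ge0 ?enorm_ge0 ?normr_ge0//.
by rewrite real_normK ?num_real// exprMn !sqr_enorm.
Qed.

Lemma inner_le u v : inner u v <= enorm u * enorm v.
Proof. exact: le_trans (ler_norm _) (inner_CS u v). Qed.

Lemma inner_ge u v : - (enorm u * enorm v) <= inner u v.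
Proof. by have := inner_CS u v; rewrite ler_norml => /andP[]. Qed.

Lemma enormD u v : enorm (u + v) <= enorm u + enorm v.
Proof.
rewrite -ler_sqr ?nnegrE ?addr_ge0 ?enorm_ge0//.
have := inner_le u v.
rewrite sqr_enorm !innerE (innerC v u) -!sqr_enorm; nra.
Qed.

Lemma enorm_dist u v w : enorm (u - w) <= enorm (u - v) + enorm (v - w).
Proof. by rewrite (le_trans _ (enormD _ _))// addrA subrK. Qed.

Lemma enorm_le_sub u v : enorm u <= enorm v + enorm (u - v).
Proof. by rewrite (le_trans _ (enormD _ _))// addrC subrK. Qed.

Lemma coord_enorm u (i : 'I_n) : `|u 0 i| <= enorm u.
Proof.
rewrite -ler_sqr ?nnegrE ?enorm_ge0// sqr_enorm real_normK ?num_real//.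
rewrite /inner (bigD1 i)//= -expr2 lerDl; apply: sumr_ge0 => j _.
by rewrite -expr2 sqr_ge0.
Qed.

Lemma enorm_sum_coord u : enorm u <= \sum_(i < n) `|u 0 i|.
Proof.
rewrite -ler_sqr ?nnegrE ?enorm_ge0//; last exact: sumr_ge0.
rewrite sqr_enorm expr2 mulr_suml; apply: ler_sum => i _.
rewrite (le_trans (ler_norm _))// normrM ler_wpM2l// (bigD1 i)//= lerDl.
exact: sumr_ge0.
Qed.

Lemma norm_le_enorm u : `|u| <= enorm u.
Proof.
rewrite [leLHS]/Num.norm /= mx_normrE; apply/bigmax_leP; split; first exact: enorm_ge0.
by move=> -[i j] _ /=; rewrite ord1 coord_enorm.
Qed.

Lemma enorm_le_norm u : enorm u <= n%:R * `|u|.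
Proof.
apply: (le_trans (enorm_sum_coord u)).
rewrite -[n in n%:R]card_ord -sumr_const mulr_suml; apply: ler_sum => i _.
rewrite mul1r [leRHS]/Num.norm /= mx_normrE.
exact: (@le_bigmax _ _ _ _ (fun ij : 'I_1 * 'I_n => `|u ij.1 ij.2|) (0, i)).
Qed.

End Inner.

(** * Neighbourhoods and limits in the Euclidean norm *)

Section Topology.
Context {R : realType}.

(** The topology on row vectors is given by sup-norm balls; the equivalence of the norms transfers
    it to Euclidean balls. Dividing the radius by [n.+1] rather than [n] covers [n = 0]. *)
Lemma nbhs_enormP {n} (x : 'rV[R]_n) (A : set 'rV[R]_n) :
  nbhs x A <-> exists2 r : R, 0 < r & forall y, enorm (y - x) < r -> A y.
Proof.
split => [/nbhs_ballP[r /= r0 xA]|[r r0 xA]].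
  exists r => // y yx; apply: xA; rewrite -ball_normE/= -opprB normrN.
  exact: le_lt_trans (norm_le_enorm _) yx.
apply/nbhs_ballP; exists (r / n.+1%:R); first by rewrite /= divr_gt0.
move=> y; rewrite -ball_normE/= -opprB normrN => yx; apply: xA.
apply: le_lt_trans (enorm_le_norm _) _.
apply: (@le_lt_trans _ _ (n.+1%:R * `|y - x|)); first by rewrite ler_wpM2r// ler_nat.
by rewrite mulrC -ltr_pdivlMr.
Qed.

Section Filter.
Context {T : Type} {F : set_system T} {FF : Filter F}.

Lemma cvg_enormP {n} (f : T -> 'rV[R]_n) (x : 'rV[R]_n) :
  f @ F --> x <-> forall e : R, 0 < e -> \forall t \near F, enorm (f t - x) < e.
Proof.
split => [fx e e0|fx A /nbhs_enormP[r r0 xA]].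
  by apply: (fx [set y | enorm (y - x) < e]); apply/nbhs_enormP; exists e.
by apply: filterS (fx r r0) => t /xA.
Qed.

Lemma cvg_realP (f : T -> R) (l : R) :
  f @ F --> l <-> forall e : R, 0 < e -> \forall t \near F, `|f t - l| < e.
Proof.
split => [/cvgrPdist_lt fl e /fl|fl].
  by apply: filterS => t; rewrite distrC.
by apply/cvgrPdist_lt => e /fl; apply: filterS => t; rewrite distrC.
Qed.

Lemma cvg_real_near (f : T -> R) (l e : R) :
  f @ F --> l -> 0 < e -> \forall t \near F, `|f t - l| < e.
Proof. by move=> /cvg_realP; apply. Qed.

Lemma cvg_enorm_near {n} (f : T -> 'rV[R]_n) (x : 'rV[R]_n) (e : R) :
  f @ F --> x -> 0 < e -> \forall t \near F, enorm (f t - x) < e.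
Proof. by move=> /cvg_enormP; apply. Qed.

Lemma cvg_coord {n} (f : T -> 'rV[R]_n) (x : 'rV[R]_n) i :
  f @ F --> x -> (fun t => f t 0 i) @ F --> x 0 i.
Proof.
move=> fx; apply: (cvg_comp f (fun u : 'rV[R]_n => u 0 i) fx).
exact: coord_continuous.
Qed.

Lemma cvg_row {n} (f : T -> 'rV[R]_n) (x : 'rV[R]_n) :
  (forall i, (fun t => f t 0 i) @ F --> x 0 i) -> f @ F --> x.
Proof.
move=> fx; apply/cvg_enormP => e e0.
have /filter_forall : forall i : 'I_n, \forall t \near F, `|f t 0 i - x 0 i| < e / n.+1%:R.
  by move=> i; apply: cvg_real_near => //; rewrite divr_gt0.
apply: filterS => t ft; apply: (le_lt_trans (enorm_sum_coord _)).
apply: (@le_lt_trans _ _ (\sum_(i < n) e / n.+1%:R)).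
  by apply: ler_sum => i _; have := ft i; rewrite !mxE => /ltW.
rewrite sumr_const card_ord -[_ *+ n]mulr_natl mulrCA -[ltRHS]mulr1 ltr_pM2l//.
by rewrite ltr_pdivrMr// mul1r ltr_nat.
Qed.

Lemma cvg_bigsum (I : Type) (r : seq I) (f : I -> T -> R) (l : I -> R) :
  (forall i, f i @ F --> l i) ->
  (fun t => \sum_(i <- r) f i t) @ F --> \sum_(i <- r) l i.
Proof.
move=> fl; elim: r => [|i r ih].
  by under eq_fun do rewrite big_nil; rewrite big_nil; exact: cvg_cst.
by under eq_fun do rewrite big_cons; rewrite big_cons; exact: cvgD.
Qed.

Lemma cvg_inner {n} (f h : T -> 'rV[R]_n) (x y : 'rV[R]_n) :
  f @ F --> x -> h @ F --> y -> (fun t => inner (f t) (h t)) @ F --> inner x y.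
Proof. by move=> fx hy; apply: cvg_bigsum => i; apply: cvgM; exact: cvg_coord. Qed.

Lemma cvg_enorm {n} (f : T -> 'rV[R]_n) (x : 'rV[R]_n) :
  f @ F --> x -> (fun t => enorm (f t)) @ F --> enorm x.
Proof.
move=> fx; apply: (cvg_comp (fun t => inner (f t) (f t)) Num.sqrt).
  exact: (cvg_inner fx fx).
exact: sqrt_continuous.
Qed.

Lemma cvg_mulmx {n p} (f : T -> 'rV[R]_n) (M : T -> 'M[R]_(n, p)) (x : 'rV[R]_n) (N : 'M[R]_(n, p)) :
  f @ F --> x -> (forall i j, (fun t => M t i j) @ F --> N i j) ->
  (fun t => f t *m M t) @ F --> x *m N.
Proof.
move=> fx MN; apply: cvg_row => j; rewrite mxE.
under eq_fun do rewrite mxE.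
by apply: cvg_bigsum => i; apply: cvgM => //; exact: cvg_coord.
Qed.

Lemma cvg_enorm0 {n} (f : T -> 'rV[R]_n) (x : 'rV[R]_n) (e : T -> R) :
  (forall t, enorm (f t - x) <= e t) -> e @ F --> (0 : R) -> f @ F --> x.
Proof.
move=> fe e0; apply/cvg_enormP => d d0.
have := cvg_real_near e0 d0; apply: filterS => t.
by rewrite subr0; apply: le_lt_trans; rewrite (le_trans (fe t))// ler_norm.
Qed.

End Filter.
End Topology.

(* A fixed free ultrafilter on [nat]: bounded sequences converge along it, so
   compactness arguments need no extraction of subsequences. *)
Definition ultra : set_system nat :=
  projT1 (cid (ultraFilterLemma eventually_filter)).

Lemma ultra_ultra : UltraFilter ultra.
Proof. by rewrite /ultra; case: cid => U []. Qed.

#[global] Instance ultra_properfilter : ProperFilter ultra.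
Proof. exact: (@ultra_proper _ _ ultra_ultra). Qed.

Lemma ultra_eventually : \oo `<=` ultra.
Proof. by rewrite /ultra; case: cid => U []. Qed.

Lemma near_ultra (P : nat -> Prop) :
  (\forall k \near \oo, P k) -> \forall k \near ultra, P k.
Proof. exact: ultra_eventually. Qed.

(** * Compactness and existence of minimizers along the ultrafilter *)

Section Ultra.
Context {R : realType}.

Lemma cvg_ultra {T : topologicalType} (a : nat -> T) (x : T) :
  a @ \oo --> x -> a @ ultra --> x.
Proof. by move=> ax A /ax; exact: ultra_eventually. Qed.

(** Closed Euclidean balls are compact, so the image of [ultra] clusters inside the ball, and an
    ultrafilter converges to each of its cluster points. *)
Lemma bounded_cvg_ultra {n} (a : nat -> 'rV[R]_n) (C : R) :
  (\forall k \near ultra, enorm (a k) <= C) ->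
  exists2 x : 'rV[R]_n, a @ ultra --> x & enorm x <= C.
Proof.
move=> aC.
have cpt : compact [set x : 'rV[R]_n | enorm x <= C].
  apply: bounded_closed_compact.
    exists C; split; first exact: num_real.
    by move=> M CM x /= xC; rewrite (le_trans (norm_le_enorm x))// (le_trans xC)// ltW.
  rewrite closedE => x /= h; apply: contrapT => /negP; rewrite -ltNge => Cx; apply: h.
  apply/nbhs_enormP; exists (enorm x - C); first by rewrite subr_gt0.
  move=> y yx /=; apply/negP; rewrite -ltNge.
  by have := enorm_le_sub x y; rewrite enormB; lra.
have [x [xC clx]] := cpt (a @ ultra) _ aC.
exists x => // A nA; case: (in_ultra_setVsetC (a @^-1` A) ultra_ultra) => // nAa.
by have [y [? Ay]] : (~` A) `&` A !=set0 by apply: clx => //; exact: filterS nAa.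
Qed.

Lemma ultra_invn : (fun k => (k.+1%:R)^-1 : R) @ ultra --> (0 : R).
Proof. exact/cvg_ultra/cvg_harmonic. Qed.

(* The closure hypothesis also excludes [f] unbounded below, as [l] is
   arbitrary. *)
Lemma exists_minimizer {A : Type} (P : A -> Prop) (f : A -> R) :
  (exists a, P a) ->
  (forall a_ : nat -> A, (forall k, P (a_ k)) ->
     exists2 a, P a & forall l, (\forall k \near ultra, f (a_ k) <= l) -> f a <= l) ->
  exists2 a, P a & forall b, P b -> f a <= f b.
Proof.
move=> [a0 Pa0] cl; pose E := [set f a | a in P].
have [[c cE]|nlb] := pselect (has_lbound E); last first.
  have /choice[a_ Ha] : forall k : nat, exists a, P a /\ f a <= - k%:R.
    move=> k; apply: contrapT => h; apply: nlb; exists (- k%:R) => _ [a Pa <-].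
    by rewrite leNgt; apply/negP => fak; apply: h; exists a; split=> //; exact: ltW.
  have [a Pa fa] := cl a_ (fun k => (Ha k).1).
  have : f a <= f a - 1.
    apply: fa; apply: near_ultra.
    have := nbhs_infty_ger (1 - f a); apply: filterS => k fak.
    by apply: (le_trans (Ha k).2); rewrite lerNl opprB.
  lra.
have infE : has_inf E by split; [exists (f a0), a0|exists c].
have /choice[a_ Ha] : forall k : nat, exists a, P a /\ f a <= inf E + k.+1%:R^-1.
  move=> k; have k0 : 0 < (k.+1%:R^-1 : R) by rewrite invr_gt0.
  have [_ [a Pa <-] fa] := inf_adherent k0 infE.
  by exists a; split=> //; exact: ltW.
have [a Pa fa] := cl a_ (fun k => (Ha k).1).
exists a => // b Pb; apply: (@le_trans _ _ (inf E)); last first.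
  by apply: ge_inf; [exists c|exists b].
apply/ler_addgt0Pr => e e0; apply: fa.
apply: filterS (cvg_real_near ultra_invn e0) => k.
rewrite subr0 => ke; apply: (le_trans (Ha k).2); rewrite lerD2l.
by rewrite (le_trans (ler_norm _))// ltW.
Qed.

End Ultra.

(** * Convex subgradients and regular normals *)

Section Subdifferentials.
Context {R : realType} {n : nat}.
Implicit Types (f : 'rV[R]_n -> \bar R) (x y z v : 'rV[R]_n).

(** The subdifferential of convex analysis. For proper l.s.c. convex functions it agrees with
    [limiting_subdiff] and spares the sequences of that definition. *)
Definition csub f z : set 'rV[R]_n :=
  [set y | (f z < +oo)%E /\ forall z', (f z + (inner y (z' - z))%:E <= f z')%E].

Lemma fin_domE f x : f x != -oo%E -> (f x < +oo)%E -> f x = (fine (f x))%:E.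
Proof. by move=> fN fP; rewrite fineK// fin_real// ltNye fN. Qed.

Lemma lsc_cvg {T : Type} {F : set_system T} {FF : ProperFilter F} f
    (a : T -> 'rV[R]_n) z (r : T -> R) (l : R) :
  lower_semicontinuous f -> a @ F --> z -> r @ F --> l ->
  (\forall t \near F, (f (a t) <= (r t)%:E)%E) -> (f z <= l%:E)%E.
Proof.
move=> fl az rl far; rewrite leNgt; apply/negP => lf.
have [c lc cf] : exists2 c : R, l < c & (c%:E < f z)%E.
  case: (f z) lf => [s||]//; rewrite ?lte_fin => ls.
    by exists ((l + s) / 2); rewrite ?lte_fin; lra.
  by exists (l + 1); rewrite ?ltry//; lra.
have [V zV Vc] := fl z c cf.
have lc0 : 0 < c - l by rewrite subr_gt0.
pose proof (cvg_real_near rl lc0) as h.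
have hV : \forall t \near F, V (a t) by exact: az.
case: (filter_ex (filterI (filterI h hV) far)) => t [[ht hVt] hft].
have := lt_le_trans (Vc _ hVt) hft; rewrite lte_fin => crt.
by move: ht; rewrite ltr_norml => /andP[_]; lra.
Qed.

(** The liminf of the quotient is unfolded and the denominator multiplied out; in this form the
    inequality is trivial at [y = x] and wherever [f] is infinite. *)
Lemma regular_subdiffP f x v : (forall y, f y != -oo%E) ->
  regular_subdiff f x v <->
  (f x < +oo)%E /\ forall e : R, 0 < e -> exists2 d : R, 0 < d &
    forall y, enorm (y - x) < d ->
      (f x + (inner v (y - x) - e * enorm (y - x))%:E <= f y)%E.
Proof.
move=> fN; split=> [[fx h]|[fx h]]; split=> //.
  move=> e e0; move: h; rewrite limf_einfE => h.
  have : (- e%:E < ereal_sup [set ereal_inf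
     ((fun y => (f y - f x - (inner v (y - x))%:E) * ((enorm (y - x))^-1)%:E)%E @` V)
     | V in x^'])%E by rewrite (lt_le_trans _ h)// -EFinN lte_fin; lra.
  move=> /ereal_sup_gt[_ [V xV <-]] eV.
  have [d d0 dV] : exists2 d : R, 0 < d &
      forall y, enorm (y - x) < d -> y != x -> V y by move: xV => /nbhs_enormP.
  exists d => // y yd; have [->|yx] := eqVneq y x.
    by rewrite subrr inner0r enorm0 mulr0 subr0 adde0.
  have yx0 : 0 < enorm (y - x) by rewrite enorm_gt0// subr_eq0.
  have := lt_le_trans eV (ereal_inf_lbound _); move=> /(_ _ (ex_intro2 _ _ y (dV y yd yx) erefl)).
  rewrite (fin_domE (fN x) fx).
  case: (f y) (fN y) => [s||]// _; last by rewrite leey.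
  rewrite -!EFinN -!EFinD -EFinM lte_fin lee_fin ltr_pdivlMr//; lra.
rewrite limf_einfE; apply/lee_addgt0Pr => e e0.
have [d d0 hd] := h e e0.
rewrite -leeBlDr// sub0e; apply: le_trans (ereal_sup_ubound _); last first.
  exists [set y | enorm (y - x) < d /\ y != x]; last by [].
  by apply/nbhs_enormP; exists d.
apply: le_ereal_inf_tmp => _ [y /= [yd yx] <-].
have yx0 : 0 < enorm (y - x) by rewrite enorm_gt0// subr_eq0.
have := hd y yd; rewrite (fin_domE (fN x) fx).
case: (f y) (fN y) => [s||]// _.
  by rewrite -!EFinN -!EFinD -EFinM !lee_fin ler_pdivlMr//; lra.
move=> _; rewrite -!EFinN !addye// mulyr gtr0_sg ?invr_gt0// mul1e.
by rewrite leey.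
Qed.

Lemma limiting_subdiffP f x v : (forall y, f y != -oo%E) ->
  limiting_subdiff f x v <->
  (f x < +oo)%E /\ forall e : R, 0 < e -> exists x' v',
    [/\ enorm (x' - x) < e, `|fine (f x') - fine (f x)| < e,
        regular_subdiff f x' v' & enorm (v' - v) < e].
Proof.
move=> fN; split=> [[fx [x_ [v_ [xx fxx reg vv]]]]|[fx h]]; split=> //.
  move=> e e0.
  have ff : (fun k => fine (f (x_ k))) @ \oo --> fine (f x).
    apply: fine_cvg; rewrite -(fin_domE (fN x) fx); exact: fxx.
  case: (filter_ex (filterI (filterI (cvg_enorm_near xx e0)
    (cvg_real_near ff e0)) (cvg_enorm_near vv e0))) => k [[h1 h2] h3].
  by exists (x_ k), (v_ k).
have /choice[p Hp] : forall k : nat, exists p : 'rV[R]_n * 'rV[R]_n,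
    [/\ enorm (p.1 - x) < k.+1%:R^-1, `|fine (f p.1) - fine (f x)| < k.+1%:R^-1,
        regular_subdiff f p.1 p.2 & enorm (p.2 - v) < k.+1%:R^-1].
  move=> k; have [|x' [v' H]] := h k.+1%:R^-1; first by rewrite invr_gt0.
  by exists (x', v').
exists (fun k => (p k).1), (fun k => (p k).2); split.
- apply: cvg_enorm0 (@cvg_harmonic R) => k.
  by have [/ltW] := Hp k.
- rewrite (_ : (fun k => f (p k).1) = (fun k => (fine (f (p k).1))%:E)); last first.
    by apply/funext => k; have [_ _ [? _] _] := Hp k; exact: fin_domE.
  rewrite (fin_domE (fN x) fx); apply: cvg_EFin; first exact: nearW.
  apply/cvg_realP => e e0; apply: filterS (cvg_real_near (@cvg_harmonic R) e0) => k.
  rewrite subr0 /harmonic => ke; have [_ h2 _ _] := Hp k.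
  by apply: (lt_trans h2); apply: le_lt_trans (ler_norm _) ke.
- by move=> k; have [] := Hp k.
- apply: cvg_enorm0 (@cvg_harmonic R) => k.
  by have [_ _ _ /ltW] := Hp k.
Qed.

Lemma csub_regular f z y : (forall x, f x != -oo%E) -> csub f z y -> regular_subdiff f z y.
Proof.
move=> fN [fz h]; apply/(regular_subdiffP _ _ fN); split=> // e e0.
exists 1 => // z' _; apply: le_trans (h z'); rewrite leeD2l// lee_fin.
by rewrite gerBl mulr_ge0 ?enorm_ge0 ?ltW.
Qed.

Lemma regular_limiting f x v : (forall x, f x != -oo%E) ->
  regular_subdiff f x v -> limiting_subdiff f x v.
Proof.
move=> fN reg; apply/(limiting_subdiffP _ _ fN); split; first by case: reg.
by move=> e e0; exists x, v; rewrite !subrr enorm0 normr0.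
Qed.

(** Tested at a fixed [z'] of the domain, the subgradient inequality bounds [f (z_ t)] by a
    convergent real sequence, and lower semicontinuity passes the bound to the limit. The same test
    at one point of the domain shows that [f z] is finite. *)
Lemma csub_cvg {T : Type} {F : set_system T} {FF : ProperFilter F} f
    (z_ y_ : T -> 'rV[R]_n) z y :
  proper_fun f -> lower_semicontinuous f -> z_ @ F --> z -> y_ @ F --> y ->
  (\forall t \near F, csub f (z_ t) (y_ t)) -> csub f z y.
Proof.
move=> [fN [z0 fz0]] fl zz yy h.
have key z' : (f z' < +oo)%E -> (f z + (inner y (z' - z))%:E <= f z')%E.
  move=> fz'; rewrite (fin_domE (fN z') fz') -leeBrDr// -EFinB.
  apply: (lsc_cvg (r := fun t => fine (f z') - inner (y_ t) (z' - z_ t)) fl zz).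
    by apply: cvgB; [exact: cvg_cst|apply: cvg_inner => //; apply: cvgB => //; exact: cvg_cst].
  apply: filterS h => t [ft /(_ z')].
  by rewrite {1}(fin_domE (fN z') fz') -leeBrDr// -EFinB.
have fz : (f z < +oo)%E.
  have := key z0 fz0; rewrite (fin_domE (fN z0) fz0).
  by case: (f z) => [s||]//; rewrite ?ltry// addye.
split=> // z'; have [fz'|] := boolP (f z' < +oo)%E; first exact: key.
by rewrite -leNgt leye_eq => /eqP ->; rewrite leey.
Qed.

(** The local inequality is used at [z + t *: (z' - z)] for a small [t], compared with convexity
    along the segment, and divided by [t]. *)
Lemma convex_regular_csub f z y : (forall x, f x != -oo%E) -> convex_fun_on setT f ->
  regular_subdiff f z y -> csub f z y.
Proof.
move=> fN fc /(regular_subdiffP _ _ fN)[fz h]; split=> // z'.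
have [|] := boolP (f z' < +oo)%E; last first.
  by rewrite -leNgt leye_eq => /eqP ->; rewrite leey.
move=> fz'; rewrite (fin_domE (fN z) fz) (fin_domE (fN z') fz') -EFinD lee_fin.
apply/ler_addgt0Pr => e e0.
pose D := enorm (z' - z); have D0 : 0 <= D := enorm_ge0 _.
have e1 : 0 < e / (D + 1) by rewrite divr_gt0// ltr_wpDl.
have [d d0 hd] := h _ e1.
(* The halving makes [t * D < d] strict, and [D + 1] in place of [D] allows [z' = z]. The matching
   error [e / (D + 1)] becomes at most [e] once multiplied by [D]. *)
pose t := Num.min 1 (d / (D + 1) / 2).
have t0 : 0 < t by rewrite lt_min ltr01/= !divr_gt0// ltr_wpDl.
have t1 : t <= 1 by rewrite ge_min lexx.
have td : t * D < d.
  have : t * (D + 1) <= d / 2.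
    by rewrite -ler_pdivlMr ?ltr_wpDl// mulrAC ge_min lexx orbT.
  have : t * D <= t * (D + 1) by rewrite ler_wpM2l ?ltW//; lra.
  lra.
have E : z + t *: (z' - z) = t *: z' + (1 - t) *: z.
  by rewrite scalerBr scalerBl scale1r addrCA addrC -addrA addrC.
have H1 := hd (z + t *: (z' - z)); rewrite addrAC subrr add0r enormZ gtr0_norm// in H1.
have {}H1 := H1 td; rewrite innerZr in H1.
have H2 := fc z' z t I I; rewrite ltW// t1 -E in H2; have {}H2 := H2 isT.
have := le_trans H1 H2.
rewrite (fin_domE (fN z) fz) (fin_domE (fN z') fz') -!EFinM -!EFinD lee_fin -/D => H3.
have eD : e / (D + 1) * D <= e.
  by rewrite mulrAC ler_pdivrMr ?ltr_wpDl// ler_wpM2l ?ltW//; lra.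
rewrite -(ler_pM2l t0); nra.
Qed.

Lemma convex_limiting_subdiffE f : proper_fun f -> lower_semicontinuous f ->
  convex_fun_on setT f -> limiting_subdiff f = csub f.
Proof.
move=> fp fl fc; have fN := fp.1; apply/funext => z; apply/predeqP => y; split.
  move=> [fz [z_ [y_ [zz _ reg yy]]]].
  apply: (csub_cvg fp fl zz yy); apply: nearW => k.
  exact: convex_regular_csub.
by move=> zy; apply: regular_limiting => //; exact: csub_regular.
Qed.

Lemma singular_of_near f x v : (forall y, f y != -oo%E) -> (f x < +oo)%E ->
  (forall e : R, 0 < e -> exists x' v' l,
    [/\ enorm (x' - x) < e, `|fine (f x') - fine (f x)| < e,
        regular_subdiff f x' v', 0 < l < e & enorm (l *: v' - v) < e]) ->
  singular_subdiff f x v.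
Proof.
move=> fN fx h; split=> //.
have /choice[p Hp] : forall k : nat, exists p : 'rV[R]_n * 'rV[R]_n * R,
    [/\ enorm (p.1.1 - x) < k.+1%:R^-1, `|fine (f p.1.1) - fine (f x)| < k.+1%:R^-1,
        regular_subdiff f p.1.1 p.1.2, 0 < p.2 < k.+1%:R^-1 &
        enorm (p.2 *: p.1.2 - v) < k.+1%:R^-1].
  move=> k; have [|x' [v' [l H]]] := h k.+1%:R^-1; first by rewrite invr_gt0.
  by exists (x', v', l).
exists (fun k => (p k).1.1), (fun k => (p k).1.2), (fun k => (p k).2); split.
- apply: cvg_enorm0 (@cvg_harmonic R) => k.
  by have [/ltW] := Hp k.
- rewrite (_ : (fun k => f (p k).1.1) = (fun k => (fine (f (p k).1.1))%:E)); last first.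
    by apply/funext => k; have [_ _ [? _] _ _] := Hp k; exact: fin_domE.
  rewrite (fin_domE (fN x) fx); apply: cvg_EFin; first exact: nearW.
  apply/cvg_realP => e e0; apply: filterS (cvg_real_near (@cvg_harmonic R) e0) => k.
  rewrite subr0 /harmonic => ke; have [_ h2 _ _ _] := Hp k.
  by apply: (lt_trans h2); apply: le_lt_trans (ler_norm _) ke.
- split; first by move=> k; have [_ _ _ /andP[]] := Hp k.
  apply/cvg_realP => e e0; apply: filterS (cvg_real_near (@cvg_harmonic R) e0) => k.
  rewrite !subr0 /harmonic => ke; have [_ _ _ /andP[l0 lk] _] := Hp k.
  by rewrite gtr0_norm//; apply: (lt_trans lk); apply: le_lt_trans (ler_norm _) ke.
- by move=> k; have [] := Hp k.
- apply: cvg_enorm0 (@cvg_harmonic R) => k.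
  by have [_ _ _ _ /ltW] := Hp k.
Qed.

End Subdifferentials.

(** * Normal cones to subdifferential graphs *)

Section Normals.
Context {R : realType}.

Lemma inner_row_mx {n m} (a c : 'rV[R]_n) (b d : 'rV[R]_m) :
  inner (row_mx a b) (row_mx c d) = inner a c + inner b d.
Proof.
rewrite /inner big_split_ord; congr (_ + _); apply: eq_bigr => i _.
  by rewrite !row_mxEl.
by rewrite !row_mxEr.
Qed.

Lemma sqr_enorm_row_mx {n m} (a : 'rV[R]_n) (b : 'rV[R]_m) :
  enorm (row_mx a b) ^+ 2 = enorm a ^+ 2 + enorm b ^+ 2.
Proof. by rewrite !sqr_enorm inner_row_mx. Qed.

Lemma enorm_row_mx_le {n m} (a : 'rV[R]_n) (b : 'rV[R]_m) :
  enorm (row_mx a b) <= enorm a + enorm b.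
Proof.
rewrite -ler_sqr ?nnegrE ?addr_ge0 ?enorm_ge0// sqr_enorm_row_mx.
by have := enorm_ge0 a; have := enorm_ge0 b; nra.
Qed.

Lemma enorm_row_mx_gel {n m} (a : 'rV[R]_n) (b : 'rV[R]_m) : enorm a <= enorm (row_mx a b).
Proof.
by rewrite -ler_sqr ?nnegrE ?enorm_ge0// sqr_enorm_row_mx lerDl sqr_ge0.
Qed.

Lemma enorm_row_mx_ger {n m} (a : 'rV[R]_n) (b : 'rV[R]_m) : enorm b <= enorm (row_mx a b).
Proof.
by rewrite -ler_sqr ?nnegrE ?enorm_ge0// sqr_enorm_row_mx lerDr sqr_ge0.
Qed.

(** For an indicator function, finiteness of the value at [x'] already means that [x'] lies in the
    set, and the values then agree. *)
Lemma normal_coneP {n} (A : set 'rV[R]_n) x v :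
  normal_cone A x v <->
  A x /\ forall e : R, 0 < e -> exists x' v',
    [/\ enorm (x' - x) < e, A x', enorm (v' - v) < e &
        forall e', 0 < e' -> exists2 d : R, 0 < d & forall y, A y -> enorm (y - x') < d ->
        inner v' (y - x') <= e' * enorm (y - x')].
Proof.
have iN : forall y, set_indicator A y != -oo%E.
  by move=> y; rewrite /set_indicator; case: ifP.
have regP x' v' : regular_subdiff (set_indicator A) x' v' <->
    A x' /\ forall e', 0 < e' -> exists2 d : R, 0 < d & forall y, A y -> enorm (y - x') < d ->
        inner v' (y - x') <= e' * enorm (y - x').
  apply: (iff_trans (regular_subdiffP _ _ iN)).
  split=> [[Ax h]|[Ax h]].
    have {}Ax : A x' by move: Ax; rewrite /set_indicator; case: ifP => // /set_mem.
    split=> // e e0; have [d d0 hd] := h e e0; exists d => // y Ay yd.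
    by have := hd y yd; rewrite /set_indicator !mem_set// add0e lee_fin subr_le0.
  split=> [|e e0]; first by rewrite /set_indicator mem_set// ltry.
  have [d d0 hd] := h e e0; exists d => // y yd.
  rewrite /set_indicator mem_set// add0e; case: ifPn => [/set_mem Ay|_]; last by rewrite leey.
  by rewrite lee_fin subr_le0 hd.
apply: (iff_trans (limiting_subdiffP _ _ iN)).
split=> [[Ax h]|[Ax h]].
  have {}Ax : A x by move: Ax; rewrite /set_indicator; case: ifP => // /set_mem.
  split=> // e e0; have [x' [v' [h1 _ /regP[h2 h3] h4]]] := h e e0.
  by exists x', v'.
split=> [|e e0]; first by rewrite /set_indicator mem_set// ltry.
have [x' [v' [h1 h2 h3 h4]]] := h e e0; exists x', v'; split=> //; last exact/regP.
by rewrite /set_indicator !mem_set// subrr normr0.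
Qed.

Context {m : nat}.
Implicit Types (f : 'rV[R]_m -> \bar R) (p q u w : 'rV[R]_m).

(* [(u, - w)] is a regular normal to the graph of [csub f] at [(p, q)]. *)
Definition reg_conormal f p q u w : Prop :=
  csub f p q /\ forall e : R, 0 < e -> exists2 d : R, 0 < d &
    forall p' q', csub f p' q' -> enorm (p' - p) < d -> enorm (q' - q) < d ->
      inner u (p' - p) - inner w (q' - q) <= e * (enorm (p' - p) + enorm (q' - q)).

(** The Euclidean norm of a pair and the sum of the norms of its halves bound each other, so
    neighbourhoods and remainders can be treated component by component. The sign in
    [row_mx u (- w)] is absorbed by [reg_conormal]. *)
Lemma second_subdiffP f z y w u :
  proper_fun f -> lower_semicontinuous f -> convex_fun_on setT f ->
  second_subdiff f z y w u <->
  csub f z y /\ forall e : R, 0 < e -> exists p q u' w',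
    [/\ enorm (p - z) < e, enorm (q - y) < e, reg_conormal f p q u' w',
        enorm (u' - u) < e & enorm (w' - w) < e].
Proof.
move=> fp fl fc; rewrite /second_subdiff /mkset (convex_limiting_subdiffE fp fl fc).
set A := [set row_mx p.1 p.2 | p in gph (csub f)].
have AP p q : A (row_mx p q) <-> csub f p q.
  split=> [[[p' q'] /= pq' /eq_row_mx[<- <-]]//|pq].
  by exists (p, q).
have subE (p q p' q' : 'rV[R]_m) : row_mx p q - row_mx p' q' = row_mx (p - p') (q - q').
  by rewrite opp_row_mx add_row_mx.
apply: (iff_trans (normal_coneP _ _ _)).
split=> [[/AP zy h]|[zy h]]; split=> //; try exact/AP.
  move=> e e0; have [x' [v' [h1 [[p q] /= pq E] h2 h3]]] := h e e0.
  rewrite -E in h1 h3.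
  have Ev : v' = row_mx (lsubmx v') (- (- rsubmx v')) by rewrite opprK hsubmxK.
  exists p, q, (lsubmx v'), (- rsubmx v').
  move: h1; rewrite subE => h1.
  rewrite Ev subE in h2.
  split.
  - exact: le_lt_trans (enorm_row_mx_gel _ _) h1.
  - exact: le_lt_trans (enorm_row_mx_ger _ _) h1.
  - split=> // e' e'0; have [d d0 hd] := h3 e' e'0.
    exists (d / 2); first by rewrite divr_gt0.
    move=> p' q' pq' pd qd.
    have := hd (row_mx p' q') ((AP p' q').2 pq'); rewrite subE => H.
    apply: (@le_trans _ _ (e' * enorm (row_mx (p' - p) (q' - q)))); last first.
      by rewrite (ler_wpM2l (ltW e'0))// enorm_row_mx_le.
    have -> : inner (lsubmx v') (p' - p) - inner (- rsubmx v') (q' - q) =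
        inner v' (row_mx (p' - p) (q' - q)).
      by rewrite [in RHS]Ev inner_row_mx !innerNl.
    apply: H; apply: (le_lt_trans (enorm_row_mx_le _ _)); lra.
  - exact: le_lt_trans (enorm_row_mx_gel _ _) h2.
  - by have := le_lt_trans (enorm_row_mx_ger _ _) h2; rewrite -opprD enormN.
move=> e e0; have e20 : 0 < e / 2 by rewrite divr_gt0.
have [p [q [u' [w' [h1 h2 [h3 h4] h5 h6]]]]] := h _ e20.
exists (row_mx p q), (row_mx u' (- w')); rewrite !subE; split.
- by apply: (le_lt_trans (enorm_row_mx_le _ _)); lra.
- exact/AP.
- apply: (le_lt_trans (enorm_row_mx_le _ _)).
  by rewrite -opprD enormN; lra.
- move=> e' e'0; have e'2 : 0 < e' / 2 by rewrite divr_gt0.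
  have [d d0 hd] := h4 _ e'2; exists d => // _ [[p' q'] /= pq' <-].
  rewrite subE => pqd; rewrite inner_row_mx innerNl.
  apply: (le_trans (hd p' q' pq' _ _)).
  + exact: le_lt_trans (enorm_row_mx_gel _ _) pqd.
  + exact: le_lt_trans (enorm_row_mx_ger _ _) pqd.
  + have := enorm_row_mx_gel (p' - p) (q' - q).
    by have := enorm_row_mx_ger (p' - p) (q' - q); nra.
Qed.

Lemma reg_conormalZ f p q u w (a : R) : 0 < a ->
  reg_conormal f p q u w -> reg_conormal f p q (a *: u) (a *: w).
Proof.
move=> a0 [pq h]; split=> // e e0.
have [|d d0 hd] := h (e / a); first by rewrite divr_gt0.
exists d => // p' q' pq' pd qd; have := hd p' q' pq' pd qd.
rewrite !innerZl -mulrBr -(ler_pM2l a0) => /le_trans; apply.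
by rewrite mulrA (mulrC a) divfK ?gt_eqF.
Qed.

End Normals.

(** * Gradients of C^2 functions *)

Section Gradients.
Context {R : realType} {n : nat}.
Implicit Types (f h : 'rV[R]_n -> R) (x s d w : 'rV[R]_n).

Definition has_grad f x s : Prop := forall e : R, 0 < e ->
  exists2 r : R, 0 < r &
    forall d, enorm d < r -> `|f (x + d) - f x - inner s d| <= e * enorm d.

Lemma has_gradD f h x s t : has_grad f x s -> has_grad h x t ->
  has_grad (fun y => f y + h y) x (s + t).
Proof.
move=> fs ht e e0; have e2 : 0 < e / 2 by rewrite divr_gt0.
have [r r0 hr] := fs _ e2; have [r' r'0 hr'] := ht _ e2.
exists (Num.min r r'); first by rewrite lt_min r0.
move=> d; rewrite lt_min => /andP[/hr hd /hr' hd'].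
have -> : f (x + d) + h (x + d) - (f x + h x) - inner (s + t) d =
  (f (x + d) - f x - inner s d) + (h (x + d) - h x - inner t d) by rewrite innerDl; ring.
by rewrite (le_trans (ler_normD _ _))//; lra.
Qed.

Lemma has_grad_cst (c : R) x : has_grad (fun=> c) x 0.
Proof.
move=> e e0; exists 1 => // d _.
by rewrite inner0l subrr subr0 normr0 mulr_ge0 ?enorm_ge0// ltW.
Qed.

Lemma has_gradZ (a : R) f x s : has_grad f x s -> has_grad (fun y => a * f y) x (a *: s).
Proof.
move=> fs e e0; have a0 : 0 < `|a| + 1 by rewrite ltr_wpDl.
have [|r r0 hr] := fs (e / (`|a| + 1)); first by rewrite divr_gt0.
exists r => // d /hr hd.
rewrite innerZl -!mulrBr normrM; apply: (le_trans (ler_wpM2l (normr_ge0 a) hd)).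
rewrite mulrA ler_wpM2r ?enorm_ge0// mulrCA -[leRHS]mulr1 (ler_wpM2l (ltW e0))//.
by rewrite ler_pdivrMr//; lra.
Qed.

Lemma has_grad_sum (I : Type) (r : seq I) (f : I -> 'rV[R]_n -> R) x (s : I -> 'rV[R]_n) :
  (forall i, has_grad (f i) x (s i)) ->
  has_grad (fun y => \sum_(i <- r) f i y) x (\sum_(i <- r) s i).
Proof.
move=> fs; elim: r => [|i r ih].
  by rewrite (_ : (fun _ => _) = fun=> 0); [rewrite big_nil; exact: has_grad_cst
    |apply/funext => y; rewrite big_nil].
rewrite (_ : (fun _ => _) = fun y => f i y + \sum_(j <- r) f j y).
  by rewrite big_cons; exact: has_gradD.
by apply/funext => y; rewrite big_cons.
Qed.

Lemma has_grad_inner s x : has_grad (inner s) x s.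
Proof.
move=> e e0; exists 1 => // d _.
have -> : inner s (x + d) - inner s x - inner s d = 0 by rewrite innerDr; ring.
by rewrite normr0 mulr_ge0 ?enorm_ge0// ltW.
Qed.

Lemma has_grad_sqr f x s : has_grad f x s ->
  has_grad (fun y => f y ^+ 2) x ((2 * f x) *: s).
Proof.
move=> fs e e0; pose a : R := 2 * `|f x|; pose N : R := enorm s.
have a0 : 0 <= a by rewrite mulr_ge0.
have N0 : 0 <= N := enorm_ge0 s.
have [|r1 r10 hr1] := fs 1; first by [].
have [|r2 r20 hr2] := fs (e / 2 / (a + 1)); first by rewrite !divr_gt0// ltr_wpDl.
pose r3 := e / 2 / (1 + N) ^+ 2.
have r30 : 0 < r3 by rewrite !divr_gt0// exprn_gt0// ltr_wpDr.
exists (Num.min r1 (Num.min r2 r3)); first by rewrite !lt_min r10 r20.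
move=> d; rewrite !lt_min => /and3P[/hr1 h1 /hr2 h2 d3].
pose D := enorm d; have D0 : 0 <= D := enorm_ge0 d.
pose b := f (x + d) - f x.
have -> : f (x + d) ^+ 2 - f x ^+ 2 - inner ((2 * f x) *: s) d =
   2 * f x * (b - inner s d) + b ^+ 2 by rewrite innerZl /b; ring.
have bD : `|b| <= (1 + N) * D.
  have -> : b = (f (x + d) - f x - inner s d) + inner s d by rewrite subrK.
  rewrite (le_trans (ler_normD _ _))//.
  by have := inner_CS s d; rewrite -/N -/D; rewrite -/D in h1; lra.
rewrite (le_trans (ler_normD _ _))// expr2 !normrM (ger0_norm (ler0n _ 2)) -/a.
have H1 : a * `|b - inner s d| <= e / 2 * D.
  apply: (le_trans (ler_wpM2l a0 h2)); rewrite mulrA ler_wpM2r//.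
  by rewrite mulrCA -[leRHS]mulr1 ler_wpM2l ?divr_ge0 ?(ltW e0)// ler_pdivrMr ?ltr_wpDl//; lra.
have H2 : `|b| * `|b| <= e / 2 * D.
  apply: (@le_trans _ _ (((1 + N) * D) * ((1 + N) * D))); first by rewrite ler_pM.
  rewrite mulrA ler_wpM2r//.
  move: d3 => /ltW; rewrite -/D /r3 ler_pdivlMr ?exprn_gt0 ?ltr_wpDr//.
  by move=> /(le_trans _); apply; rewrite expr2; nra.
by rewrite -/D; lra.
Qed.

Lemma has_grad_sqr_dist (c x : 'rV[R]_n) :
  has_grad (fun y => enorm (y - c) ^+ 2) x (2 *: (x - c)).
Proof.
move=> e e0; exists e => // d /ltW de.
rewrite !sqr_enorm (addrAC x d); move: (x - c) => z.
have -> : inner (z + d) (z + d) - inner z z - inner (2 *: z) d = inner d d.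
  by rewrite !innerE (innerC d z); ring.
by rewrite -sqr_enorm expr2 ger0_norm ?mulr_ge0 ?enorm_ge0// ler_wpM2r ?enorm_ge0.
Qed.

(* Fermat's rule, up to a Lipschitz perturbation of rank [e]. *)
Lemma has_grad_min f x s (e r : R) : 0 <= e -> 0 < r -> has_grad f x s ->
  (forall d, enorm d < r -> f x <= f (x + d) + e * enorm d) -> enorm s <= e.
Proof.
move=> e0 r0 fs h; apply/ler_addgt0Pr => c c0.
have [r' r'0 hr'] := fs _ c0.
rewrite leNgt; apply/negP => es; have S0 : 0 < enorm s by lra.
(* The test direction is [- s], scaled to half the smaller radius so that both strict bounds
   apply. *)
pose t := Num.min r r' / 2 / enorm s.
have t0 : 0 < t by rewrite !divr_gt0// lt_min r0.
have E : enorm (- (t *: s)) = Num.min r r' / 2.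
  by rewrite enormN enormZ gtr0_norm// /t divfK ?gt_eqF.
have m0 : 0 < Num.min r r' by rewrite lt_min r0.
have m1 : Num.min r r' <= r by rewrite ge_min lexx.
have m2 : Num.min r r' <= r' by rewrite ge_min lexx orbT.
have mr : Num.min r r' / 2 < r by lra.
have mr' : Num.min r r' / 2 < r' by lra.
have H1 := h (- (t *: s)); rewrite E in H1; have {}H1 := H1 mr.
have H2 := hr' (- (t *: s)); rewrite E in H2; have {}H2 := H2 mr'.
move: H2; rewrite innerNr innerZr -sqr_enorm ler_norml => /andP[_ H2].
have E2 : t * enorm s = Num.min r r' / 2 by rewrite /t divfK ?gt_eqF.
have H3 : t * enorm s ^+ 2 <= (e + c) * (t * enorm s) by rewrite E2; lra.
have : (e + c) * (t * enorm s) < t * enorm s ^+ 2.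
  rewrite expr2 (mulrCA (e + c)) ltr_pM2l// ltr_pM2r//.
by rewrite ltNge H3.
Qed.

Lemma has_grad_line f (G : 'rV[R]_n -> 'rV[R]_n) x d (t : R) :
  (forall y, has_grad f y (G y)) ->
  is_derive t 1 (fun t => f (x + t *: d)) (inner (G (x + t *: d)) d).
Proof.
move=> fG; set l := inner _ _.
have lim : (fun h : R => h^-1 *: (((fun t => f (x + t *: d)) \o shift t) (h *: 1) -
   f (x + t *: d))) @ 0^' --> l.
  apply/cvgrPdist_le => e e0; pose D := enorm d.
  have D1 : 0 < D + 1 by rewrite ltr_wpDl ?enorm_ge0.
  have [|r r0 hr] := fG (x + t *: d) (e / (D + 1)); first by rewrite divr_gt0.
  near=> h.
  have h0 : h != 0 by near: h; exact: nbhs_dnbhs_neq.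
  have hr0 : `|h| < r / (D + 1).
    by near: h; apply: dnbhs0_lt; rewrite divr_gt0.
  have := hr (h *: d); rewrite enormZ -/D => H.
  have {}H := H _; rewrite /= /shift/= [h *: 1]mulr1 scalerDl (addrC (h *: d)) addrA.
  have hD : `|h| * D < r.
    apply: (@le_lt_trans _ _ (`|h| * (D + 1))); first by rewrite ler_wpM2l//; lra.
    by rewrite -ltr_pdivlMr.
  have {}H := H hD; rewrite innerZr -/l in H.
  set F := f _ - f _ in H *.
  have -> : l - h^-1 *: F = - (h^-1 * (F - h * l)).
    by rewrite -[h^-1 *: F]/(h^-1 * F); field.
  rewrite normrN normrM normfV mulrC ler_pdivrMr ?normr_gt0//.
  apply: (le_trans H); rewrite (mulrC `|h|) mulrA ler_wpM2r//.
  rewrite mulrAC ler_pdivrMr// (ler_wpM2l (ltW e0))//; lra.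
apply: DeriveDef; first by apply/cvg_ex; exists l.
exact: cvg_lim lim.
Unshelve. all: by end_near. Qed.

Lemma mean_value f (G : 'rV[R]_n -> 'rV[R]_n) x y :
  (forall z, has_grad f z (G z)) ->
  exists2 t : R, 0 <= t <= 1 & f y - f x = inner (G (x + t *: (y - x))) (y - x).
Proof.
move=> fG.
have [||t] := @MVT_segment R (fun t => f (x + t *: (y - x)))
    (fun t => inner (G (x + t *: (y - x))) (y - x)) 0 1 ler01.
- by move=> t _; exact: has_grad_line.
- apply: derivable_within_continuous => t _.
  by have [] := has_grad_line x (y - x) t fG.
rewrite in_itv/= => t01; rewrite scale1r scale0r addr0 subr0 mulr1 (addrC x (y - x)) subrK => ->.
by exists t.
Qed.

Lemma differentiable_has_grad f x : differentiable f x -> has_grad f x (grad f x).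
Proof.
move=> fx e e0.
have dE d : 'd f x d = inner (grad f x) d.
  rewrite {1}(matrix_sum_delta d) big_ord1 linear_sum /inner; apply: eq_bigr => i _.
  by rewrite linearZ/= !mxE /pderiv deriveE// mulrC.
have /diff_locallyP[_ /eqaddoP/(_ (e / n.+1%:R))] := fx.
rewrite divr_gt0// => /(_ isT) /nbhs_enormP[r r0 hr].
exists r => // d dr; have := hr d; rewrite subr0 => /(_ dr).
rewrite /= !fctE/= /shift/= -dE (addrC d) opprD addrA => h.
apply: (le_trans h); rewrite mulrAC ler_pdivrMr//.
rewrite -mulrA (ler_wpM2l (ltW e0))// mulrC.
apply: (le_trans (norm_le_enorm d)).
by rewrite ler_peMl ?enorm_ge0// ler1n.
Qed.

Lemma C2_has_grad f x : C2 f -> has_grad f x (grad f x).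
Proof. by case=> df _ _; exact: differentiable_has_grad. Qed.

Lemma C2_has_grad2 f x i : C2 f -> has_grad (pderiv i f) x (grad (pderiv i f) x).
Proof. by case=> _ df _; exact: differentiable_has_grad. Qed.

(** The entry [(i, j)] of [hessian] differentiates the [j]-th partial in direction [i], so combining
    the gradients of the partials with the weights [w] produces the transpose. *)
Lemma has_grad_inner_grad f x w : C2 f ->
  has_grad (fun y => inner w (grad f y)) x (w *m (hessian f x)^T).
Proof.
move=> f2.
have -> : w *m (hessian f x)^T = \sum_j w 0 j *: grad (pderiv j f) x.
  apply/rowP => i; rewrite mxE summxE; apply: eq_bigr => j _; by rewrite !mxE.
have -> : (fun y => inner w (grad f y)) = fun y => \sum_j w 0 j * pderiv j f y.
  by apply/funext => y; apply: eq_bigr => j _; rewrite mxE.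
by apply: has_grad_sum => j; apply/has_gradZ/C2_has_grad2.
Qed.

Lemma has_grad_continuous f x s : has_grad f x s -> f @ x --> f x.
Proof.
move=> fs; apply/(@cvg_realP R _ (nbhs x) (nbhs_filter x)) => e e0.
have [|r r0 hr] := fs 1; first by [].
have S : 0 < enorm s + 1 by rewrite ltr_wpDl ?enorm_ge0.
apply/nbhs_enormP; exists (Num.min r (e / (enorm s + 1))).
  by rewrite lt_min r0 divr_gt0.
move=> y; rewrite lt_min => /andP[yr]; rewrite ltr_pdivlMr// => ye.
have := hr _ yr; rewrite (addrC x (y - x)) subrK => h.
have -> : f y - f x = (f y - f x - inner s (y - x)) + inner s (y - x) by rewrite subrK.
apply: le_lt_trans ye; rewrite (le_trans (ler_normD _ _))//.
by have := inner_CS s (y - x); lra.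
Qed.

Lemma C2_grad_continuous f x : C2 f -> grad f @ x --> grad f x.
Proof.
move=> f2; apply: (@cvg_row R _ (nbhs x) (nbhs_filter x)) => i.
under eq_fun do rewrite mxE; rewrite mxE.
exact: has_grad_continuous (C2_has_grad2 x i f2).
Qed.

Lemma C2_hessian_continuous f x i j : C2 f ->
  (fun y => hessian f y i j) @ x --> hessian f x i j.
Proof. by case=> _ _ fc; under eq_fun do rewrite mxE; rewrite mxE; exact: fc. Qed.

(** By continuity, the gradients of the partial derivatives stay near [xbar] below their norms at
    [xbar] plus one. Balls being convex, the mean value theorem applies to each partial and then to
    [f], and both estimates hold with the same constant. *)
Lemma C2_local f xbar : C2 f -> exists r C : R, [/\ 0 < r, 0 <= C &
  forall x y, enorm (x - xbar) < r -> enorm (y - xbar) < r ->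
    enorm (grad f y - grad f x) <= C * enorm (y - x) /\
    `|f y - f x - inner (grad f x) (y - x)| <= C * enorm (y - x) ^+ 2].
Proof.
move=> f2.
pose B := \sum_j (enorm (grad (pderiv j f) xbar) + 1).
have B0 j : 0 <= enorm (grad (pderiv j f) xbar) + 1 by rewrite addr_ge0 ?enorm_ge0.
have [r r0 hr] : exists2 r : R, 0 < r & forall y, enorm (y - xbar) < r ->
    forall j, enorm (grad (pderiv j f) y) <= enorm (grad (pderiv j f) xbar) + 1.
  suff : \forall y \near xbar, forall j,
      enorm (grad (pderiv j f) y) <= enorm (grad (pderiv j f) xbar) + 1.
    by move=> /nbhs_enormP.
  apply: (@filter_forall _ _ (fun j y =>
    enorm (grad (pderiv j f) y) <= enorm (grad (pderiv j f) xbar) + 1) (nbhs xbar)) => j.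
  have gc : grad (pderiv j f) @ xbar --> grad (pderiv j f) xbar.
    apply: (@cvg_row R _ (nbhs xbar) (nbhs_filter xbar)) => i; under eq_fun do rewrite mxE; rewrite mxE.
    by case: f2 => _ _; exact.
  apply: filterS (cvg_enorm_near gc ltr01) => y yh.
  by apply: (le_trans (enorm_le_sub _ (grad (pderiv j f) xbar))); lra.
have seg x y (t : R) : enorm (x - xbar) < r -> enorm (y - xbar) < r -> 0 <= t <= 1 ->
    enorm (x + t *: (y - x) - xbar) < r.
  move=> xr yr /andP[t0 t1].
  have -> : x + t *: (y - x) - xbar = (1 - t) *: (x - xbar) + t *: (y - xbar).
    by apply/rowP => i; rewrite !mxE; ring.
  apply: (le_lt_trans (enormD _ _)); rewrite !enormZ !ger0_norm ?subr_ge0//.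
  have [->|t0'] := eqVneq t 0; first by rewrite mul0r addr0 subr0 mul1r.
  have {}t0' : 0 < t by rewrite lt_neqAle eq_sym t0'.
  have := ler_wpM2l (_ : 0 <= 1 - t) (ltW xr); rewrite subr_ge0 => /(_ t1).
  have : t * enorm (y - xbar) < t * r by rewrite ltr_pM2l.
  lra.
have lip x y : enorm (x - xbar) < r -> enorm (y - xbar) < r ->
    enorm (grad f y - grad f x) <= B * enorm (y - x).
  move=> xr yr; apply: (le_trans (enorm_sum_coord _)).
  rewrite /B mulr_suml; apply: ler_sum => j _; rewrite !mxE.
  have [t t01 ->] := mean_value x y (fun z => C2_has_grad2 z j f2).
  apply: (le_trans (inner_CS _ _)); rewrite ler_wpM2r ?enorm_ge0//.
  by apply: hr; exact: seg.
have BB : 0 <= B by exact: sumr_ge0.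
exists r, B; split=> // x y xr yr; split; first exact: lip.
have [t t01 ->] := mean_value x y (fun z => C2_has_grad z f2).
rewrite -innerNl -innerDl; apply: (le_trans (inner_CS _ _)).
rewrite expr2 mulrA ler_wpM2r ?enorm_ge0//.
apply: (le_trans (lip _ _ xr (seg _ _ _ xr yr t01))).
rewrite (ler_wpM2l BB)// addrC addKr enormZ ger0_norm; last by case/andP: t01.
by rewrite ler_piMl ?enorm_ge0//; case/andP: t01.
Qed.

End Gradients.

(** * Jacobians and Hessians of C^2 maps *)

Section VectorMaps.
Context {R : realType} {n m : nat}.
Variables (g : 'rV[R]_n -> 'rV[R]_m).
Hypothesis g_C2 : C2_map g.
Implicit Types (x w h : 'rV[R]_n) (y u : 'rV[R]_m).

Let gk (k : 'I_m) := fun x => g x 0 k.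

Lemma C2_map_differentiable x : differentiable g x.
Proof.
have -> : g = \sum_(k < m) (fun x => gk k x *: (delta_mx 0 k : 'rV[R]_m)).
  apply/funext => z; rewrite fct_sumE [LHS]matrix_sum_delta big_ord1.
  by apply: eq_bigr.
apply: differentiable_sum => k; apply: differentiableZl.
by have [] := g_C2 k.
Qed.

Lemma jacobianE x i k : 'J g x i k = pderiv i (gk k) x.
Proof.
have dg := C2_map_differentiable x.
have E := deriveEjacobian (delta_mx 0 i : 'rV[R]_n) dg.
have dgi : derivable g x (delta_mx 0 i) by exact: diff_derivable.
have := derive_mx dgi.
rewrite E => /rowP/(_ k); rewrite -rowE !mxE => ->.
by [].
Qed.

Lemma jac_adjE x y : jac_adj g x y = \sum_(k < m) y 0 k *: grad (gk k) x.
Proof.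
apply/rowP => i; rewrite mxE summxE; apply: eq_bigr => k _.
by rewrite [_^T k i]mxE jacobianE !mxE.
Qed.

Lemma inner_jac x w u : inner u (jac g x w) = inner (jac_adj g x u) w.
Proof.
rewrite jac_adjE /inner; under [RHS]eq_bigr do rewrite summxE mulr_suml.
rewrite exchange_big; apply: eq_bigr => k _; rewrite mxE mulr_sumr.
by apply: eq_bigr => i _; rewrite jacobianE !mxE; ring.
Qed.

Lemma jac_adjZ x (a : R) y : jac_adj g x (a *: y) = a *: jac_adj g x y.
Proof. by rewrite /jac_adj scalemxAl. Qed.

Lemma jac_adjB x y u : jac_adj g x (y - u) = jac_adj g x y - jac_adj g x u.
Proof. exact: mulmxBl. Qed.

Lemma jacZ x (a : R) w : jac g x (a *: w) = a *: jac g x w.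
Proof. by rewrite /jac scalemxAl. Qed.

Lemma hessian_inner x y :
  hessian (fun x' => inner y (g x')) x = \sum_(k < m) y 0 k *: hessian (gk k) x.
Proof.
have p1 j : pderiv j (fun x' => inner y (g x')) = \sum_(k < m) (y 0 k \*: pderiv j (gk k)).
  apply/funext => z; rewrite fct_sumE /pderiv.
  have -> : (fun x' => inner y (g x')) = \sum_(k < m) (y 0 k \*: gk k).
    by apply/funext => x'; rewrite fct_sumE.
  have dk k : derivable (y 0 k \*: gk k) z (delta_mx 0 j).
    by apply/derivableZ/diff_derivable; have [] := g_C2 k.
  rewrite derive_sum//; apply: eq_bigr => k _.
  by rewrite deriveZ//; apply: diff_derivable; have [] := g_C2 k.
apply/matrixP => i j; rewrite !mxE summxE p1 /pderiv.
have d2 k : derivable (pderiv j (gk k)) x (delta_mx 0 i).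
  by apply: diff_derivable; have [_ d2 _] := g_C2 k; exact: d2.
have dk k : derivable (y 0 k \*: pderiv j (gk k)) x (delta_mx 0 i).
  exact/derivableZ/d2.
rewrite derive_sum//; apply: eq_bigr => k _; rewrite !mxE.
by rewrite deriveZ//; exact: d2.
Qed.

Lemma cvg_g x : g @ x --> g x.
Proof.
by apply: (@cvg_row R _ (nbhs x) (nbhs_filter x)) => k; exact: has_grad_continuous (C2_has_grad x (g_C2 k)).
Qed.

Lemma cvg_jac_adj {T : Type} {F : set_system T} {FF : Filter F}
    (x_ : T -> 'rV[R]_n) (y_ : T -> 'rV[R]_m) x y :
  x_ @ F --> x -> y_ @ F --> y -> (fun t => jac_adj g (x_ t) (y_ t)) @ F --> jac_adj g x y.
Proof.
move=> xx yy; apply: cvg_mulmx => // k i.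
under eq_fun do rewrite [_^T _ _]mxE jacobianE; rewrite [_^T _ _]mxE jacobianE.
apply: (cvg_comp x_ (pderiv i (gk k)) xx).
exact: has_grad_continuous (C2_has_grad2 x i (g_C2 k)).
Qed.

Lemma cvg_jac {T : Type} {F : set_system T} {FF : Filter F}
    (x_ w_ : T -> 'rV[R]_n) x w :
  x_ @ F --> x -> w_ @ F --> w -> (fun t => jac g (x_ t) (w_ t)) @ F --> jac g x w.
Proof.
move=> xx yy; apply: cvg_mulmx => // i k.
under eq_fun do rewrite jacobianE; rewrite jacobianE.
apply: (cvg_comp x_ (pderiv i (gk k)) xx).
exact: has_grad_continuous (C2_has_grad2 x i (g_C2 k)).
Qed.

End VectorMaps.

(** * Quadratic minorants, penalties and sequences escaping to infinity *)

Lemma regular_of_quad {R : realType} {n} (f : 'rV[R]_n -> \bar R) x v (C r : R) :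
  (forall y, f y != -oo%E) -> (f x < +oo)%E -> 0 <= C -> 0 < r ->
  (forall y, enorm (y - x) < r -> (f y < +oo)%E ->
     fine (f x) + inner v (y - x) - C * enorm (y - x) ^+ 2 <= fine (f y)) ->
  regular_subdiff f x v.
Proof.
move=> fN fx C0 r0 h; apply/(regular_subdiffP _ _ fN); split=> // e e0.
have C1 : 0 < C + 1 by rewrite ltr_wpDl.
exists (Num.min r (e / (C + 1))); first by rewrite lt_min r0 divr_gt0.
move=> y; rewrite lt_min => /andP[yr /ltW ye].
have [fy|] := boolP (f y < +oo)%E; last first.
  by rewrite -leNgt leye_eq => /eqP ->; rewrite leey.
rewrite (fin_domE (fN x) fx) (fin_domE (fN y) fy) -EFinD lee_fin.
apply: le_trans (h y yr fy); rewrite -addrA lerD2l lerD2l lerN2 expr2 mulrA.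
rewrite ler_wpM2r ?enorm_ge0//.
move: ye; rewrite ler_pdivlMr// => /(le_trans _); apply.
by rewrite mulrC ler_wpM2l ?enorm_ge0//; lra.
Qed.

Lemma cvg_unique_real {R : realType} (u : nat -> R) (x y : R) :
  u @ ultra --> x -> u @ ultra --> y -> x = y.
Proof.
move=> ux uy; apply/eqP; rewrite -subr_eq0 -normr_eq0 eq_le normr_ge0 andbT.
apply/ler_addgt0Pr => e e0; rewrite add0r.
have e2 : 0 < e / 2 by rewrite divr_gt0.
case: (filter_ex (filterI (cvg_real_near ux e2) (cvg_real_near uy e2))) => k [h1 h2].
by have := ler_distD (u k) x y; rewrite (distrC x (u k)); lra.
Qed.

Lemma cvg_unique_vec {R : realType} {n} (u : nat -> 'rV[R]_n) (x y : 'rV[R]_n) :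
  u @ ultra --> x -> u @ ultra --> y -> x = y.
Proof.
move=> ux uy; apply/rowP => i; apply: (@cvg_unique_real _ (fun k => u k 0 i)); exact: cvg_coord.
Qed.

(** If [q0 > 0], then [q k > q0 / 2] near the limit. Indices [k] above [4 * (|M0| + 1) / q0] make
    the penalty at least [|M0| + 1], which exceeds [M k]. *)
Lemma penalty_limit {R : realType} (q M : nat -> R) (q0 M0 : R) :
  q @ ultra --> q0 -> M @ ultra --> M0 ->
  (\forall k \near ultra, k%:R / 2 * q k <= M k) -> q0 <= 0.
Proof.
move=> qq MM h; rewrite leNgt; apply/negP => q00.
have q2 : 0 < q0 / 2 by rewrite divr_gt0.
have kd : \forall k \near ultra, 4 * (`|M0| + 1) / q0 <= k%:R.
  by apply: near_ultra; exact: nbhs_infty_ger.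
case: (filter_ex (filterI (filterI h kd)
  (filterI (cvg_real_near qq q2) (cvg_real_near MM ltr01)))) => k /= [[hk {}kd] [h1 h2]].
move: kd h1 h2; rewrite ler_pdivrMr// !ltr_norml => kd /andP[h1 _] /andP[_ h2].
have := ler_norm M0; have : k%:R * (q0 / 2) <= k%:R * q k by rewrite ler_wpM2l//; lra.
lra.
Qed.

Lemma cvg_normalized {R : realType} {n} (u : nat -> 'rV[R]_n) :
  (\forall k \near ultra, u k != 0) ->
  exists2 d : 'rV[R]_n, (fun k => (enorm (u k))^-1 *: u k) @ ultra --> d & enorm d = 1.
Proof.
move=> u0; have E : \forall k \near ultra, enorm ((enorm (u k))^-1 *: u k) = 1.
  apply: filterS u0 => k uk0.
  by rewrite enormZ gtr0_norm ?invr_gt0 ?enorm_gt0// mulVf// gt_eqF// enorm_gt0.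
have [|d hd _] := @bounded_cvg_ultra R n (fun k => (enorm (u k))^-1 *: u k) 1.
  by apply: filterS E => k ->.
exists d => //; apply: (@cvg_unique_real _ (fun k => enorm ((enorm (u k))^-1 *: u k))).
  exact: cvg_enorm.
by apply/cvg_realP => e e0; apply: filterS E => k ->; rewrite subrr normr0.
Qed.

Lemma cvg_scale0 {R : realType} {n} (a : nat -> R) (u : nat -> 'rV[R]_n) (x : 'rV[R]_n) :
  a @ ultra --> (0 : R) -> u @ ultra --> x -> (fun k => a k *: u k) @ ultra --> (0 : 'rV[R]_n).
Proof.
move=> a0 ux; apply: cvg_row => i; rewrite mxE.
rewrite (_ : (fun k => _) = fun k => a k * u k 0 i); last by apply/funext => k; rewrite mxE.
by rewrite -(mul0r (x 0 i)); apply: cvgM => //; exact: cvg_coord.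
Qed.

(** The ultrafilter decides each event [a k <= C], so a sequence that is not bounded along it
    diverges along it. *)
Lemma ultra_bounded_or {R : realType} (a : nat -> R) :
  (exists C : R, \forall k \near ultra, a k <= C) \/
  (forall C : R, \forall k \near ultra, C < a k).
Proof.
have [[C aC]|nb] := pselect (exists C : R, \forall k \near ultra, a k <= C).
  by left; exists C.
right=> C; case: (in_ultra_setVsetC [set k | a k <= C] ultra_ultra) => h.
  by case: nb; exists C.
by apply: filterS h => k /= /negP; rewrite -ltNge.
Qed.

Lemma cvg_inv_infty {R : realType} (a : nat -> R) :
  (forall C : R, \forall k \near ultra, C < a k) ->
  (fun k => (a k)^-1) @ ultra --> (0 : R).
Proof.
move=> ainf; apply/cvg_realP => e e0; apply: filterS (ainf e^-1) => k ak.
have a0 : 0 < a k by rewrite (lt_trans _ ak)// invr_gt0.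
by rewrite subr0 gtr0_norm ?invr_gt0// invf_plt.
Qed.

Lemma has_grad_sqr_dist_map {R : realType} {n m} (g : 'rV[R]_n -> 'rV[R]_m) (p : 'rV[R]_m) x :
  C2_map g ->
  has_grad (fun z => enorm (g z - p) ^+ 2) x (jac_adj g x (2 *: (g x - p))).
Proof.
move=> g2; rewrite (jac_adjE g2).
rewrite (_ : (fun z => _) = fun z => \sum_(k < m) (g z 0 k + - p 0 k) ^+ 2); last first.
  by apply/funext => z; rewrite sqr_enorm; apply: eq_bigr => k _; rewrite !mxE expr2.
apply: has_grad_sum => k; rewrite !mxE.
apply: (@has_grad_sqr _ _ (fun z => g z 0 k + - p 0 k)).
rewrite -[X in has_grad _ _ X]addr0.
by apply: has_gradD; [exact: C2_has_grad (g2 k)|exact: has_grad_cst].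
Qed.

Record problem (R : realType) (n m : nat) := Problem {
  pphi0 : 'rV[R]_n -> R;
  pg : 'rV[R]_n -> 'rV[R]_m;
  ppsi : 'rV[R]_m -> \bar R;
  pxbar : 'rV[R]_n;
  pphi0_C2 : C2 pphi0;
  pg_C2 : C2_map pg;
  ppsi_proper : proper_fun ppsi;
  ppsi_lsc : lower_semicontinuous ppsi;
  ppsi_convex : convex_fun_on setT ppsi;
  pstationary : limiting_subdiff (composite pphi0 pg ppsi) pxbar 0;
  pfoqc : singular_subdiff ppsi (pg pxbar) `&` ker_jac_adj pg pxbar = [set 0];
  psoqc : forall y, multipliers pphi0 pg ppsi pxbar 0 y ->
    second_subdiff ppsi (pg pxbar) y 0 `&` ker_jac_adj pg pxbar = [set 0] }.

Arguments pphi0_C2 {R n m}.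
Arguments pg_C2 {R n m}.
Arguments ppsi_proper {R n m}.
Arguments ppsi_lsc {R n m}.
Arguments ppsi_convex {R n m}.
Arguments pstationary {R n m}.
Arguments pfoqc {R n m}.
Arguments psoqc {R n m}.

(** * First-order chain rule *)

Section FirstOrder.
Context {R : realType} {n m : nat} (pb : problem R n m).
Notation phi0 := (pphi0 pb).
Notation g := (pg pb).
Notation psi := (ppsi pb).
Notation xbar := (pxbar pb).
Notation phi := (composite phi0 g psi).
Let psiN := (ppsi_proper pb).1.

Definition lag_grad x y := grad phi0 x + jac_adj g x y.

Lemma phiN x : phi x != -oo%E.
Proof. by rewrite /composite; case: (psi (g x)) (psiN (g x)). Qed.

Lemma phi_fin x : (phi x < +oo)%E = (psi (g x) < +oo)%E.
Proof. by rewrite /composite; case: (psi (g x)) (psiN (g x)) => //= s _; rewrite !ltry. Qed.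

Lemma fine_phi x : (phi x < +oo)%E -> fine (phi x) = phi0 x + fine (psi (g x)).
Proof. by rewrite phi_fin /composite; case: (psi (g x)) (psiN (g x)). Qed.

Lemma phi_proper : proper_fun phi.
Proof.
by split; [exact: phiN|exists xbar; case: (pstationary pb)].
Qed.

Lemma phi_lsc : lower_semicontinuous phi.
Proof.
move=> x a ax.
have [b [c [ab pb' ac]]] : exists b c : R, [/\ b < phi0 x, (c%:E < psi (g x))%E & a <= b + c].
  move: ax; rewrite /composite; case: (psi (g x)) (psiN (g x)) => [s||]// _.
    rewrite -EFinD lte_fin => asx; exists (phi0 x - (phi0 x + s - a) / 2),
      (s - (phi0 x + s - a) / 2); rewrite lte_fin; split; lra.
  by move=> _; exists (phi0 x - 1), (a - phi0 x + 1); rewrite ltry; split => //; lra.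
have [V gV cV] := ppsi_lsc pb _ _ pb'.
have b0 : 0 < phi0 x - b by lra.
exists (g @^-1` V `&` [set y | `|phi0 y - phi0 x| < phi0 x - b]).
  apply: filterI; first exact: (cvg_g (pg_C2 pb) gV).
  exact: (@cvg_real_near R _ (nbhs x) _ _ _ _
    (has_grad_continuous (C2_has_grad x (pphi0_C2 pb))) b0).
move=> y [/cV cy] /=; rewrite ltr_norml => /andP[h _].
rewrite /composite; apply: (@le_lt_trans _ _ (b%:E + c%:E)%E); first by rewrite -EFinD lee_fin.
apply: lte_leD => //; first by rewrite lte_fin; lra.
exact: ltW.
Qed.

(** Quadratic penalization in the pair [(x', p)]. The regular subgradient inequality with error [c],
    played against the term [2 * c * enorm (x' - x)] of [h0], drives the minimizers to [(x, g x)].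
    Optimality in [p] makes [k%:R *: (g x' - p)] a subgradient of [psi]; optimality in [x'] bounds
    the distance from [lag_grad] to [v] by [2 * c = e / 2]. *)
Lemma fuzzy_chain x v (e : R) : regular_subdiff phi x v -> 0 < e ->
  exists x' p y, [/\ enorm (x' - x) < e, enorm (p - g x) < e,
    `|fine (psi p) - fine (psi (g x))| < e, csub psi p y & enorm (lag_grad x' y - v) < e].
Proof.
move=> /(regular_subdiffP _ _ phiN)[fx reg] e0.
have psix : (psi (g x) < +oo)%E by rewrite -phi_fin.
pose f0 := fine (psi (g x)).
have psixE : psi (g x) = f0%:E := fin_domE (psiN _) psix.
pose c := e / 4; have c0 : 0 < c by rewrite divr_gt0.
have [r1 r10 hr1] := reg _ c0.
have [r2 r20 hr2] : exists2 r : R, 0 < r &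
    forall p, enorm (p - g x) < r -> ((f0 - e / 2)%:E < psi p)%E.
  have [|V /nbhs_enormP[r r0 rV] hV] := ppsi_lsc pb (g x) (f0 - e / 2).
    by rewrite psixE lte_fin; lra.
  by exists r => // p /rV/hV.
(* The halves put the closed balls of [P] inside the open balls where [reg] and the lower bound on
   [psi] are available. *)
pose rho := Num.min (r1 / 2) (Num.min (r2 / 2) (e / 2)).
have rho0 : 0 < rho by rewrite !lt_min !divr_gt0.
have rho1 : rho <= r1 / 2 by rewrite /rho ge_min lexx.
have rho2 : rho <= r2 / 2 by rewrite /rho !ge_min lexx orbT.
have rhoe : rho <= e / 2 by rewrite /rho !ge_min lexx !orbT.
pose P (a : 'rV[R]_n * 'rV[R]_m) :=
  [/\ enorm (a.1 - x) <= rho, enorm (a.2 - g x) <= rho & (psi a.2 < +oo)%E].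
pose h0 (a : 'rV[R]_n * 'rV[R]_m) := phi0 a.1 - inner v (a.1 - x) + 2 * c * enorm (a.1 - x).
pose f (k : nat) (a : 'rV[R]_n * 'rV[R]_m) :=
  h0 a + fine (psi a.2) + k%:R / 2 * enorm (g a.1 - a.2) ^+ 2.
have P0 : P (x, g x) by split; rewrite //= subrr enorm0 ltW.
have h0_cvg (a_ : nat -> 'rV[R]_n * 'rV[R]_m) a :
    (fun k => (a_ k).1) @ ultra --> a -> (fun k => h0 (a_ k)) @ ultra --> h0 (a, 0).
  move=> aa; have ax : (fun k => (a_ k).1 - x) @ ultra --> a - x.
    by apply: cvgB => //; exact: cvg_cst.
  apply: cvgD; last by apply: cvgM; [exact: cvg_cst|exact: cvg_enorm].
  apply: cvgB; last by apply: cvg_inner => //; exact: cvg_cst.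
  apply: (cvg_comp (fun k => (a_ k).1) phi0 aa).
  exact: has_grad_continuous (C2_has_grad a (pphi0_C2 pb)).
have lims (a_ : nat -> 'rV[R]_n * 'rV[R]_m) : (forall k, P (a_ k)) ->
    exists a : 'rV[R]_n * 'rV[R]_m, [/\ (fun k => (a_ k).1) @ ultra --> a.1,
      (fun k => (a_ k).2) @ ultra --> a.2, enorm (a.1 - x) <= rho & enorm (a.2 - g x) <= rho].
  move=> Pa.
  have [|a1 ha1 ha1'] := @bounded_cvg_ultra R n (fun k => (a_ k).1 - x) rho.
    by apply: nearW => k; have [] := Pa k.
  have [|a2 ha2 ha2'] := @bounded_cvg_ultra R m (fun k => (a_ k).2 - g x) rho.
    by apply: nearW => k; have [] := Pa k.
  exists (a1 + x, a2 + g x); rewrite /= !addrK; split=> //.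
    rewrite (_ : (fun k => (a_ k).1) = (fun k => ((a_ k).1 - x) + x)).
      by apply: cvgD => //; exact: cvg_cst.
    by apply/funext => k; rewrite subrK.
  rewrite (_ : (fun k => (a_ k).2) = (fun k => ((a_ k).2 - g x) + g x)).
    by apply: cvgD => //; exact: cvg_cst.
  by apply/funext => k; rewrite subrK.
have g_cvg (a_ : nat -> 'rV[R]_n * 'rV[R]_m) a :
    (fun k => (a_ k).1) @ ultra --> a -> (fun k => g (a_ k).1) @ ultra --> g a.
  by move=> aa; apply: (cvg_comp (fun k => (a_ k).1) g aa); exact: cvg_g (pg_C2 pb) a.
have /choice[a_ ha] : forall k, exists a, P a /\ forall b, P b -> f k a <= f k b.
  move=> k; have [||a Pa ha] := @exists_minimizer R _ P (f k); first by exists (x, g x).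
    move=> a_ Pa; have [a [ha1 ha2 ha3 ha4]] := lims _ Pa.
    have q_cvg : (fun j => k%:R / 2 * enorm (g (a_ j).1 - (a_ j).2) ^+ 2) @ ultra -->
        k%:R / 2 * enorm (g a.1 - a.2) ^+ 2.
      apply: cvgM; first exact: cvg_cst.
      rewrite (_ : (fun _ => _) = (fun j => enorm (g (a_ j).1 - (a_ j).2) *
        enorm (g (a_ j).1 - (a_ j).2))); last by apply/funext => j; rewrite expr2.
      by rewrite expr2; apply: cvgM; apply: cvg_enorm; apply: cvgB => //; exact: g_cvg.
    have key l : (\forall j \near ultra, f k (a_ j) <= l) ->
        (psi a.2 <= (l - h0 (a.1, 0) - k%:R / 2 * enorm (g a.1 - a.2) ^+ 2)%:E)%E.
      move=> hl; apply: (lsc_cvg (ppsi_lsc pb) ha2 (r := fun j =>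
        l - h0 (a_ j) - k%:R / 2 * enorm (g (a_ j).1 - (a_ j).2) ^+ 2)).
        by apply: cvgB => //; apply: cvgB; [exact: cvg_cst|exact: h0_cvg].
      apply: filterS hl => j; have [_ _ fin] := Pa j.
      by rewrite (fin_domE (psiN _) fin) lee_fin /f; lra.
    have [psia|npsia] := boolP (psi a.2 < +oo)%E.
      exists a; first by split.
      move=> l /key; rewrite (fin_domE (psiN _) psia) lee_fin /f.
      have -> : h0 a = h0 (a.1, 0) by [].
      lra.
    (* An infinite value of [psi] at the limit contradicts every bound [l], so any admissible pair
       serves as witness. *)
    exists (x, g x) => // l /key; move: npsia; rewrite -leNgt leye_eq => /eqP ->.
    by rewrite leye_eq.
  by exists a.
have Pa k : P (a_ k) := (ha k).1.
have [[xi pi] [/= xxi ppi xi_rho pi_rho]] := lims _ Pa.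
have val k : f k (a_ k) <= phi0 x + f0.
  apply: le_trans ((ha k).2 _ P0) _.
  by rewrite /f /h0/= !subrr !enorm0 expr0n inner0r/= !mulr0 subr0 !addr0.
have psi_lb k : f0 - e / 2 < fine (psi (a_ k).2).
  have [_ h2 h3] := Pa k; have := hr2 (a_ k).2.
  by rewrite (fin_domE (psiN _) h3) lte_fin; apply; lra.
have h0c := h0_cvg a_ xi xxi.
have gap_cvg : (fun k => enorm (g (a_ k).1 - (a_ k).2) ^+ 2) @ ultra --> enorm (g xi - pi) ^+ 2.
  rewrite (_ : (fun _ => _) = (fun j => enorm (g (a_ j).1 - (a_ j).2) *
    enorm (g (a_ j).1 - (a_ j).2))); last by apply/funext => j; rewrite expr2.
  by rewrite expr2; apply: cvgM; apply: cvg_enorm; apply: cvgB => //; exact: g_cvg.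
have gapi : g xi = pi.
  have : enorm (g xi - pi) ^+ 2 <= 0.
    apply: (penalty_limit gap_cvg (M := fun k => phi0 x + f0 - h0 (a_ k) - (f0 - e / 2))).
      apply: cvgB; last exact: cvg_cst.
      by apply: cvgB; [exact: cvg_cst|exact: h0c].
    by apply: nearW => k; have := val k; have := psi_lb k; rewrite /f; lra.
  rewrite le_eqVlt ltNge sqr_ge0 orbF sqrf_eq0 => /eqP/enorm_eq0/eqP.
  by rewrite subr_eq0 => /eqP.
have psi_ub k : fine (psi (a_ k).2) <= phi0 x + f0 - h0 (a_ k).
  have : 0 <= k%:R / 2 * enorm (g (a_ k).1 - (a_ k).2) ^+ 2.
    by rewrite mulr_ge0 ?sqr_ge0// divr_ge0.
  by have := val k; rewrite /f; lra.
have ub_cvg : (fun k => phi0 x + f0 - h0 (a_ k)) @ ultra --> phi0 x + f0 - h0 (xi, 0).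
  by apply: cvgB; [exact: cvg_cst|exact: h0c].
have psipi : (psi pi <= (phi0 x + f0 - h0 (xi, 0))%:E)%E.
  apply: (lsc_cvg (ppsi_lsc pb) ppi ub_cvg); apply: nearW => k.
  by have [_ _ h3] := Pa k; rewrite (fin_domE (psiN _) h3) lee_fin.
have fpi : (psi pi < +oo)%E by apply: le_lt_trans psipi (ltry _).
have xix : xi = x.
  have xir1 : enorm (xi - x) < r1 by lra.
  have := hr1 xi xir1; have fxi : (phi xi < +oo)%E by rewrite phi_fin gapi.
  rewrite (fin_domE (phiN _) fx) (fin_domE (phiN _) fxi) !fine_phi// -EFinD lee_fin gapi.
  move: psipi; rewrite (fin_domE (psiN _) fpi) lee_fin /h0/= -/f0 => h1 h2.
  have h3 : c * enorm (xi - x) <= 0 by lra.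
  apply/eqP; rewrite -subr_eq0; apply/eqP/enorm_eq0/eqP.
  by rewrite eq_le enorm_ge0 andbT -(pmulr_rle0 _ c0).
have pix : pi = g x by rewrite -gapi xix.
have lim_ub : phi0 x + f0 - h0 (xi, 0) = f0.
  by rewrite /h0/= xix subrr enorm0 inner0r; ring.
rewrite lim_ub in ub_cvg; rewrite {}xix in xxi; rewrite {}pix in ppi.
case: (filter_ex (filterI (filterI (cvg_enorm_near xxi rho0) (cvg_enorm_near ppi rho0))
  (cvg_real_near ub_cvg e0))) => k [[hx hp]]; rewrite ltr_norml => /andP[_ hub].
case: (a_ k) (Pa k) (ha k) (psi_lb k) (psi_ub k) hx hp hub => xk pk /= [_ _ fpk] [_ mink]
  plb pub hx hp hub.
pose y : 'rV[R]_m := k%:R *: (g xk - pk).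
exists xk, pk, y; split.
- lra.
- lra.
- by rewrite ltr_norml -/f0; apply/andP; split; lra.
- apply: (convex_regular_csub psiN (ppsi_convex pb)).
  apply: (@regular_of_quad _ _ _ _ _ (k%:R / 2) (rho - enorm (pk - g x))) => //.
  + by rewrite subr_gt0.
  + move=> p' p'r fp'.
    have Pp' : P (xk, p').
      split=> //=; first exact: ltW.
      by have := enorm_dist p' pk (g x); lra.
    have := mink _ Pp'; rewrite /f /h0/=.
    have -> : enorm (g xk - p') ^+ 2 = enorm (g xk - pk) ^+ 2
        - 2 * inner (g xk - pk) (p' - pk) + enorm (p' - pk) ^+ 2.
      have -> : g xk - p' = (g xk - pk) - (p' - pk) by rewrite opprB addrA subrK.
      by rewrite !sqr_enorm; move: (g xk - pk) (p' - pk) => s t; rewrite !innerE (innerC t s); ring.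
    by rewrite /y innerZl; lra.
- pose s z := phi0 z + - inner v z + k%:R / 2 * enorm (g z - pk) ^+ 2.
  have hs : has_grad s xk (lag_grad xk y - v).
    have -> : lag_grad xk y - v = grad phi0 xk + (-1) *: v
        + (k%:R / 2) *: jac_adj g xk (2 *: (g xk - pk)).
      by rewrite /lag_grad -jac_adjZ scalerA divfK ?pnatr_eq0// scaleN1r addrAC.
    apply: has_gradD; last exact/has_gradZ/has_grad_sqr_dist_map/pg_C2.
    apply: has_gradD; first exact: C2_has_grad (pphi0_C2 pb).
    rewrite (_ : (fun z => _) = fun z => -1 * inner v z); last by apply/funext => z; rewrite mulN1r.
    exact/has_gradZ/has_grad_inner.
  have c20 : 0 <= 2 * c by rewrite mulr_ge0// ltW.
  have : enorm (lag_grad xk y - v) <= 2 * c.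
    apply: (has_grad_min c20 (r := rho - enorm (xk - x)) _ hs); first by rewrite subr_gt0.
    move=> d dr; have Pd : P (xk + d, pk).
      split=> //=; last exact: ltW.
      by rewrite addrAC; have := enormD (xk - x) d; lra.
    have := mink _ Pd; rewrite /f /h0/= /s (addrAC xk d).
    have := enormD (xk - x) d; rewrite !innerDr.
    move=> t1 t2; have t3 : 2 * c * enorm (xk - x + d) <= 2 * c * (enorm (xk - x) + enorm d).
      by rewrite ler_wpM2l.
    lra.
  by move=> /le_lt_trans; apply; rewrite /c; lra.
Qed.

End FirstOrder.

(** * Bounded multipliers and the exact chain rule *)

Section ChainRule.
Context {R : realType} {n m : nat} (pb : problem R n m).
Notation phi0 := (pphi0 pb).
Notation g := (pg pb).
Notation psi := (ppsi pb).
Notation xbar := (pxbar pb).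
Notation phi := (composite phi0 g psi).
Notation lag := (lag_grad pb).
Notation zbar := (g xbar).
Let psiN := (ppsi_proper pb).1.

Lemma g_near (e : R) : 0 < e ->
  exists2 d : R, 0 < d & forall x, enorm (x - xbar) < d -> enorm (g x - zbar) < e.
Proof.
move=> e0; suff : \forall x \near xbar, enorm (g x - zbar) < e by move=> /nbhs_enormP.
exact: (@cvg_enorm_near R _ (nbhs xbar) _ _ g zbar _ (@cvg_g _ _ _ g (pg_C2 pb) xbar)).
Qed.

Lemma cvg_harmonic_vec {k} (u : nat -> 'rV[R]_k) (x : 'rV[R]_k) :
  (forall i, enorm (u i - x) < i.+1%:R^-1) -> u @ ultra --> x.
Proof. by move=> ux; apply: cvg_enorm0 (@ultra_invn R) => i; exact: ltW. Qed.

Lemma cvg_grad_phi0 (x_ : nat -> 'rV[R]_n) (x : 'rV[R]_n) : x_ @ ultra --> x ->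
  (fun k => grad phi0 (x_ k)) @ ultra --> grad phi0 x.
Proof.
move=> xx; apply: (cvg_comp x_ (grad phi0) xx).
exact: C2_grad_continuous (pphi0_C2 pb).
Qed.

Lemma cvg_lag (x_ : nat -> 'rV[R]_n) (y_ : nat -> 'rV[R]_m) x y :
  x_ @ ultra --> x -> y_ @ ultra --> y -> (fun k => lag (x_ k) (y_ k)) @ ultra --> lag x y.
Proof.
move=> xx yy; apply: cvgD; first exact: cvg_grad_phi0.
exact: (cvg_jac_adj (pg_C2 pb)).
Qed.

(* Multipliers escaping to infinity have a limiting direction in the kernel of
   the adjoint Jacobian. *)
Lemma unbounded_multiplier_direction (x_ : nat -> 'rV[R]_n) (y_ : nat -> 'rV[R]_m) (C : R) x :
  x_ @ ultra --> x -> (forall M : R, \forall k \near ultra, M < enorm (y_ k)) ->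
  (forall k, enorm (lag (x_ k) (y_ k)) <= C) ->
  exists d : 'rV[R]_m, [/\ (fun k => (enorm (y_ k))^-1 *: y_ k) @ ultra --> d,
    enorm d = 1 & jac_adj g x d = 0].
Proof.
move=> xx yinf lagC.
have y0 : \forall k \near ultra, y_ k != 0.
  by apply: filterS (yinf 0) => k; apply: contraTneq => ->; rewrite enorm0 ltxx.
have [d dd d1] := cvg_normalized y0; exists d; split=> //.
have inv0 := cvg_inv_infty yinf.
apply: (@cvg_unique_vec _ _ (fun k => jac_adj g (x_ k) ((enorm (y_ k))^-1 *: y_ k))).
  exact: (cvg_jac_adj (pg_C2 pb)).
have [|l ll _] := @bounded_cvg_ultra R n (fun k => lag (x_ k) (y_ k)) C.
  exact: nearW.
rewrite (_ : (fun k => _) = fun k => (enorm (y_ k))^-1 *: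
  (lag (x_ k) (y_ k) - grad phi0 (x_ k))); last first.
  by apply/funext => k; rewrite jac_adjZ /lag_grad addrC addrA addNr add0r.
apply: (cvg_scale0 (x := l - grad phi0 x) inv0).
by apply: cvgB => //; exact: cvg_grad_phi0.
Qed.

(** Applied to regular subgradients tending to [0], [fuzzy_chain] gives approximate multipliers
    along which [psi] converges to [psi zbar]. If they are bounded, their limit is a subgradient at
    [zbar]; otherwise their direction is a unit singular subgradient in the kernel, against the
    first-order condition. *)
Lemma csub_xbar_nonempty : exists y, csub psi zbar y.
Proof.
have [fxbar h] := (limiting_subdiffP _ _ (phiN pb)).1 (pstationary pb).
have psix : (psi zbar < +oo)%E by rewrite -phi_fin.
have /choice[a Ha] : forall k : nat, exists a : 'rV[R]_n * 'rV[R]_m * 'rV[R]_m,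
   [/\ enorm (a.1.1 - xbar) < k.+1%:R^-1, enorm (a.1.2 - zbar) < k.+1%:R^-1,
    `|fine (psi a.1.2) - fine (psi zbar)| < k.+1%:R^-1, csub psi a.1.2 a.2 &
    enorm (lag a.1.1 a.2) < k.+1%:R^-1].
  move=> k; set e := _^-1; have e0 : 0 < e by rewrite invr_gt0.
  have e4 : 0 < e / 4 by rewrite divr_gt0.
  have [d d0 hd] : exists2 d : R, 0 < d & forall x, enorm (x - xbar) < d ->
      enorm (g x - zbar) < e / 4 /\ `|phi0 x - phi0 xbar| < e / 4.
    suff : \forall x \near xbar, enorm (g x - zbar) < e / 4 /\ `|phi0 x - phi0 xbar| < e / 4.
      by move=> /nbhs_enormP.
    pose proof (@cvg_enorm_near R _ (nbhs xbar) _ _ g zbar _ (@cvg_g _ _ _ g (pg_C2 pb) xbar) e4) as h1.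
    pose proof (@cvg_real_near R _ (nbhs xbar) _ _ _ _
      (has_grad_continuous (C2_has_grad xbar (pphi0_C2 pb))) e4) as h2.
    exact: filterI h1 h2.
  have m0 : 0 < Num.min d (e / 4) by rewrite lt_min d0.
  have [x' [v' []]] := h _ m0; rewrite !lt_min subr0 => /andP[/hd[h1 h2] h3] /andP[_ h4] reg /andP[_ h5].
  have fx' : (phi x' < +oo)%E by case: reg.
  have [x [p [y [k1 k2 k3 k4 k5]]]] := fuzzy_chain reg e4.
  exists (x, p, y); split=> //=.
  - by have := enorm_dist x x' xbar; lra.
  - by have := enorm_dist p (g x') zbar; lra.
  - move: h2 h4 k3; rewrite !fine_phi//.
    rewrite !ltr_norml => /andP[? ?] /andP[? ?] /andP[? ?]; apply/andP; split; lra.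
  - by have := enorm_le_sub (lag x y) v'; lra.
have xx : (fun k => (a k).1.1) @ ultra --> xbar.
  by apply: cvg_harmonic_vec => k; have [] := Ha k.
have pp : (fun k => (a k).1.2) @ ultra --> zbar.
  by apply: cvg_harmonic_vec => k; have [] := Ha k.
have sub k : csub psi (a k).1.2 (a k).2 by have [] := Ha k.
have [[C yC]|yinf] := ultra_bounded_or (fun k => enorm (a k).2).
  have [y yy _] := bounded_cvg_ultra yC; exists y.
  by apply: (csub_cvg (ppsi_proper pb) (ppsi_lsc pb) pp yy); exact: nearW.
have [|d [dd d1 Ad]] := unbounded_multiplier_direction (C := 1) xx yinf.
  move=> k; have [_ _ _ _ /ltW/le_trans] := Ha k; apply.
  by rewrite invf_le1// ler1n.
suff : (singular_subdiff psi zbar `&` ker_jac_adj g xbar) d.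
  by rewrite (pfoqc pb) => /= d0; move: d1; rewrite d0 enorm0 => /eqP; rewrite eq_sym oner_eq0.
split=> //; apply: singular_of_near => // e e0.
have kpos : \forall k \near ultra, (k.+1%:R^-1 : R) < e.
  apply: filterS (cvg_real_near (@ultra_invn R) e0) => k; rewrite subr0.
  exact: le_lt_trans (ler_norm _).
case: (filter_ex (filterI (filterI kpos (yinf (Num.max 0 e^-1))) (cvg_enorm_near dd e0))).
move=> k /= [[ke yk] dk]; have [k1 k2 k3 k4 k5] := Ha k.
move: yk; rewrite gt_max => /andP[y0 ye].
exists (a k).1.2, (a k).2, (enorm (a k).2)^-1; split=> //.
- exact: lt_trans k2 ke.
- exact: lt_trans k3 ke.
- exact: csub_regular.
- by rewrite invr_gt0 y0 invf_plt.
Qed.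

(** The values [psi p] are not controlled here, while [singular_subdiff] asks for their convergence,
    so the escaping direction [d] cannot be read off along the sequence. Instead [d] is shown to be
    normal to the domain of [psi] at [zbar]; then the whole ray [y0 + t *: d] consists of
    subgradients at the fixed point [zbar], and scaling it down exhibits [d] as a singular
    subgradient. *)
Lemma bounded_multipliers : exists r K : R, [/\ 0 < r, 0 <= K & forall x p y,
  enorm (x - xbar) < r -> enorm (p - zbar) < r -> csub psi p y -> enorm (lag x y) < r ->
  enorm y <= K].
Proof.
apply: contrapT => H.
have /choice[a Ha] : forall k : nat, exists a : 'rV[R]_n * 'rV[R]_m * 'rV[R]_m,
   [/\ enorm (a.1.1 - xbar) < k.+1%:R^-1, enorm (a.1.2 - zbar) < k.+1%:R^-1,
    csub psi a.1.2 a.2, enorm (lag a.1.1 a.2) < k.+1%:R^-1 & k%:R < enorm a.2].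
  move=> k; apply: contrapT => Hk; apply: H; exists k.+1%:R^-1, k%:R; split=> //.
  move=> x p y h1 h2 h3 h4; rewrite leNgt; apply/negP => h5; apply: Hk.
  by exists (x, p, y).
have xx : (fun k => (a k).1.1) @ ultra --> xbar.
  by apply: cvg_harmonic_vec => k; have [] := Ha k.
have pp : (fun k => (a k).1.2) @ ultra --> zbar.
  by apply: cvg_harmonic_vec => k; have [] := Ha k.
have yinf (M : R) : \forall k \near ultra, M < enorm (a k).2.
  have : \forall k \near ultra, M <= k%:R by apply: near_ultra; exact: nbhs_infty_ger.
  by apply: filterS => k Mk; apply: (le_lt_trans Mk); have [] := Ha k.
have [|d [dd d1 Ad]] := unbounded_multiplier_direction (C := 1) xx yinf.
  move=> k; have [_ _ _ /ltW/le_trans + _] := Ha k; apply.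
  by rewrite invf_le1// ler1n.
have inv0 := cvg_inv_infty yinf.
have [y0 [fz hy0]] := csub_xbar_nonempty.
(* [d] is normal to the domain of [psi] at [zbar]. *)
have dN z : (psi z < +oo)%E -> inner d (z - zbar) <= 0.
  (* Lower semicontinuity keeps [psi] above [c] near [zbar]. After division by the norm of the
     multiplier, the value terms of the subgradient inequality tend to [0]. *)
  move=> fz'; pose c := fine (psi zbar) - 1.
  have [V zV Vc] : exists2 V, nbhs zbar V & forall p, V p -> (c%:E < psi p)%E.
    by apply: (ppsi_lsc pb); rewrite (fin_domE (psiN _) fz) lte_fin /c; lra.
  have nV : \forall k \near ultra, V (a k).1.2 by exact: pp.
  have lim1 : (fun k => inner ((enorm (a k).2)^-1 *: (a k).2) (z - (a k).1.2)) @ ultra -->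
      inner d (z - zbar).
    by apply: cvg_inner => //; apply: cvgB => //; exact: cvg_cst.
  have lim2 : (fun k => (enorm (a k).2)^-1 * (fine (psi z) - c)) @ ultra -->
      0 * (fine (psi z) - c) by apply: cvgM => //; exact: cvg_cst.
  rewrite mul0r in lim2; apply/ler_addgt0Pr => e e0; rewrite add0r.
  have e2 : 0 < e / 2 by rewrite divr_gt0.
  case: (filter_ex (filterI (filterI nV (yinf 0))
    (filterI (cvg_real_near lim1 e2) (cvg_real_near lim2 e2)))).
  move=> k /= [[/Vc Vk yk] [h1 h2]]; have [_ _ [fp hp] _ _] := Ha k.
  have := hp z; rewrite (fin_domE (psiN _) fp) (fin_domE (psiN _) fz') -EFinD lee_fin.
  move: Vk; rewrite (fin_domE (psiN _) fp) lte_fin => ck hz.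
  have : (enorm (a k).2)^-1 * inner (a k).2 (z - (a k).1.2) <=
      (enorm (a k).2)^-1 * (fine (psi z) - c).
    by rewrite ler_pM2l ?invr_gt0//; lra.
  move: h1 h2; rewrite innerZl subr0 !ltr_norml => /andP[? ?] /andP[? ?]; lra.
have sub t : 0 <= t -> csub psi zbar (y0 + t *: d).
  move=> t0; split=> // z.
  have [fz'|] := boolP (psi z < +oo)%E; last first.
    by rewrite -leNgt leye_eq => /eqP ->; rewrite leey.
  apply: le_trans (hy0 z); rewrite (fin_domE (psiN _) fz) -!EFinD lee_fin.
  by rewrite innerDl innerZl lerD2l gerDl mulr_ge0_le0// dN.
suff : (singular_subdiff psi zbar `&` ker_jac_adj g xbar) d.
  by rewrite (pfoqc pb) => /= d0; move: d1; rewrite d0 enorm0 => /eqP; rewrite eq_sym oner_eq0.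
split=> //; apply: singular_of_near => // e e0.
have N1 : 0 < enorm y0 + 1 by rewrite ltr_wpDl ?enorm_ge0.
(* The vector [l *: (y0 + l^-1 *: d)] misses [d] by [l *: y0], which is shorter than [e]; the choice
   also gives [l < e]. *)
pose l := e / (enorm y0 + 1) / 2.
have l0 : 0 < l by rewrite /l !divr_gt0.
have le : l < e.
  rewrite /l -mulrA gtr_pMr// -invfM invf_lt1 ?mulr_gt0//.
  by have := enorm_ge0 y0; lra.
exists zbar, (y0 + l^-1 *: d), l; split=> //.
- by rewrite subrr enorm0.
- by rewrite subrr normr0.
- by apply/csub_regular => //; apply: sub; rewrite invr_ge0 ltW.
- by rewrite l0.
- rewrite scalerDr scalerA divff ?gt_eqF// scale1r addrK enormZ gtr0_norm//.
  have : l * (enorm y0 + 1) = e / 2 by rewrite /l mulrAC divfK// gt_eqF.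
  lra.
Qed.

(** The easy inclusion: replacing [psi] by its affine minorant at [g x] leaves a function
    differentiable at [x] with gradient [lag x y]. *)
Lemma lag_regular x y : csub psi (g x) y -> regular_subdiff phi x (lag x y).
Proof.
move=> [fx hy]; have fphi : (phi x < +oo)%E by rewrite phi_fin.
apply/(regular_subdiffP _ _ (phiN pb)); split=> // e e0.
have hG : has_grad (fun z => phi0 z + inner y (g z)) x (lag x y).
  apply: (has_gradD (C2_has_grad x (pphi0_C2 pb))).
  rewrite (jac_adjE (pg_C2 pb)).
  apply: (@has_grad_sum _ _ _ _ (fun k z => y 0 k * g z 0 k)) => k.
  exact: (has_gradZ (y 0 k) (C2_has_grad x (pg_C2 pb k))).
have [r r0 hr] := hG _ e0.
exists r => // x' x'r; have := hr _ x'r; rewrite (addrC x (x' - x)) subrK.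
have [fx'|] := boolP (phi x' < +oo)%E; last first.
  by rewrite -leNgt leye_eq => /eqP ->; rewrite leey.
have fx'2 : (psi (g x') < +oo)%E by rewrite -phi_fin.
rewrite (fin_domE (phiN pb _) fphi) (fin_domE (phiN pb _) fx') !fine_phi// -EFinD lee_fin.
have := hy (g x'); rewrite (fin_domE (psiN _) fx) (fin_domE (psiN _) fx'2) -EFinD lee_fin.
rewrite innerDr innerNr ler_norml => h /andP[h1 h2]; lra.
Qed.

(** Near [(xbar, 0)] the multipliers that [fuzzy_chain] delivers for vanishing errors are bounded,
    so they converge along the ultrafilter to an exact one. *)
Lemma chain_rule : exists2 r : R, 0 < r & forall x v,
  enorm (x - xbar) < r -> enorm v < r -> limiting_subdiff phi x v ->
  exists2 y, csub psi (g x) y & v = lag x y.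
Proof.
have [rB [K [rB0 K0 hB]]] := bounded_multipliers.
have rB2 : 0 < rB / 2 by rewrite divr_gt0.
have [rg rg0 hg] := g_near rB2.
pose r := Num.min rg (rB / 2).
have r_rg : r <= rg by rewrite ge_min lexx.
have r_rB : r <= rB / 2 by rewrite ge_min lexx orbT.
exists r; first by rewrite lt_min rg0 divr_gt0.
move=> x v xr vr /(limiting_subdiffP _ _ (phiN pb))[fx h].
have /choice[a Ha] : forall k : nat, exists a : 'rV[R]_n * 'rV[R]_m * 'rV[R]_m,
   [/\ enorm (a.1.1 - x) < k.+1%:R^-1, enorm (a.1.2 - g x) < k.+1%:R^-1,
    csub psi a.1.2 a.2 & enorm (lag a.1.1 a.2 - v) < k.+1%:R^-1].
  move=> k; set e := _^-1; have e0 : 0 < e by rewrite invr_gt0.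
  have e2 : 0 < e / 2 by rewrite divr_gt0.
  have [d d0 hd] : exists2 d : R, 0 < d & forall x', enorm (x' - x) < d ->
      enorm (g x' - g x) < e / 2.
    suff : \forall x' \near x, enorm (g x' - g x) < e / 2 by move=> /nbhs_enormP.
    exact: (@cvg_enorm_near R _ (nbhs x) _ _ g (g x) _ (@cvg_g _ _ _ g (pg_C2 pb) x) e2).
  have m0 : 0 < Num.min d (e / 2) by rewrite lt_min d0.
  have [x' [v' []]] := h _ m0; rewrite !lt_min => /andP[/hd h1 h3] _ reg /andP[_ h5].
  have [x1 [p [y [k1 k2 k3 k4 k5]]]] := fuzzy_chain reg e2.
  exists (x1, p, y); split=> //=.
  - by have := enorm_dist x1 x' x; lra.
  - by have := enorm_dist p (g x') (g x); lra.
  - by have := enorm_dist (lag x1 y) v' v; lra.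
have xx : (fun k => (a k).1.1) @ ultra --> x.
  by apply: cvg_harmonic_vec => k; have [] := Ha k.
have pp : (fun k => (a k).1.2) @ ultra --> g x.
  by apply: cvg_harmonic_vec => k; have [] := Ha k.
have vv : (fun k => lag (a k).1.1 (a k).2) @ ultra --> v.
  by apply: cvg_harmonic_vec => k; have [] := Ha k.
have yK : \forall k \near ultra, enorm (a k).2 <= K.
  have xr' : 0 < r - enorm (x - xbar) by lra.
  have vr' : 0 < r - enorm v by lra.
  apply: filterS (filterI (cvg_enorm_near xx xr') (filterI (cvg_enorm_near pp rB2)
    (cvg_enorm_near vv vr'))) => k [h1 [h2 h3]].
  have [_ _ h4 _] := Ha k; apply: (hB (a k).1.1 (a k).1.2) => //.
  - by have := enorm_dist (a k).1.1 x xbar; lra.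
  - have gx : enorm (g x - zbar) < rB / 2 by apply: hg; lra.
    by have := enorm_dist (a k).1.2 (g x) zbar; lra.
  - apply: (le_lt_trans (enorm_le_sub _ v)); rewrite -ltrBrDl; apply: (lt_le_trans h3).
    by rewrite lerD2r; lra.
have [y yy _] := bounded_cvg_ultra yK; exists y.
  apply: (csub_cvg (ppsi_proper pb) (ppsi_lsc pb) pp yy); apply: nearW => k.
  by have [] := Ha k.
exact: (@cvg_unique_vec R n _ v (lag x y) vv (cvg_lag xx yy)).
Qed.

End ChainRule.

Lemma inner_mulmx {R : realType} {n m} (u : 'rV[R]_n) (M : 'M[R]_(n, m)) (v : 'rV[R]_m) :
  inner (u *m M) v = inner u (v *m M^T).
Proof.
rewrite /inner; under eq_bigr do rewrite mxE mulr_suml.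
rewrite exchange_big; apply: eq_bigr => i _; rewrite mxE mulr_sumr.
by apply: eq_bigr => j _; rewrite mxE; ring.
Qed.

Lemma trmxij {R : realType} {n m} (M : 'M[R]_(n, m)) i j : M^T i j = M j i.
Proof. exact: mxE. Qed.

Lemma inner_sumZ {R : realType} {n} (I : Type) (s : seq I) (a : I -> R)
    (v : I -> 'rV[R]_n) w :
  inner (\sum_(i <- s) a i *: v i) w = \sum_(i <- s) a i * inner (v i) w.
Proof.
elim: s => [|i s ih]; first by rewrite !big_nil inner0l.
by rewrite !big_cons innerDl innerZl ih.
Qed.

Lemma enorm_sum {R : realType} {n} (I : Type) (s : seq I) (f : I -> 'rV[R]_n) :
  enorm (\sum_(i <- s) f i) <= \sum_(i <- s) enorm (f i).
Proof.
elim: s => [|i s ih]; first by rewrite !big_nil enorm0.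
by rewrite !big_cons (le_trans (enormD _ _))// lerD2l.
Qed.

Lemma cvg_vsum {R : realType} {n} (I : Type) (s : seq I) (f : I -> nat -> 'rV[R]_n)
    (l : I -> 'rV[R]_n) : (forall i, f i @ ultra --> l i) ->
  (fun k => \sum_(i <- s) f i k) @ ultra --> \sum_(i <- s) l i.
Proof.
move=> fl; elim: s => [|i s ih].
  rewrite big_nil (_ : (fun _ => _) = cst 0); first exact: cvg_cst.
  by apply/funext => k; rewrite big_nil.
rewrite big_cons (_ : (fun _ => _) = fun k => f i k + \sum_(j <- s) f j k).
  exact: cvgD.
by apply/funext => k; rewrite big_cons.
Qed.

Lemma cvg_scale {R : realType} {n} (a : nat -> R) (u : nat -> 'rV[R]_n) (b : R) (x : 'rV[R]_n) :
  a @ ultra --> b -> u @ ultra --> x -> (fun k => a k *: u k) @ ultra --> b *: x.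
Proof.
move=> ab ux; apply: cvg_row => i; rewrite mxE.
rewrite (_ : (fun k => _) = fun k => a k * u k 0 i); last by apply/funext => k; rewrite mxE.
by apply: cvgM => //; exact: cvg_coord.
Qed.

Lemma cvg_sqr_enorm {R : realType} {n} (u : nat -> 'rV[R]_n) (x : 'rV[R]_n) :
  u @ ultra --> x -> (fun k => enorm (u k) ^+ 2) @ ultra --> enorm x ^+ 2.
Proof.
move=> ux; rewrite (_ : (fun _ => _) = (fun j => inner (u j) (u j))).
  by rewrite sqr_enorm; exact: cvg_inner.
by apply/funext => j; rewrite sqr_enorm.
Qed.

Lemma cvg_sub_cst {R : realType} {n} (u : nat -> 'rV[R]_n) (x c : 'rV[R]_n) :
  u @ ultra --> x -> (fun k => u k - c) @ ultra --> x - c.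
Proof. by move=> ux; apply: cvgB => //; exact: cvg_cst. Qed.

Lemma cvg_of_sub {R : realType} {n} (u : nat -> 'rV[R]_n) (x c : 'rV[R]_n) :
  (fun k => u k - c) @ ultra --> x -> u @ ultra --> x + c.
Proof.
move=> ux; rewrite (_ : u = (fun k => (u k - c) + c)).
  by apply: cvgD => //; exact: cvg_cst.
by apply/funext => k; rewrite subrK.
Qed.

(** * Second-order subdifferentials *)

Section ConormalSequences.
Context {R : realType} {m : nat} (f : 'rV[R]_m -> \bar R).
Hypotheses (fp : proper_fun f) (fl : lower_semicontinuous f) (fc : convex_fun_on setT f).
Implicit Types (z y w u : 'rV[R]_m).

Lemma second_subdiff_seq z y w u : second_subdiff f z y w u ->
  exists p q u_ w_ : nat -> 'rV[R]_m,
  [/\ p @ ultra --> z, q @ ultra --> y, u_ @ ultra --> u, w_ @ ultra --> w &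
      forall k, reg_conormal f (p k) (q k) (u_ k) (w_ k)].
Proof.
move=> /(second_subdiffP _ _ _ _ fp fl fc)[zy h].
have /choice[a Ha] : forall k : nat, exists a : 'rV[R]_m * 'rV[R]_m * ('rV[R]_m * 'rV[R]_m),
    [/\ enorm (a.1.1 - z) < k.+1%:R^-1, enorm (a.1.2 - y) < k.+1%:R^-1,
        reg_conormal f a.1.1 a.1.2 a.2.1 a.2.2,
        enorm (a.2.1 - u) < k.+1%:R^-1 & enorm (a.2.2 - w) < k.+1%:R^-1].
  move=> k; have [|p [q [u' [w' H]]]] := h k.+1%:R^-1; first by rewrite invr_gt0.
  by exists ((p, q), (u', w')).
exists (fun k => (a k).1.1), (fun k => (a k).1.2), (fun k => (a k).2.1), (fun k => (a k).2.2).
by split; first [apply: cvg_harmonic_vec | idtac] => k; have [] := Ha k.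
Qed.

Lemma second_subdiff_cvg z y w u (p q u_ w_ : nat -> 'rV[R]_m) :
  p @ ultra --> z -> q @ ultra --> y -> u_ @ ultra --> u -> w_ @ ultra --> w ->
  (\forall k \near ultra, reg_conormal f (p k) (q k) (u_ k) (w_ k)) ->
  second_subdiff f z y w u.
Proof.
move=> pz qy uu ww h; apply/(second_subdiffP _ _ _ _ fp fl fc); split.
  by apply: (csub_cvg fp fl pz qy); apply: filterS h => k [].
move=> e e0.
case: (filter_ex (filterI (filterI (cvg_enorm_near pz e0) (cvg_enorm_near qy e0))
  (filterI h (filterI (cvg_enorm_near uu e0) (cvg_enorm_near ww e0))))).
by move=> k [[h1 h2] [h3 [h4 h5]]]; exists (p k), (q k), (u_ k), (w_ k).
Qed.

Lemma second_subdiff_closed z y w u (z_ y_ u_ w_ : nat -> 'rV[R]_m) :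
  z_ @ ultra --> z -> y_ @ ultra --> y -> u_ @ ultra --> u -> w_ @ ultra --> w ->
  (forall k, second_subdiff f (z_ k) (y_ k) (w_ k) (u_ k)) ->
  second_subdiff f z y w u.
Proof.
move=> zz yy uu ww h; apply/(second_subdiffP _ _ _ _ fp fl fc).
have {}h k := (second_subdiffP _ _ _ _ fp fl fc).1 (h k); split.
  by apply: (csub_cvg fp fl zz yy); apply: nearW => k; have [] := h k.
move=> e e0; have e2 : 0 < e / 2 by rewrite divr_gt0.
case: (filter_ex (filterI (filterI (cvg_enorm_near zz e2) (cvg_enorm_near yy e2))
  (filterI (cvg_enorm_near uu e2) (cvg_enorm_near ww e2)))).
move=> k [[h1 h2] [h3 h4]]; have [_ /(_ _ e2)[p [q [u' [w' [k1 k2 k3 k4 k5]]]]]] := h k.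
exists p, q, u', w'; split=> //.
- by have := enorm_dist p (z_ k) z; lra.
- by have := enorm_dist q (y_ k) y; lra.
- by have := enorm_dist u' (u_ k) u; lra.
- by have := enorm_dist w' (w_ k) w; lra.
Qed.

Lemma second_subdiffZ z y w u (a : R) : 0 < a ->
  second_subdiff f z y w u -> second_subdiff f z y (a *: w) (a *: u).
Proof.
move=> a0 /second_subdiff_seq[p [q [u_ [w_ [pz qy uu ww h]]]]].
apply: (second_subdiff_cvg pz qy (u_ := fun k => a *: u_ k) (w_ := fun k => a *: w_ k)).
- by apply: cvg_scale => //; exact: cvg_cst.
- by apply: cvg_scale => //; exact: cvg_cst.
- by apply: nearW => k; exact: reg_conormalZ.
Qed.

End ConormalSequences.

Section SecondOrder.
Context {R : realType} {n m : nat} (pb : problem R n m).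
Notation phi0 := (pphi0 pb).
Notation g := (pg pb).
Notation psi := (ppsi pb).
Notation xbar := (pxbar pb).
Notation lag := (lag_grad pb).
Notation zbar := (g xbar).
Let fp := ppsi_proper pb.
Let fl := ppsi_lsc pb.
Let fc := ppsi_convex pb.

(* The gradient of [x |-> inner w (lag x y)]. *)
Definition lag_hess (x : 'rV[R]_n) (y : 'rV[R]_m) (w : 'rV[R]_n) : 'rV[R]_n := w *m (hessian phi0 x)^T +
  \sum_(k < m) y 0 k *: (w *m (hessian (fun x' => g x' 0 k) x)^T).

(** The vector paired with [w] on the right is the one that the multiplier rule returns, so bounds
    on the form become bounds on multipliers. *)
Lemma second_order_formE x y u w :
  second_order_form phi0 g x y u w = inner (lag_hess x y w + jac_adj g x u) w.
Proof.
rewrite /second_order_form (inner_jac (pg_C2 pb)) !innerDl; congr (_ + _ + _).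
  by rewrite inner_mulmx innerC.
rewrite inner_mulmx innerC (hessian_inner (pg_C2 pb)); congr inner.
rewrite linear_sum mulmx_sumr; apply: eq_bigr => k _.
by rewrite linearZ -scalemxAr.
Qed.

Lemma has_grad_inner_lag x y w : has_grad (fun z => inner w (lag z y)) x (lag_hess x y w).
Proof.
rewrite (_ : (fun z => _) = fun z => inner w (grad phi0 z) +
  \sum_(k < m) y 0 k * inner w (grad (fun x' => g x' 0 k) z)); last first.
  apply/funext => z; rewrite innerDr (jac_adjE (pg_C2 pb)); congr (_ + _).
  by rewrite innerC inner_sumZ; apply: eq_bigr => k _; rewrite innerC.
apply: (has_gradD (has_grad_inner_grad x w (pphi0_C2 pb))).
apply: (@has_grad_sum _ _ _ _ (fun k z => y 0 k * inner w (grad (fun x' => g x' 0 k) z))) => k.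
exact: (has_gradZ _ (has_grad_inner_grad x w (pg_C2 pb k))).
Qed.

Lemma cvg_xi (x_ w_ : nat -> 'rV[R]_n) (y_ : nat -> 'rV[R]_m) (x : 'rV[R]_n) (y : 'rV[R]_m) (w : 'rV[R]_n) :
  x_ @ ultra --> x -> y_ @ ultra --> y -> w_ @ ultra --> w ->
  (fun k => lag_hess (x_ k) (y_ k) (w_ k)) @ ultra --> lag_hess x y w.
Proof.
move=> xx yy ww.
have hc (f : 'rV[R]_n -> R) i j : C2 f ->
    (fun k => (hessian f (x_ k))^T i j) @ ultra --> (hessian f x)^T i j.
  move=> f2.
  have E : (fun k => (hessian f (x_ k))^T i j) = (fun k => hessian f (x_ k) j i).
    by apply/funext => k; exact: trmxij.
  rewrite E trmxij; apply: (cvg_comp x_ (fun z => hessian f z j i) xx).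
  exact: C2_hessian_continuous.
apply: cvgD; first by apply: cvg_mulmx => // i j; exact: hc (pphi0_C2 pb).
apply: cvg_vsum => k; apply: cvg_scale; first exact: cvg_coord.
by apply: cvg_mulmx => // i j; exact: hc (pg_C2 pb k).
Qed.

Lemma xiZ x y (a : R) w : lag_hess x y (a *: w) = a *: lag_hess x y w.
Proof.
rewrite /lag_hess scalerDr scaler_sumr; congr (_ + _); first exact: esym (scalemxAl _ _ _).
apply: eq_bigr => k _; rewrite scalerA mulrC -scalerA; congr (_ *: _).
exact: esym (scalemxAl _ _ _).
Qed.

Lemma multipliersP x v y : multipliers phi0 g psi x v y <-> v = lag x y /\ csub psi (g x) y.
Proof. by rewrite /multipliers /mkset (convex_limiting_subdiffE fp fl fc). Qed.

(** A sequence violating this, scaled to unit [u], has as limit a unit vector in the intersection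
    that the second-order condition makes trivial. The base point [p] is left independent of [x],
    because penalized minimizers provide conormals at such points. *)
Lemma uniform_second_order_qc : exists r c : R, [/\ 0 < r, 0 < c & forall x p q u w,
  enorm (x - xbar) < r -> enorm (p - zbar) < r -> enorm (lag x q) < r ->
  reg_conormal psi p q u w -> c * enorm u <= enorm (jac_adj g x u) + enorm w].
Proof.
apply: contrapT => H.
have [rB [K [rB0 K0 hB]]] := bounded_multipliers pb.
have /choice[a Ha] : forall k : nat, exists a : 'rV[R]_n * 'rV[R]_m * ('rV[R]_m * 'rV[R]_m * 'rV[R]_m),
   [/\ enorm (a.1.1 - xbar) < k.+1%:R^-1, enorm (a.1.2 - zbar) < k.+1%:R^-1,
    enorm (lag a.1.1 a.2.1.1) < k.+1%:R^-1, reg_conormal psi a.1.2 a.2.1.1 a.2.1.2 a.2.2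
    & enorm (jac_adj g a.1.1 a.2.1.2) + enorm a.2.2 < k.+1%:R^-1 * enorm a.2.1.2].
  move=> k; apply: contrapT => Hk; apply: H; exists k.+1%:R^-1, k.+1%:R^-1.
  have k0 : 0 < (k.+1%:R^-1 : R) by rewrite invr_gt0.
  split=> // x p q u w h1 h2 h3 h4; rewrite leNgt; apply/negP => h5; apply: Hk.
  by exists ((x, p), ((q, u), w)).
pose x_ k := (a k).1.1; pose p k := (a k).1.2; pose q k := (a k).2.1.1.
pose u k := (a k).2.1.2; pose w k := (a k).2.2.
have xx : x_ @ ultra --> xbar by apply: cvg_harmonic_vec => k; have [] := Ha k.
have pp : p @ ultra --> zbar by apply: cvg_harmonic_vec => k; have [] := Ha k.
have ll : (fun k => lag (x_ k) (q k)) @ ultra --> (0 : 'rV[R]_n).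
  by apply: cvg_harmonic_vec => k; rewrite subr0; have [] := Ha k.
have reg k : reg_conormal psi (p k) (q k) (u k) (w k) by have [] := Ha k.
have bound k : enorm (jac_adj g (x_ k) (u k)) + enorm (w k) < k.+1%:R^-1 * enorm (u k).
  by have [] := Ha k.
have qK : \forall k \near ultra, enorm (q k) <= K.
  apply: filterS (cvg_real_near (@ultra_invn R) rB0) => k; rewrite subr0 => kr.
  have {}kr : k.+1%:R^-1 < rB by apply: le_lt_trans kr; exact: ler_norm.
  have [h1 h2 h3 [h4 _] _] := Ha k.
  apply: (hB (x_ k) (p k)) => //; exact: lt_trans kr.
have [q0 qq _] := bounded_cvg_ultra qK.
have mult : multipliers phi0 g psi xbar 0 q0.
  apply/multipliersP; split; last first.
    by apply: (csub_cvg fp fl pp qq); apply: nearW => k; have [] := reg k.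
  exact: (@cvg_unique_vec R n _ 0 (lag xbar q0) ll (cvg_lag xx qq)).
have u0 k : u k != 0.
  apply: contraTneq (bound k) => ->; rewrite enorm0 mulr0 -leNgt.
  by rewrite addr_ge0 ?enorm_ge0.
have un k : 0 < enorm (u k) by rewrite enorm_gt0.
have [|d dd d1] := @cvg_normalized R m u; first exact: nearW.
have Ad : jac_adj g xbar d = 0.
  apply: (@cvg_unique_vec _ _ (fun k => jac_adj g (x_ k) ((enorm (u k))^-1 *: u k))).
    exact: (cvg_jac_adj (pg_C2 pb)).
  apply: cvg_harmonic_vec => k; rewrite subr0 jac_adjZ enormZ gtr0_norm ?invr_gt0//.
  rewrite mulrC ltr_pdivrMr//; apply: le_lt_trans (bound k).
  by rewrite lerDl enorm_ge0.
have ww : (fun k => (enorm (u k))^-1 *: w k) @ ultra --> (0 : 'rV[R]_m).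
  apply: cvg_harmonic_vec => k; rewrite subr0 enormZ gtr0_norm ?invr_gt0//.
  rewrite mulrC ltr_pdivrMr//; apply: le_lt_trans (bound k).
  by rewrite lerDr enorm_ge0.
have : (second_subdiff psi zbar q0 0 `&` ker_jac_adj g xbar) d.
  split=> //; apply: (second_subdiff_cvg fp fl fc pp qq dd ww); apply: nearW => k.
  by apply: reg_conormalZ; rewrite ?invr_gt0.
by rewrite (psoqc pb _ mult) => /= d0; move: d1; rewrite d0 enorm0 => /eqP; rewrite eq_sym oner_eq0.
Qed.

(** As [lag] is affine in [y], the local constants of [phi0] and of the components of [g] combine
    into one, with [1 + enorm y] as the price. *)
Lemma lag_local : exists r C : R, [/\ 0 < r, 0 <= C & forall x x' y,
  enorm (x - xbar) < r -> enorm (x' - xbar) < r ->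
  [/\ `|(phi0 x' + inner y (g x')) - (phi0 x + inner y (g x)) - inner (lag x y) (x' - x)|
        <= C * (1 + enorm y) * enorm (x' - x) ^+ 2,
      enorm (lag x' y - lag x y) <= C * (1 + enorm y) * enorm (x' - x) &
      enorm (jac_adj g x y) <= C * enorm y]].
Proof.
have [r0 [C0 [r00 C00 h0]]] := C2_local xbar (pphi0_C2 pb).
have /choice[a Ha] : forall k : 'I_m, exists a : R * R, [/\ 0 < a.1, 0 <= a.2 &
    forall x y, enorm (x - xbar) < a.1 -> enorm (y - xbar) < a.1 ->
    enorm (grad (fun x' => g x' 0 k) y - grad (fun x' => g x' 0 k) x) <= a.2 * enorm (y - x) /\
    `|g y 0 k - g x 0 k - inner (grad (fun x' => g x' 0 k) x) (y - x)| <= a.2 * enorm (y - x) ^+ 2].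
  by move=> k; have [r [C H]] := C2_local xbar (pg_C2 pb k); exists (r, C).
pose gr k x := grad (fun x' => g x' 0 k) x.
(* The inverse of a sum of inverses lies below [1] and below every radius, and so replaces a finite
   minimum. *)
pose r := (1 + r0^-1 + \sum_k (a k).1^-1)^-1.
have s0 : 0 <= \sum_k (a k).1^-1.
  by apply: sumr_ge0 => k _; have [/ltW h _ _] := Ha k; rewrite invr_ge0.
have i0 : 0 < r0^-1 by rewrite invr_gt0.
have r_gt0 : 0 < r by rewrite invr_gt0; lra.
have rr0 : r <= r0.
  rewrite -[r0]invrK lef_pV2 ?posrE//; lra.
have r1 : r <= 1 by rewrite invf_le1; lra.
have rrk k : r <= (a k).1.
  have [ak0 _ _] := Ha k.
  rewrite -[(a k).1]invrK lef_pV2 ?posrE ?invr_gt0//; last by lra.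
  rewrite (bigD1 k)//= addrCA lerDl.
  have : 0 <= \sum_(j | j != k) (a j).1^-1.
    by apply: sumr_ge0 => j _; have [/ltW h _ _] := Ha j; rewrite invr_ge0.
  lra.
pose C := C0 + \sum_k (a k).2 + \sum_k (enorm (gr k xbar) + (a k).2).
have Ck0 : 0 <= \sum_k (a k).2 by apply: sumr_ge0 => k _; have [] := Ha k.
have Cg0 : 0 <= \sum_k (enorm (gr k xbar) + (a k).2).
  by apply: sumr_ge0 => k _; have [_ h _] := Ha k; rewrite addr_ge0 ?enorm_ge0.
exists r, C; split=> //; first by rewrite /C; lra.
move=> x x' y xr xr'; pose D := enorm (x' - x); have D0 : 0 <= D := enorm_ge0 _.
have Y0 : 0 <= enorm y := enorm_ge0 y.
have xr0 : enorm (x - xbar) < r0 := lt_le_trans xr rr0.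
have xr0' : enorm (x' - xbar) < r0 := lt_le_trans xr' rr0.
have [g0 t0] := h0 x x' xr0 xr0'.
have hk k := (Ha k).
have gk k : enorm (gr k x' - gr k x) <= (a k).2 * D.
  by have [_ _ H] := Ha k; have [] := H x x' (lt_le_trans xr (rrk k)) (lt_le_trans xr' (rrk k)).
have tk k : `|g x' 0 k - g x 0 k - inner (gr k x) (x' - x)| <= (a k).2 * D ^+ 2.
  by have [_ _ H] := Ha k; have [] := H x x' (lt_le_trans xr (rrk k)) (lt_le_trans xr' (rrk k)).
have a0 k : 0 <= (a k).2 by have [] := Ha k.
split.
- have -> : phi0 x' + inner y (g x') - (phi0 x + inner y (g x)) - inner (lag x y) (x' - x) =
      (phi0 x' - phi0 x - inner (grad phi0 x) (x' - x)) +
      \sum_k y 0 k * (g x' 0 k - g x 0 k - inner (gr k x) (x' - x)).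
    rewrite /lag_grad (jac_adjE (pg_C2 pb)) innerDl.
    have -> : inner (\sum_(k < m) y 0 k *: grad (fun x' => g x' 0 k) x) (x' - x) =
       \sum_k y 0 k * inner (gr k x) (x' - x).
      exact: inner_sumZ.
    have -> : \sum_k y 0 k * (g x' 0 k - g x 0 k - inner (gr k x) (x' - x)) =
       inner y (g x') - inner y (g x) - \sum_k y 0 k * inner (gr k x) (x' - x).
      by rewrite /inner -!sumrB; apply: eq_bigr => k _; ring.
    ring.
  apply: (le_trans (ler_normD _ _)).
  have s1 : `|\sum_k y 0 k * (g x' 0 k - g x 0 k - inner (gr k x) (x' - x))| <=
      enorm y * (\sum_k (a k).2) * D ^+ 2.
    apply: (le_trans (ler_norm_sum _ _ _)).
    rewrite -mulrA mulr_suml mulr_sumr; apply: ler_sum => k _; rewrite normrM.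
    by apply: ler_pM => //; exact: coord_enorm.
  apply: (@le_trans _ _ (C0 * D ^+ 2 + enorm y * (\sum_k (a k).2) * D ^+ 2)).
    by rewrite lerD.
  rewrite -mulrDl ler_wpM2r ?sqr_ge0// /C mulrDr mulr1.
  move: s1 => _; nra.
- have -> : lag x' y - lag x y = (grad phi0 x' - grad phi0 x) +
      \sum_k y 0 k *: (gr k x' - gr k x).
    rewrite /lag_grad !(jac_adjE (pg_C2 pb)).
    have -> : \sum_k y 0 k *: (gr k x' - gr k x) = \sum_k y 0 k *: gr k x' - \sum_k y 0 k *: gr k x.
      by rewrite -sumrB; apply: eq_bigr => k _; rewrite scalerBr.
    by rewrite opprD addrACA.
  apply: (le_trans (enormD _ _)).
  have s1 : enorm (\sum_k y 0 k *: (gr k x' - gr k x)) <= enorm y * (\sum_k (a k).2) * D.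
    apply: (le_trans (enorm_sum _ _)).
    rewrite -mulrA mulr_suml mulr_sumr; apply: ler_sum => k _; rewrite enormZ.
    by apply: ler_pM => //; [exact: enorm_ge0|exact: coord_enorm].
  apply: (@le_trans _ _ (C0 * D + enorm y * (\sum_k (a k).2) * D)).
    by rewrite lerD.
  rewrite -mulrDl ler_wpM2r// /C mulrDr mulr1.
  move: s1 => _; nra.
- rewrite (jac_adjE (pg_C2 pb)); apply: (le_trans (enorm_sum _ _)).
  apply: (@le_trans _ _ ((\sum_k (enorm (gr k xbar) + (a k).2)) * enorm y)); last first.
    by rewrite ler_wpM2r// /C; lra.
  rewrite mulr_suml; apply: ler_sum => k _; rewrite enormZ mulrC.
  apply: ler_pM => //; [exact: enorm_ge0| |exact: coord_enorm].
  apply: (le_trans (enorm_le_sub _ (gr k xbar))); rewrite lerD2l.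
  have xb : enorm (xbar - xbar) < (a k).1 by rewrite subrr enorm0; have [] := Ha k.
  have [_ _ H] := Ha k; have [H1 _] := H xbar x xb (lt_le_trans xr (rrk k)).
  have x1 : enorm (x - xbar) <= 1 := le_trans (ltW xr) r1.
  exact: (le_trans H1 (ler_piMr (a0 k) x1)).
Qed.

End SecondOrder.

Opaque inner enorm grad jac_adj jac hessian lag_hess.

(* [lra] compares atoms up to conversion, which is slow on unfoldable terms. *)
Ltac atom_lra :=
  clear; repeat match goal with
  | |- context [inner ?a ?b] => generalize (inner a b); intro
  | |- context [enorm ?a] => generalize (enorm a); intro
  end; intros; lra.

Lemma enorm_lt_trans {R : realType} {n} (u v w : 'rV[R]_n) (r : R) :
  enorm (u - v) < r - enorm (v - w) -> enorm (u - w) < r.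
Proof. by rewrite ltrBrDr => h; apply: le_lt_trans h; exact: enorm_dist. Qed.

Lemma enorm_lt_near {R : realType} {n} (u v : 'rV[R]_n) (r : R) :
  enorm (u - v) < r - enorm v -> enorm u < r.
Proof. by rewrite ltrBrDl => h; apply: le_lt_trans h; exact: enorm_le_sub. Qed.

Lemma penalized_gap {R : realType} (A B C D : R) :
  A <= B + C * D -> B + (C + 1) * D <= A -> D <= 0.
Proof. lra. Qed.

(** * Multiplier rule *)

Section MultiplierRule.
Context {R : realType} {n m : nat} (pb : problem R n m).
Notation g := (pg pb).
Notation psi := (ppsi pb).
Notation xbar := (pxbar pb).
Notation lag := (lag_grad pb).
Notation xi := (lag_hess pb).
Notation zbar := (g xbar).
Let fp := ppsi_proper pb.
Let fl := ppsi_lsc pb.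
Let fc := ppsi_convex pb.

Lemma lagB x y y' : lag x y - lag x y' = jac_adj g x (y - y').
Proof. by rewrite /lag_grad jac_adjB opprD addrACA subrr add0r. Qed.

Opaque lag_grad.

(** Raising [C] to [C + 1] makes [(x, y)] the only minimizer of [h0] on [S] near it, so the
    minimizers of the penalized problem converge to [(x, g x, y)]. Their optimality in [x] is
    [stat]; their optimality in [(p, q)] is [regn]. The bound of [uniform_second_order_qc] on the
    penalty multipliers [u] lets both pass to the limit. *)
Lemma multiplier_rule : exists2 r : R, 0 < r & forall x y w b (C rho : R),
  enorm (x - xbar) < r -> enorm (lag x y) < r -> csub psi (g x) y -> 0 <= C -> 0 < rho ->
  (forall x' y', csub psi (g x') y' ->
      enorm (x' - x) < rho -> enorm (y' - y) < rho ->
    inner w (lag x y) + inner b x <= inner w (lag x' y') + inner b x' +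
      C * (enorm (x' - x) ^+ 2 + enorm (y' - y) ^+ 2)) ->
  exists2 u, second_subdiff psi (g x) y (jac g x w) u & b + xi x y w + jac_adj g x u = 0.
Proof.
have [r0 [c [r00 c0 hQ]]] := uniform_second_order_qc pb.
have [rg rg0 hg] := g_near pb r00.
exists (Num.min rg r0); first by rewrite lt_min rg0.
move=> x y w b C rho; rewrite !lt_min => /andP[xrg xr0] /andP[_ lr0] xy C0 rho0 hmin.
pose h0 (a : 'rV[R]_n * 'rV[R]_m) := inner w (lag a.1 a.2) + inner b a.1 +
  (C + 1) * (enorm (a.1 - x) ^+ 2 + enorm (a.2 - y) ^+ 2).
pose F0 := inner w (lag x y) + inner b x.
pose rh := rho / 2; have rh0 : 0 < rh by rewrite divr_gt0.
pose P (a : 'rV[R]_n * 'rV[R]_m * 'rV[R]_m) := [/\ enorm (a.1.1 - x) <= rh,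
  enorm (a.1.2 - g x) <= rh, enorm (a.2 - y) <= rh & csub psi a.1.2 a.2].
pose f (k : nat) (a : 'rV[R]_n * 'rV[R]_m * 'rV[R]_m) :=
  h0 (a.1.1, a.2) + k%:R / 2 * enorm (g a.1.1 - a.1.2) ^+ 2.
have P0 : P (x, g x, y) by split; rewrite //= subrr enorm0 ltW.
have fP0 k : f k (x, g x, y) = F0.
  by rewrite /f /h0/= !subrr !enorm0 expr0n/= addr0 !mulr0 !addr0.
have h0_cvg (x_ : nat -> 'rV[R]_n) (y_ : nat -> 'rV[R]_m) (x1 : 'rV[R]_n) (y1 : 'rV[R]_m) :
    x_ @ ultra --> x1 -> y_ @ ultra --> y1 ->
    (fun k => h0 (x_ k, y_ k)) @ ultra --> h0 (x1, y1).
  move=> xx yy; apply: cvgD.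
    apply: cvgD; first by apply: cvg_inner; [exact: cvg_cst|exact: cvg_lag].
    by apply: cvg_inner => //; exact: cvg_cst.
  apply: cvgM; first exact: cvg_cst.
  by apply: cvgD; apply/cvg_sqr_enorm/cvg_sub_cst.
have g_cvg (x_ : nat -> 'rV[R]_n) (x1 : 'rV[R]_n) : x_ @ ultra --> x1 -> (fun k => g (x_ k)) @ ultra --> g x1.
  by move=> xx; apply: (cvg_comp x_ g xx); exact: cvg_g (pg_C2 pb) _.
have q_cvg (x_ : nat -> 'rV[R]_n) (p_ : nat -> 'rV[R]_m) (x1 : 'rV[R]_n) (p1 : 'rV[R]_m) :
    x_ @ ultra --> x1 -> p_ @ ultra --> p1 ->
    (fun k => enorm (g (x_ k) - p_ k) ^+ 2) @ ultra --> enorm (g x1 - p1) ^+ 2.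
  by move=> xx pp; apply: cvg_sqr_enorm; apply: cvgB => //; exact: g_cvg.
have lims (a_ : nat -> 'rV[R]_n * 'rV[R]_m * 'rV[R]_m) : (forall k, P (a_ k)) ->
    exists a : 'rV[R]_n * 'rV[R]_m * 'rV[R]_m, [/\ (fun k => (a_ k).1.1) @ ultra --> a.1.1,
      (fun k => (a_ k).1.2) @ ultra --> a.1.2, (fun k => (a_ k).2) @ ultra --> a.2 & P a].
  move=> Pa.
  have [|a1 ha1 ha1'] := @bounded_cvg_ultra R n (fun k => (a_ k).1.1 - x) rh.
    by apply: nearW => k; have [] := Pa k.
  have [|a2 ha2 ha2'] := @bounded_cvg_ultra R m (fun k => (a_ k).1.2 - g x) rh.
    by apply: nearW => k; have [] := Pa k.
  have [|a3 ha3 ha3'] := @bounded_cvg_ultra R m (fun k => (a_ k).2 - y) rh.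
    by apply: nearW => k; have [] := Pa k.
  have k1 := cvg_of_sub ha1; have k2 := cvg_of_sub ha2; have k3 := cvg_of_sub ha3.
  exists (a1 + x, a2 + g x, a3 + y); split=> //; split; rewrite /= ?addrK//.
  by apply: (csub_cvg fp fl k2 k3); apply: nearW => k; have [] := Pa k.
have /choice[a_ ha] : forall k, exists a, P a /\ forall a', P a' -> f k a <= f k a'.
  move=> k; have [||a Pa ha] := @exists_minimizer R _ P (f k); first by exists (x, g x, y).
    move=> a_ Pa; have [a [ha1 ha2 ha3 ha4]] := lims _ Pa.
    exists a => // l hl.
    have fc' : (fun j => f k (a_ j)) @ ultra --> f k a.
      apply: cvgD; first exact: h0_cvg.
      by apply: cvgM; [exact: cvg_cst|exact: q_cvg].
    apply/ler_addgt0Pr => e e0.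
    case: (filter_ex (filterI hl (cvg_real_near fc' e0))) => j [h1].
    by rewrite ltr_norml => /andP[h2 h3]; move: h1 h2 h3; atom_lra.
  by exists a.
have Pa k : P (a_ k) := (ha k).1.
have [[[x1 p1] y1] [/= xx pp yy [xrh prh yrh py1]]] := lims _ Pa.
have val k : f k (a_ k) <= F0 by rewrite -(fP0 k); exact: (ha k).2.
have h0c := h0_cvg _ _ _ _ xx yy.
have gp : g x1 = p1.
  have : enorm (g x1 - p1) ^+ 2 <= 0.
    apply: (penalty_limit (q_cvg _ _ _ _ xx pp) (M := fun k => F0 - h0 ((a_ k).1.1, (a_ k).2))).
      by apply: cvgB; [exact: cvg_cst|exact: h0c].
    by apply: nearW => k; rewrite lerBrDl; exact: val k.
  rewrite le_eqVlt ltNge sqr_ge0 orbF sqrf_eq0 => /eqP/enorm_eq0/eqP.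
  by rewrite subr_eq0 => /eqP.
have h0F0 : h0 (x1, y1) <= F0.
  apply/ler_addgt0Pr => e e0.
  case: (filter_ex (cvg_real_near h0c e0)) => k.
  rewrite ltr_norml => /andP[h2 h3].
  have : h0 ((a_ k).1.1, (a_ k).2) <= F0.
    by apply: le_trans (val k); rewrite /f lerDl mulr_ge0 ?sqr_ge0// divr_ge0.
  by move: h2 h3; atom_lra.
have [xx1 yy1] : x1 = x /\ y1 = y.
  have rhr : rh < rho by rewrite /rh ltr_pdivrMr// ltr_pMr// ltr1n.
  have py1' : csub psi (g x1) y1 by rewrite gp.
  have h1 := hmin x1 y1 py1' (le_lt_trans xrh rhr) (le_lt_trans yrh rhr).
  have h2 : enorm (x1 - x) ^+ 2 + enorm (y1 - y) ^+ 2 <= 0.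
    exact: (penalized_gap h1 h0F0).
  have s1 := sqr_ge0 (enorm (x1 - x)); have s2 := sqr_ge0 (enorm (y1 - y)).
  have e1 : enorm (x1 - x) ^+ 2 == 0 by rewrite eq_le s1 andbT; move: h2 s2; atom_lra.
  have e2 : enorm (y1 - y) ^+ 2 == 0 by rewrite eq_le s2 andbT; move: h2 s1; atom_lra.
  move: e1 e2; rewrite !sqrf_eq0 => /eqP/enorm_eq0/eqP + /eqP/enorm_eq0/eqP.
  by rewrite !subr_eq0 => /eqP -> /eqP ->.
have {}gp : p1 = g x by rewrite -gp xx1.
rewrite xx1 in xx; rewrite yy1 in yy; rewrite gp in pp.
clear lims hmin h0_cvg q_cvg h0c h0F0 xrh yrh prh py1 xx1 yy1 gp.
pose x_ k := (a_ k).1.1; pose p_ k := (a_ k).1.2; pose q_ k := (a_ k).2.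
pose u k : 'rV[R]_m := k%:R *: (g (x_ k) - p_ k).
pose W k : 'rV[R]_m := jac g (x_ k) w + (2 * (C + 1)) *: (q_ k - y).
pose S k : 'rV[R]_n := b + xi (x_ k) (q_ k) w + (2 * (C + 1)) *: (x_ k - x).
have nearP : \forall k \near ultra, [/\ enorm (x_ k - x) < rh, enorm (p_ k - g x) < rh
    & enorm (q_ k - y) < rh].
  apply: filterS (filterI (cvg_enorm_near xx rh0) (filterI (cvg_enorm_near pp rh0)
    (cvg_enorm_near yy rh0))) => k [? [? ?]]; by [].
have mink k z p q : enorm (z - x) <= rh -> enorm (p - g x) <= rh -> enorm (q - y) <= rh ->
    csub psi p q -> f k (x_ k, p_ k, q_ k) <= f k (z, p, q).
  move=> h1 h2 h3 h4; rewrite /x_ /p_ /q_ -!surjective_pairing; apply: (ha k).2.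
  by split.
have pq k : csub psi (p_ k) (q_ k) by have [] := Pa k.
have stat : \forall k \near ultra, S k + jac_adj g (x_ k) (u k) = 0.
  apply: filterS nearP => k [h1 h2 h3].
  pose s z := inner w (lag z (q_ k)) + inner b z + (C + 1) * enorm (z - x) ^+ 2 +
    k%:R / 2 * enorm (g z - p_ k) ^+ 2.
  have hs : has_grad s (x_ k) (S k + jac_adj g (x_ k) (u k)).
    have -> : S k + jac_adj g (x_ k) (u k) = xi (x_ k) (q_ k) w + b +
       (C + 1) *: (2 *: (x_ k - x)) + (k%:R / 2) *: jac_adj g (x_ k) (2 *: (g (x_ k) - p_ k)).
      rewrite -jac_adjZ !scalerA divfK ?pnatr_eq0// (mulrC (C + 1)).
      by rewrite /S (addrC b).
    apply: (has_gradD _ (has_gradZ _ (has_grad_sqr_dist_map (p_ k) (x_ k) (pg_C2 pb)))).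
    apply: (has_gradD _ (has_gradZ _ (has_grad_sqr_dist x (x_ k)))).
    exact: (has_gradD (has_grad_inner_lag _ _ _ _) (has_grad_inner _ _)).
  apply: enorm_eq0; apply/eqP; rewrite eq_le enorm_ge0 andbT.
  apply: (has_grad_min (lexx 0) (r := rh - enorm (x_ k - x)) _ hs); first by rewrite subr_gt0.
  move=> d dr; rewrite mul0r addr0.
  have := @mink k (x_ k + d) (p_ k) (q_ k) _ (ltW h2) (ltW h3) (pq k).
  have hd : enorm (x_ k + d - x) <= rh.
    by rewrite (addrAC (x_ k) d (- x)) (le_trans (enormD _ _))// -lerBrDl ltW.
  by move=> /(_ hd); rewrite /f /h0/= /s; atom_lra.
have regn : \forall k \near ultra, reg_conormal psi (p_ k) (q_ k) (u k) (W k).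
  apply: filterS nearP => k [h1 h2 h3]; split; first exact: pq.
  (* Minimality leaves a remainder of at most [K] times squared distances; within radius [e / K] it
     is linear with slope [e]. *)
  move=> e e0; pose K := C + 1 + k%:R / 2.
  have K0 : 0 < K by rewrite /K ltr_wpDr ?divr_ge0// ltr_wpDl.
  pose d := Num.min (e / K) (Num.min (rh - enorm (p_ k - g x)) (rh - enorm (q_ k - y))).
  exists d; first by rewrite !lt_min divr_gt0// !subr_gt0 h2 h3.
  move=> p' q' pq'; rewrite !lt_min => /and3P[/ltW p1' p2' p3'] /and3P[/ltW q1' q2' q3'].
  have hp : enorm (p' - g x) <= rh.
    by have := enorm_dist p' (p_ k) (g x); move: p2'; atom_lra.
  have hq : enorm (q' - y) <= rh.
    by have := enorm_dist q' (q_ k) y; move: q3'; atom_lra.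
  have := mink k (x_ k) p' q' (ltW h1) hp hq pq'; rewrite /f /h0/=.
  (* The linear part of [lag] in the multiplier is the adjoint Jacobian; moving it onto [w] is how
     [jac g x w] becomes the direction of the second subdifferential. *)
  have E1 : inner w (lag (x_ k) q') = inner w (lag (x_ k) (q_ k)) + inner (jac g (x_ k) w) (q' - q_ k).
    have -> : lag (x_ k) q' = lag (x_ k) (q_ k) + jac_adj g (x_ k) (q' - q_ k).
      by rewrite -lagB addrC subrK.
    by rewrite (innerDr w); congr (_ + _); rewrite [RHS]innerC (inner_jac (pg_C2 pb)) innerC.
  have E2 : enorm (g (x_ k) - p') ^+ 2 = enorm (g (x_ k) - p_ k) ^+ 2
        - 2 * inner (g (x_ k) - p_ k) (p' - p_ k) + enorm (p' - p_ k) ^+ 2.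
    have -> : g (x_ k) - p' = (g (x_ k) - p_ k) - (p' - p_ k) by rewrite opprB addrA subrK.
    by rewrite !sqr_enorm; move: (g _ - p_ k) (p' - p_ k) => s t; rewrite !innerE (innerC t s); ring.
  have E3 : enorm (q' - y) ^+ 2 = enorm (q_ k - y) ^+ 2
        + 2 * inner (q_ k - y) (q' - q_ k) + enorm (q' - q_ k) ^+ 2.
    have -> : q' - y = (q_ k - y) + (q' - q_ k) by rewrite [RHS]addrC addrA subrK.
    by rewrite !sqr_enorm; move: (q_ k - y) (q' - q_ k) => s t; rewrite !innerE (innerC t s); ring.
  have E4 : inner (W k) (q' - q_ k) = inner (jac g (x_ k) w) (q' - q_ k) +
      2 * (C + 1) * inner (q_ k - y) (q' - q_ k) by rewrite /W innerDl innerZl.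
  have E5 : inner (u k) (p' - p_ k) = k%:R * inner (g (x_ k) - p_ k) (p' - p_ k).
    by rewrite /u innerZl.
  rewrite E1 E2 E3 E4 E5 => H.
  pose Dp := enorm (p' - p_ k); pose Dq := enorm (q' - q_ k).
  rewrite -/Dp -/Dq in H p1' q1' *.
  have Dp0 : 0 <= Dp := enorm_ge0 _; have Dq0 : 0 <= Dq := enorm_ge0 _.
  have H1 : K * Dp <= e by rewrite mulrC -ler_pdivlMr.
  have H2 : K * Dq <= e by rewrite mulrC -ler_pdivlMr.
  have H3 : K * Dp * Dp <= e * Dp by rewrite ler_wpM2r.
  have H4 : K * Dq * Dq <= e * Dq by rewrite ler_wpM2r.
  have k0 : 0 <= (k%:R / 2 : R) by rewrite divr_ge0.
  have H5 : 0 <= k%:R / 2 * Dq ^+ 2 by rewrite mulr_ge0 ?sqr_ge0.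
  have H6 : 0 <= (C + 1) * Dp ^+ 2 by rewrite mulr_ge0 ?sqr_ge0// addr_ge0.
  move: H H3 H4 H5 H6; rewrite /K !expr2; atom_lra.
have Wc : W @ ultra --> jac g x w.
  rewrite -[jac g x w]addr0; apply: cvgD.
    by apply: (cvg_jac (pg_C2 pb)) => //; exact: cvg_cst.
  rewrite -(scaler0 _ (2 * (C + 1))) -(subrr y); apply: cvg_scale; first exact: cvg_cst.
  exact: cvg_sub_cst.
have Sc : S @ ultra --> b + xi x y w.
  rewrite -[b + xi x y w]addr0; apply: cvgD.
    by apply: cvgD; [exact: cvg_cst|apply: cvg_xi => //; exact: cvg_cst].
  rewrite -(scaler0 _ (2 * (C + 1))) -(subrr x); apply: cvg_scale; first exact: cvg_cst.
  exact: cvg_sub_cst.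
have lc := @cvg_lag R n m pb _ _ _ _ xx yy.
(* The [2] absorbs the unit distances of [S k] and [W k] from their limits. *)
pose B := enorm (b + xi x y w) + enorm (jac g x w) + 2.
have ub : \forall k \near ultra, enorm (u k) <= B / c.
  have x0' : 0 < r0 - enorm (x - xbar) by rewrite subr_gt0.
  have l0' : 0 < r0 - enorm (lag x y) by rewrite subr_gt0.
  have g0' : 0 < r0 - enorm (g x - zbar) by rewrite subr_gt0 hg.
  pose proof (@cvg_enorm_near R _ ultra _ _ _ _ 1 Wc ltr01) as N1.
  pose proof (@cvg_enorm_near R _ ultra _ _ _ _ 1 Sc ltr01) as N2.
  pose proof (cvg_enorm_near xx x0') as N3; pose proof (cvg_enorm_near pp g0') as N4.
  pose proof (cvg_enorm_near lc l0') as N5.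
  apply: filterS (filterI (filterI N1 N2) (filterI (filterI N3 N4) (filterI N5 (filterI stat regn)))).
  move=> k [[h1 h2] [[h3 h4] [h5 [h6 h7]]]].
  have k1 : enorm (x_ k - xbar) < r0 := enorm_lt_trans h3.
  have k2 : enorm (p_ k - zbar) < r0 := enorm_lt_trans h4.
  have k3 : enorm (lag (x_ k) (q_ k)) < r0 := enorm_lt_near h5.
  have := hQ _ _ _ _ _ k1 k2 k3 h7.
  have -> : jac_adj g (x_ k) (u k) = - S k by apply/eqP; rewrite eq_sym eqr_oppLR -addr_eq0 h6.
  rewrite enormN ler_pdivlMr// mulrC => /le_trans; apply.
  have := enorm_le_sub (S k) (b + xi x y w); have := enorm_le_sub (W k) (jac g x w).
  by rewrite /B; move: h1 h2; atom_lra.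
have [u0 uu _] := bounded_cvg_ultra ub; exists u0.
  exact: (second_subdiff_cvg fp fl fc pp yy uu Wc).
apply: (@cvg_unique_vec R n (fun k => S k + jac_adj g (x_ k) (u k))).
  by apply: cvgD => //; exact: (cvg_jac_adj (pg_C2 pb)).
by apply/cvg_enormP => e e0; apply: filterS stat => k ->; rewrite subrr enorm0.
Qed.

End MultiplierRule.

(* Its square is a C^1 barrier. *)
Definition pospart {R : realType} (s : R) : R := (s + `|s|) / 2.

Lemma pospart_ge0 {R : realType} (s : R) : 0 <= pospart s.
Proof. by rewrite /pospart; have := ler_norm (- s); rewrite normrN; lra. Qed.

(** The descent inequality of the barrier, with [2 * pospart s] in the role of its derivative at
    [s]. *)
Lemma sqr_pospart_le {R : realType} (s t : R) :
  pospart t ^+ 2 <= pospart s ^+ 2 + 2 * pospart s * (t - s) + (t - s) ^+ 2.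
Proof.
rewrite /pospart.
have E (a : R) : (a + a) / 2 = a by lra.
have E0 (a : R) : (a - a) / 2 = 0 by lra.
case: (ger0P s) => hs; case: (ger0P t) => ht; rewrite ?E ?E0.
- by have -> : s ^+ 2 + 2 * s * (t - s) + (t - s) ^+ 2 = t ^+ 2 by ring.
- have -> : s ^+ 2 + 2 * s * (t - s) + (t - s) ^+ 2 = t ^+ 2 by ring.
  by rewrite expr0n/= sqr_ge0.
- by rewrite expr0n/= mulr0 mul0r !add0r ler_sqr ?nnegrE//; lra.
- by rewrite expr0n/= mulr0 mul0r !add0r sqr_ge0.
Qed.

(** * Mean value inequality *)

Section Tube.
Context {R : realType} {n : nat} (e : 'rV[R]_n) (c M K : R).
Hypotheses (e0 : e != 0) (M0 : 0 <= M) (K0 : 0 <= K).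
Let N := enorm e ^+ 2.
Implicit Types q h : 'rV[R]_n.

Definition along q : R := inner q e / enorm e ^+ 2.
Definition across q : 'rV[R]_n := q - along q *: e.
(** Slope [c] along the axis, a wall beyond the end [along q = 1] and a quadratic penalty off the
    axis. The wall can only steepen the slope along [e], so it never falls below [c]; this is the
    bound that survives in the mean value inequality. *)
Definition tube_fun q : R :=
  c * along q + M * pospart (along q - 1) ^+ 2 + K / 2 * enorm (across q) ^+ 2.
Definition tube_grad q : 'rV[R]_n :=
  ((c + 2 * M * pospart (along q - 1)) / enorm e ^+ 2) *: e + K *: across q.

Let N0 : 0 < N. Proof. by rewrite exprn_gt0// enorm_gt0. Qed.

Lemma alongD q h : along (q + h) = along q + along h.
Proof. by rewrite /along innerDl mulrDl. Qed.

Lemma acrossD q h : across (q + h) = across q + across h.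
Proof. by rewrite /across alongD scalerDl opprD addrACA. Qed.

Lemma inner_along q : inner q e = along q * N.
Proof. by rewrite /along divfK// gt_eqF. Qed.

Lemma inner_across q : inner (across q) e = 0.
Proof.
by rewrite /across innerDl innerNl innerZl -sqr_enorm -/N inner_along subrr.
Qed.

Lemma across_dec q : q = across q + along q *: e.
Proof. by rewrite subrK. Qed.

Lemma sqr_enorm_dec q : enorm q ^+ 2 = enorm (across q) ^+ 2 + along q ^+ 2 * N.
Proof.
rewrite {1}(across_dec q) !sqr_enorm; have := inner_across q.
move: (across q) => p hp.
by rewrite !innerE (innerC e p) hp /N sqr_enorm; ring.
Qed.

Lemma along_e : along e = 1.
Proof. by rewrite /along -sqr_enorm divff// gt_eqF. Qed.

Lemma across_e : across e = 0.
Proof. by rewrite /across along_e scale1r subrr. Qed.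

Lemma tube_gradE q : inner (tube_grad q) e = c + 2 * M * pospart (along q - 1).
Proof.
rewrite /tube_grad innerDl !innerZl inner_across mulr0 addr0 -sqr_enorm divfK//.
by rewrite gt_eqF.
Qed.

Lemma tube_grad_ge q : c <= inner (tube_grad q) e.
Proof. by rewrite tube_gradE lerDl mulr_ge0 ?pospart_ge0 ?(mulr_ge0 _ M0). Qed.

(** The decomposition is orthogonal, so the curvatures [M / N] along the axis and [K / 2] across it
    can be estimated separately; their sum serves both directions. *)
Lemma tube_fun_le q h : tube_fun (q + h) <= tube_fun q + inner (tube_grad q) h +
  (M / N + K / 2) * enorm h ^+ 2.
Proof.
have H : tube_fun (q + h) <= tube_fun q + (c + 2 * M * pospart (along q - 1)) * along h +
    M * along h ^+ 2 + K * inner (across q) (across h) + K / 2 * enorm (across h) ^+ 2.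
  rewrite /tube_fun alongD acrossD.
  have E : enorm (across q + across h) ^+ 2 = enorm (across q) ^+ 2 +
     2 * inner (across q) (across h) + enorm (across h) ^+ 2.
    rewrite !sqr_enorm; move: (across q) (across h) => s t.
    by rewrite !innerE (innerC t s); ring.
  rewrite E; have := sqr_pospart_le (along q - 1) (along q + along h - 1).
  have -> : along q + along h - 1 - (along q - 1) = along h by ring.
  by move=> /(ler_wpM2l M0); lra.
apply: (le_trans H).
have E1 : inner (across q) h = inner (across q) (across h).
  have := inner_across q; move: (across q) => p hp.
  by rewrite [in LHS](across_dec h) innerDr innerZr hp mulr0 addr0.
have E2 : inner (tube_grad q) h = (c + 2 * M * pospart (along q - 1)) * along h +
    K * inner (across q) (across h).
  rewrite -E1 /tube_grad; move: (across q) (c + 2 * M * pospart (along q - 1)) => p A.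
  rewrite innerDl !innerZl (innerC e h) inner_along -/N.
  by rewrite mulrA (mulrAC (A / _)) divfK// gt_eqF.
rewrite E2 (sqr_enorm_dec h).
have -> : (M / N + K / 2) * (enorm (across h) ^+ 2 + along h ^+ 2 * N) =
   M / N * enorm (across h) ^+ 2 + K / 2 * enorm (across h) ^+ 2 + M * along h ^+ 2
   + K / 2 * (along h ^+ 2 * N) by field; rewrite gt_eqF.
have h1 : 0 <= M / N * enorm (across h) ^+ 2.
  by apply: mulr_ge0; [apply: divr_ge0 => //; exact: ltW|exact: sqr_ge0].
have h2 : 0 <= K / 2 * (along h ^+ 2 * N).
  by apply: mulr_ge0; [exact: divr_ge0|apply: mulr_ge0; [exact: sqr_ge0|exact: ltW]].
by move: h1 h2; lra.
Qed.

Lemma enorm_across_le q : enorm (across q) <= enorm q.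
Proof.
by rewrite -ler_sqr ?nnegrE ?enorm_ge0// (sqr_enorm_dec q) lerDl mulr_ge0 ?sqr_ge0// ltW.
Qed.

Lemma along_le q : `|along q| * enorm e <= enorm q.
Proof.
rewrite -ler_sqr ?nnegrE ?enorm_ge0 ?mulr_ge0 ?enorm_ge0// (sqr_enorm_dec q) exprMn.
by rewrite real_normK ?num_real// lerDr sqr_ge0.
Qed.

End Tube.

Section Cvg.
Context {R : realType}.

Lemma cvg_along {n} (e : 'rV[R]_n) (u : nat -> 'rV[R]_n) (x : 'rV[R]_n) :
  u @ ultra --> x -> (fun k => along e (u k)) @ ultra --> along e x.
Proof.
by move=> ux; apply: cvgM; [apply: cvg_inner => //; exact: cvg_cst|exact: cvg_cst].
Qed.

Lemma cvg_across {n} (e : 'rV[R]_n) (u : nat -> 'rV[R]_n) (x : 'rV[R]_n) :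
  u @ ultra --> x -> (fun k => across e (u k)) @ ultra --> across e x.
Proof.
by move=> ux; apply: cvgB => //; apply: cvg_scale; [exact: cvg_along|exact: cvg_cst].
Qed.

Lemma cvg_tube_fun {n} (e : 'rV[R]_n) c M K (u : nat -> 'rV[R]_n) (x : 'rV[R]_n) :
  u @ ultra --> x -> (fun k => tube_fun e c M K (u k)) @ ultra --> tube_fun e c M K x.
Proof.
move=> ux; have aa : (fun k => along e (u k)) @ ultra --> along e x by exact: cvg_along.
have a1 : (fun k => along e (u k) - 1) @ ultra --> along e x - 1.
  by apply: cvgB => //; exact: cvg_cst.
have pp : (fun k => pospart (along e (u k) - 1)) @ ultra --> pospart (along e x - 1).
  apply: cvgM; last exact: cvg_cst.
  by apply: cvgD => //; exact: cvg_norm.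
apply: cvgD; last by apply: cvgM; [exact: cvg_cst|apply/cvg_sqr_enorm/cvg_across].
apply: cvgD; first by apply: cvgM; [exact: cvg_cst|].
apply: cvgM; first exact: cvg_cst.
rewrite expr2 (_ : (fun _ => _) = fun k => pospart (along e (u k) - 1) * pospart (along e (u k) - 1)).
  exact: cvgM.
by apply/funext => k; rewrite expr2.
Qed.

Lemma ultra_le_cvg (u v : nat -> R) (a b : R) : u @ ultra --> a -> v @ ultra --> b ->
  (forall k, u k <= v k) -> a <= b.
Proof.
move=> ua vb uv; apply/ler_addgt0Pr => e e0; have e2 : 0 < e / 2 by rewrite divr_gt0.
case: (filter_ex (filterI (cvg_real_near ua e2) (cvg_real_near vb e2))) => k [].
have := uv k; rewrite !ltr_norml => ? /andP[? ?] /andP[? ?]; lra.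
Qed.

End Cvg.

(** * Prox-regularity and Minty coordinates *)

Section Localization.
Context {R : realType} {n m : nat} (pb : problem R n m).
Notation phi0 := (pphi0 pb).
Notation g := (pg pb).
Notation psi := (ppsi pb).
Notation xbar := (pxbar pb).
Notation lag := (lag_grad pb).
Notation zbar := (g xbar).
Let psiN := (ppsi_proper pb).1.

Definition phi_real (x : 'rV[R]_n) : R := phi0 x + fine (psi (g x)).

Definition graph_pt (r : R) (x v : 'rV[R]_n) (y : 'rV[R]_m) : Prop :=
  [/\ enorm (x - xbar) < r, enorm v < r, v = lag x y & csub psi (g x) y].

(* Prox-regularity with modulus [s]; for [s = - sigma < 0] it is uniform quadratic
   growth. *)
Definition prox_reg (s r : R) : Prop := forall (x v : 'rV[R]_n) (y : 'rV[R]_m) (x' : 'rV[R]_n),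
  graph_pt r x v y ->
  enorm (x' - xbar) < r -> (psi (g x') < +oo)%E ->
  phi_real x + inner v (x' - x) - s / 2 * enorm (x' - x) ^+ 2 <= phi_real x'.

Lemma graph_pt_le r r' x v y : r <= r' -> graph_pt r x v y -> graph_pt r' x v y.
Proof. by move=> rr [h1 h2 h3 h4]; split=> //; exact: lt_le_trans rr. Qed.

Lemma prox_reg_le s r r' : r' <= r -> prox_reg s r -> prox_reg s r'.
Proof.
move=> rr st x v y x' /(graph_pt_le rr) l xr; apply: (st _ _ _ _ l).
exact: lt_le_trans xr rr.
Qed.

Lemma exists_multiplier : exists y, csub psi zbar y /\ 0 = lag xbar y.
Proof.
have [r r0 hr] := chain_rule pb; have [||y] := hr xbar 0 _ _ (pstationary pb).
- by rewrite subrr enorm0.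
- by rewrite enorm0.
by exists y.
Qed.

(** The subgradient inequality of [psi] at [g x'] is added to the second-order estimate of the
    Lagrangian, which is uniform because multipliers are bounded by [K]. The final [+ 1] in the
    modulus ensures positivity. *)
Lemma prox_reg_exists : exists r s : R, [/\ 0 < r, 0 < s & prox_reg s r].
Proof.
have [rB [K [rB0 K0 hB]]] := bounded_multipliers pb.
have [rL [C [rL0 C0 hL]]] := lag_local pb.
have [rg rg0 hg] := g_near pb rB0.
exists (Num.min rB (Num.min rL rg)), (2 * (C * (1 + K)) + 1); split.
- by rewrite !lt_min rB0 rL0.
- have : 0 <= C * (1 + K) by rewrite mulr_ge0 ?addr_ge0.
  lra.
move=> x v y x' [+ + vE [fx hy]]; rewrite {}vE !lt_min.
move=> /and3P[xB xL xg] /and3P[vB _ _] /and3P[_ xL' _] fx'.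
have yK : enorm y <= K := hB x (g x) y xB (hg x xg) (conj fx hy) vB.
have [h1 _ _] := hL x x' y xL xL'.
have := hy (g x'); rewrite (fin_domE (psiN _) fx) (fin_domE (psiN _) fx') -EFinD lee_fin.
rewrite innerDr innerNr => h2.
have h3 : C * (1 + enorm y) * enorm (x' - x) ^+ 2 <= C * (1 + K) * enorm (x' - x) ^+ 2.
  by rewrite ler_wpM2r ?sqr_ge0// ler_wpM2l// lerD2l.
have h4 := sqr_ge0 (enorm (x' - x)).
move: h1; rewrite ler_norml => /andP[h1 _]; rewrite /phi_real.
by move: h1 h2 h3 h4; clear; lra.
Qed.

(** The sum of the two prox-regularity inequalities, each tested at the other point. *)
Lemma hypomonotone s r x1 v1 y1 x2 v2 y2 : prox_reg s r -> graph_pt r x1 v1 y1 -> graph_pt r x2 v2 y2 ->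
  - s * enorm (x1 - x2) ^+ 2 <= inner (x1 - x2) (v1 - v2).
Proof.
move=> st l1 l2; have [h1 _ _ [f1 _]] := l1; have [h2 _ _ [f2 _]] := l2.
have := st _ _ _ _ l1 h2 f2; have := st _ _ _ _ l2 h1 f1.
rewrite (enormB x2) -(opprB x1 x2) innerNr (innerC (x1 - x2)) innerDl innerNl.
by clear; lra.
Qed.

(* Minty parametrization of a hypomonotone graph. *)
Lemma minty_lipschitz (s lam : R) (X Y : 'rV[R]_n) : 0 < lam -> lam * s < 1 ->
  - s * enorm X ^+ 2 <= inner X Y ->
  (1 - lam * s) * enorm X <= enorm (X + lam *: Y) /\
  (1 - lam * s) * lam * enorm Y <= (2 - lam * s) * enorm (X + lam *: Y).
Proof.
move=> l0 ls XY; set e := X + lam *: Y.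
have k0 : 0 < 1 - lam * s by rewrite subr_gt0.
have h1 : (1 - lam * s) * enorm X <= enorm e.
  have [->|X0] := eqVneq X 0; first by rewrite enorm0 mulr0 enorm_ge0.
  have Xn : 0 < enorm X by rewrite enorm_gt0.
  rewrite -(ler_pM2l Xn); apply: le_trans (inner_le X e).
  rewrite /e innerDr innerZr -sqr_enorm.
  have := ler_wpM2l (ltW l0) XY; rewrite expr2; lra.
split=> //; have h2 : lam * enorm Y <= enorm e + enorm X.
  have -> : lam * enorm Y = enorm (lam *: Y) by rewrite enormZ gtr0_norm.
  have -> : lam *: Y = e - X by rewrite /e addrAC subrr add0r.
  by rewrite (le_trans (enormD _ _))// enormN.
have := ler_wpM2l (ltW k0) h2; lra.
Qed.

End Localization.

Lemma minty_const {R : realType} {n} (s lam : R) : 0 < lam -> lam * s < 1 ->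
  exists2 L : R, 0 < L & forall X Y : 'rV[R]_n, - s * enorm X ^+ 2 <= inner X Y ->
    enorm X <= L * enorm (X + lam *: Y) /\ enorm Y <= L * enorm (X + lam *: Y).
Proof.
move=> l0 ls; have k0 : 0 < 1 - lam * s by rewrite subr_gt0.
have k2 : 0 < 2 - lam * s by lra.
have kl : 0 < (1 - lam * s) * lam by rewrite mulr_gt0.
pose L1 := (1 - lam * s)^-1; pose L2 := (2 - lam * s) / ((1 - lam * s) * lam).
have L10 : 0 < L1 by rewrite invr_gt0.
have L20 : 0 < L2 by rewrite divr_gt0.
exists (L1 + L2) => [|X Y XY]; first exact: addr_gt0.
have [h1 h2] := minty_lipschitz l0 ls XY; set E := enorm (X + lam *: Y) in h1 h2 *.
have E0 : 0 <= E := enorm_ge0 _; rewrite mulrDl; split.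
  apply: (@le_trans _ _ (L1 * E)); last by rewrite lerDl mulr_ge0// ltW.
  by rewrite /L1 mulrC ler_pdivlMr// mulrC.
apply: (@le_trans _ _ (L2 * E)); last by rewrite lerDr mulr_ge0// ltW.
by rewrite /L2 mulrAC ler_pdivlMr// mulrC.
Qed.

Section MeanValue.
Context {R : realType} {n m : nat} (pb : problem R n m).
Notation g := (pg pb).
Notation psi := (ppsi pb).
Notation xbar := (pxbar pb).
Notation lag := (lag_grad pb).
Notation zbar := (g xbar).
Let fp := ppsi_proper pb.
Let fl := ppsi_lsc pb.

(** Compactness is due to [bounded_multipliers]: small [x - xbar] and [lag x y] leave only bounded
    [y]. *)
Lemma region_minimizer : exists2 r : R, 0 < r & forall (r0 : R)
    (Q : 'rV[R]_n -> 'rV[R]_m -> Prop) (f : 'rV[R]_n -> 'rV[R]_m -> R), r0 < r ->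
  (forall (x_ : nat -> 'rV[R]_n) (y_ : nat -> 'rV[R]_m) (x : 'rV[R]_n) (y : 'rV[R]_m),
    x_ @ ultra --> x -> y_ @ ultra --> y -> (fun k => f (x_ k) (y_ k)) @ ultra --> f x y) ->
  (forall (x_ : nat -> 'rV[R]_n) (y_ : nat -> 'rV[R]_m) (x : 'rV[R]_n) (y : 'rV[R]_m),
    x_ @ ultra --> x -> y_ @ ultra --> y -> (forall k, Q (x_ k) (y_ k)) -> Q x y) ->
  let P x y := [/\ csub psi (g x) y, enorm (x - xbar) <= r0, enorm (lag x y) <= r0 & Q x y] in
  (exists (x : 'rV[R]_n) (y : 'rV[R]_m), P x y) ->
  exists (x : 'rV[R]_n) (y : 'rV[R]_m), P x y /\
    forall (x' : 'rV[R]_n) (y' : 'rV[R]_m), P x' y' -> f x y <= f x' y'.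
Proof.
have [rB [K [rB0 K0 hB]]] := bounded_multipliers pb.
have [rg rg0 hg] := g_near pb rB0.
exists (Num.min rB rg); first by rewrite lt_min rB0.
move=> r0 Q f; rewrite lt_min => /andP[r0B r0g] fcont Qclosed P [x1 [y1 P1]].
have [||[x y] /= Pxy hmin] := @exists_minimizer R _ (fun a => P a.1 a.2) (fun a => f a.1 a.2).
- by exists (x1, y1).
- move=> a_ Pa.
  have [|x' xx xr] := @bounded_cvg_ultra R n (fun k => (a_ k).1 - xbar) r0.
    by apply: nearW => k; have [] := Pa k.
  have [|y yy _] := @bounded_cvg_ultra R m (fun k => (a_ k).2) K.
    apply: nearW => k; have [h1 h2 h3 _] := Pa k.
    apply: (hB (a_ k).1 (g (a_ k).1)) => //; [exact: le_lt_trans h2 _|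
      apply: hg; exact: le_lt_trans h2 _|exact: le_lt_trans h3 _].
  have {}xx := cvg_of_sub xx; set x := x' + xbar in xx.
  have fcv := fcont _ _ _ _ xx yy.
  have lcv := @cvg_lag R n m pb _ _ _ _ xx yy.
  have gcv : (fun k => g (a_ k).1) @ ultra --> g x.
    by apply: (cvg_comp (fun k => (a_ k).1) g xx); exact: cvg_g (pg_C2 pb) _.
  exists (x, y) => /=.
    split.
    + by apply: (csub_cvg fp fl gcv yy); apply: nearW => k; have [] := Pa k.
    + by rewrite addrK.
    + apply: (@ultra_le_cvg R _ (cst r0) _ _ (cvg_enorm lcv)); first exact: cvg_cst.
      by move=> k; have [] := Pa k.
    + by apply: (Qclosed _ _ _ _ xx yy) => k; have [] := Pa k.
  move=> l hl; apply/ler_addgt0Pr => e e0.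
  case: (filter_ex (filterI hl (cvg_real_near fcv e0))) => j [h1].
  by rewrite ltr_norml => /andP[h2 _]; move: h1 h2; clear; lra.
by exists x, y; split=> // x' y' P'; exact: (hmin (x', y')).
Qed.

Lemma lag_lipschitz : exists r C : R, [/\ 0 < r, 0 <= C & forall x x' y y',
  enorm (x - xbar) < r -> enorm (x' - xbar) < r ->
  enorm (lag x' y' - lag x y) <= C * (1 + enorm y) * (enorm (x' - x) + enorm (y' - y))].
Proof.
have [r [C [r0 C0 h]]] := lag_local pb; exists r, C; split=> // x x' y y' xr xr'.
have [_ h1 _] := h x x' y xr xr'; have [_ _ h2] := h x' x (y' - y) xr' xr.
apply: (le_trans (enorm_dist _ (lag x' y) _)); rewrite lagB mulrDr addrC.
apply: lerD h1 _; apply: (le_trans h2); rewrite ler_wpM2r ?enorm_ge0//.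
by rewrite ler_peMr// lerDl enorm_ge0.
Qed.

End MeanValue.

Lemma sqr_sum_le {R : realType} (a b : R) : (a + b) ^+ 2 <= 2 * (a ^+ 2 + b ^+ 2).
Proof. by have := sqr_ge0 (a - b); nra. Qed.

Lemma ltr_of_sqr {R : realType} (a b : R) : 0 <= b -> a ^+ 2 < b ^+ 2 -> a < b.
Proof. by move=> b0 h; rewrite ltNge; apply/negP => ba; nra. Qed.

Lemma shift_affine {R : realType} {n} (x x' v v' z : 'rV[R]_n) (lam : R) :
  x' + lam *: v' - z = (x + lam *: v - z) + (x' - x + lam *: (v' - v)).
Proof. by rewrite scalerBr; apply/rowP => i; rewrite !mxE; ring. Qed.

Section MeanValueNormal.
Context {R : realType} {n m : nat} (pb : problem R n m).
Notation g := (pg pb).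
Notation psi := (ppsi pb).
Notation xbar := (pxbar pb).
Notation lag := (lag_grad pb).
Notation graph_pt := (graph_pt pb).
Notation prox_reg := (prox_reg pb).

Opaque inner enorm lag_grad along across.

(* An interior local minimizer of [<a, v> + <b, x> + P (x + lam v)]
   over the graph, where [P] has slope at least [c] along the segment. *)
Lemma tube_minimizer (s lam r : R) : 0 < r -> prox_reg s r -> 0 < lam -> lam * s < 1 ->
  exists2 r' : R, 0 < r' &
  forall (x1 v1 : 'rV[R]_n) (y1 : 'rV[R]_m) (x2 v2 : 'rV[R]_n) (y2 : 'rV[R]_m),
    graph_pt r' x1 v1 y1 -> graph_pt r' x2 v2 y2 ->
  x1 - x2 != 0 -> forall (a b : 'rV[R]_n) (d : R), 0 < d ->
  let e := x1 - x2 + lam *: (v1 - v2) in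
  let c := - inner a (v1 - v2) - inner b (x1 - x2) - d in
  exists (M K : R) (x : 'rV[R]_n) (y : 'rV[R]_m),
  let q (x' : 'rV[R]_n) (y' : 'rV[R]_m) := x' + lam *: lag x' y' - (x2 + lam *: v2) in
  [/\ [/\ e != 0, 0 <= M & 0 <= K], graph_pt r x (lag x y) y & exists2 rho : R, 0 < rho &
    forall (x' : 'rV[R]_n) (y' : 'rV[R]_m), csub psi (g x') y' ->
      enorm (x' - x) < rho -> enorm (y' - y) < rho ->
    inner a (lag x y) + inner b x + tube_fun e c M K (q x y) <=
    inner a (lag x' y') + inner b x' + tube_fun e c M K (q x' y')].
Proof.
move=> r0 st l0 ls.
have [L L0 hL] := @minty_const R n s lam l0 ls.
have [rR rR0 hR] := region_minimizer pb.
have [rL [CL [rL0 CL0 hLip]]] := lag_lipschitz pb.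
have [y0 [y0sub y0E]] := exists_multiplier pb.
pose R0 := Num.min r (Num.min rR rL) / 2.
have m0 : 0 < Num.min r (Num.min rR rL) by rewrite !lt_min r0 rR0.
have R00 : 0 < R0 by rewrite divr_gt0.
have R0lt : R0 < Num.min r (Num.min rR rL) by rewrite ltr_pdivrMr// ltr_pMr// ltr1n.
move: R0lt; rewrite !lt_min => /and3P[R0r R0R R0L].
have l1 : 0 < 1 + lam by rewrite addr_gt0.
have L1 : 0 < L + 1 by rewrite addr_gt0.
(* The minimizer will satisfy [enorm (q x y) <= 3 * enorm e], which is below [6 * (1 + lam) * r'],
   and the origin [z2] of [q] contributes one more [(1 + lam) * r']. The Minty constant [L] then
   keeps [x] and its subgradient strictly within [R0] of [(xbar, 0)]. *)
pose r' := R0 / (7 * (1 + lam) * (L + 1)).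
have den0 : 0 < 7 * (1 + lam) * (L + 1) by rewrite !mulr_gt0.
have r'0 : 0 < r' by rewrite divr_gt0.
have r'R : r' <= R0.
  rewrite ler_pdivrMr// ler_peMr ?(ltW R00)//.
  by apply: mulr_ege1; move: l0 L0; clear; lra.
have r'L : L * (7 * (1 + lam) * r') < R0.
  have -> : L * (7 * (1 + lam) * r') = R0 * (L / (L + 1)).
    by rewrite /r'; field; rewrite !gt_eqF.
  by rewrite gtr_pMr// ltr_pdivrMr// mul1r ltrDl.
exists r' => // x1 v1 y1 x2 v2 y2 loc1 loc2 X0 a b d d0 e c.
have hyp := hypomonotone st (graph_pt_le _ loc1) (graph_pt_le _ loc2).
have {}hyp : - s * enorm (x1 - x2) ^+ 2 <= inner (x1 - x2) (v1 - v2).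
  by apply: hyp; apply: (le_trans r'R); exact: ltW.
have [Xe Ye] := hL _ _ hyp; rewrite -/e in Xe Ye.
have en0 : 0 < enorm e.
  rewrite -(pmulr_rgt0 _ L0); apply: lt_le_trans Xe; exact: enorm_gt0.
have e0 : e != 0 by apply: contraTneq en0 => ->; rewrite enorm0 ltxx.
have [x1r v1r v1E sub1] := loc1; have [x2r v2r v2E sub2] := loc2.
pose z2 := x2 + lam *: v2.
have z_near (x v : 'rV[R]_n) : enorm (x - xbar) < r' -> enorm v < r' ->
    enorm (x + lam *: v - xbar) < (1 + lam) * r'.
  move=> h1 h2; rewrite addrAC (le_lt_trans (enormD _ _))// enormZ gtr0_norm// mulrDl mul1r.
  by rewrite ltrD// ltr_pM2l.
have z2n := z_near _ _ x2r v2r.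
have en : enorm e < 2 * (1 + lam) * r'.
  have -> : e = (x1 + lam *: v1 - xbar) - (x2 + lam *: v2 - xbar).
    by rewrite /e scalerBr; apply/rowP => i; rewrite !mxE; ring.
  rewrite (le_lt_trans (enormD _ _))// enormN.
  by have := z_near _ _ x1r v1r; move: z2n; clear; lra.
pose V2 := inner a v2 + inner b x2.
pose A := enorm a; pose B := enorm b.
have A0 : 0 <= A := enorm_ge0 _; have B0 : 0 <= B := enorm_ge0 _.
(* A bound over the region for what the terms without a barrier can gain against [V2 - d]; the
   factor [2] reflects [along <= 2]. *)
pose G0 := A * R0 + B * (enorm xbar + R0) + 2 * `|c| + `|V2 - d|.
have G00 : 0 <= G0.
  by rewrite !addr_ge0 ?mulr_ge0 ?addr_ge0 ?enorm_ge0// ltW.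
(* On the face [along = 0], a point closer than [tau] to the axis is within [L * tau] of [(x2, v2)]
   in each variable, which changes the linear part by less than [d]. *)
pose tau := d / (L * (A + B) + 1).
have tden : 0 < L * (A + B) + 1 by rewrite ltr_wpDl// mulr_ge0 ?addr_ge0// ltW.
have tau0 : 0 < tau by rewrite divr_gt0.
have tauE : L * (A + B) * tau < d.
  rewrite /tau mulrA ltr_pdivrMr// mulrC ltr_pM2l//; lra.
pose N := enorm e ^+ 2.
have N0 : 0 < N by rewrite exprn_gt0.
pose mn := Num.min N (tau ^+ 2).
have mn0 : 0 < mn by rewrite lt_min N0 exprn_gt0.
(* [M] excludes the face [along = 2], where the squared positive part is [1]; [K] forces the squared
   distance to the axis below [mn], which excludes the lateral face and provides the closeness
   [tau]. *)
pose M := 2 * G0 + 1; pose K := (4 * G0 + 1) / mn.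
have M0 : 0 <= M by rewrite addr_ge0// mulr_ge0.
have K0 : 0 <= K by rewrite divr_ge0 ?(ltW mn0)// addr_ge0// mulr_ge0.
pose q (x' : 'rV[R]_n) (y' : 'rV[R]_m) := x' + lam *: lag x' y' - z2.
pose F (x : 'rV[R]_n) (y : 'rV[R]_m) := inner a (lag x y) + inner b x + tube_fun e c M K (q x y).
pose Q (x : 'rV[R]_n) (y : 'rV[R]_m) := [/\ 0 <= along e (q x y), along e (q x y) <= 2 &
  enorm (across e (q x y)) ^+ 2 <= N].
have q_cvg (x_ : nat -> 'rV[R]_n) (y_ : nat -> 'rV[R]_m) (x : 'rV[R]_n) (y : 'rV[R]_m) :
    x_ @ ultra --> x -> y_ @ ultra --> y -> (fun k => q (x_ k) (y_ k)) @ ultra --> q x y.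
  move=> xx yy; apply: cvg_sub_cst; apply: cvgD => //; apply: cvg_scale; first exact: cvg_cst.
  exact: cvg_lag.
have Fcvg (x_ : nat -> 'rV[R]_n) (y_ : nat -> 'rV[R]_m) (x : 'rV[R]_n) (y : 'rV[R]_m) :
    x_ @ ultra --> x -> y_ @ ultra --> y -> (fun k => F (x_ k) (y_ k)) @ ultra --> F x y.
  move=> xx yy; apply: cvgD; last by apply: cvg_tube_fun; exact: q_cvg.
  apply: cvgD; first by apply: cvg_inner; [exact: cvg_cst|exact: cvg_lag].
  by apply: cvg_inner => //; exact: cvg_cst.
have Qcl (x_ : nat -> 'rV[R]_n) (y_ : nat -> 'rV[R]_m) (x : 'rV[R]_n) (y : 'rV[R]_m) :
    x_ @ ultra --> x -> y_ @ ultra --> y -> (forall k, Q (x_ k) (y_ k)) -> Q x y.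
  move=> xx yy Qk; have qq := q_cvg _ _ _ _ xx yy; split.
  - apply: (@ultra_le_cvg R (cst 0) _ _ _ _ (cvg_along qq)); first exact: cvg_cst.
    by move=> k; have [] := Qk k.
  - apply: (@ultra_le_cvg R _ (cst 2) _ _ (cvg_along qq)); first exact: cvg_cst.
    by move=> k; have [] := Qk k.
  - apply: (@ultra_le_cvg R _ (cst N) _ _ (cvg_sqr_enorm (cvg_across qq))); first exact: cvg_cst.
    by move=> k; have [] := Qk k.
have q1 : q x1 y1 = e.
  by rewrite /q /z2 -v1E /e scalerBr; apply/rowP => i; rewrite !mxE; ring.
have hx1 : enorm (x1 - xbar) <= R0 := le_trans (ltW x1r) r'R.
have hv1 : enorm (lag x1 y1) <= R0 by rewrite -v1E (le_trans (ltW v1r) r'R).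
have Q1 : Q x1 y1.
  rewrite /Q q1 (along_e e0) (across_e e0) enorm0 expr0n/= ler01 ler1n.
  by split=> //; exact: ltW.
have P1 : exists (x : 'rV[R]_n) (y : 'rV[R]_m),
    [/\ csub psi (g x) y, enorm (x - xbar) <= R0, enorm (lag x y) <= R0 & Q x y].
  by exists x1, y1.
(* The choice of [c] puts the value at the first end [d] below the value [V2] at the second, so no
   minimizer lies on the face through the second end. *)
have F1 : F x1 y1 = V2 - d.
  rewrite /F q1 /tube_fun (along_e e0) (across_e e0) enorm0 -v1E subrr /pospart normr0 /c /V2.
  have -> : inner a (v1 - v2) = inner a v1 - inner a v2 by rewrite innerDr innerNr.
  have -> : inner b (x1 - x2) = inner b x1 - inner b x2 by rewrite innerDr innerNr.
  by field.
have [x [y [[xysub xR vR [al0 al2 acN]] hmin]]] := hR R0 Q F R0R Fcvg Qcl P1.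
have {hmin}hmin x' y' : csub psi (g x') y' -> enorm (x' - xbar) <= R0 ->
    enorm (lag x' y') <= R0 -> Q x' y' -> F x y <= F x' y' by move=> *; apply: hmin.
have Fle : F x y <= V2 - d.
  have h := hmin x1 y1 sub1 hx1 hv1 Q1.
  by rewrite F1 in h.
clear hR P1 Fcvg q_cvg Qcl F1 q1.
set t := along e (q x y) in al0 al2 *; set ac := enorm (across e (q x y)) in acN *.
have ac0 : 0 <= ac := enorm_ge0 _.
have aLB : - (A * R0) <= inner a (lag x y).
  by apply: le_trans (inner_ge a (lag x y)); rewrite lerN2 ler_wpM2l.
have bLB : - (B * (enorm xbar + R0)) <= inner b x.
  apply: le_trans (inner_ge b x); rewrite lerN2 ler_wpM2l//.
  by apply: (le_trans (enorm_le_sub x xbar)); rewrite lerD2l.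
have cLB : - (2 * `|c|) <= c * t.
  have : `|c * t| <= 2 * `|c| by rewrite normrM (ger0_norm al0) mulrC ler_wpM2r.
  by rewrite ler_norml => /andP[].
have Fxy : F x y = inner a (lag x y) + inner b x + (c * t + M * pospart (t - 1) ^+ 2 + K / 2 * ac ^+ 2).
  by [].
have p0 : 0 <= M * pospart (t - 1) ^+ 2 by rewrite mulr_ge0// sqr_ge0.
have k0 : 0 <= K / 2 * ac ^+ 2 by rewrite mulr_ge0 ?sqr_ge0// divr_ge0.
have Vd := ler_norm (V2 - d).
have acb : ac ^+ 2 < mn.
  have h : K / 2 * ac ^+ 2 <= 2 * G0.
    by move: Fle aLB bLB cLB p0 Vd G00; rewrite Fxy /G0; atom_lra.
  have : (4 * G0 + 1) * ac ^+ 2 <= 4 * G0 * mn.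
    by move: h; rewrite /K mulrAC ler_pdivrMr// mulrAC ler_pdivrMr//; clear; lra.
  have G1 : 0 < 4 * G0 + 1 by rewrite ltr_wpDl// mulr_ge0.
  move=> h2; rewrite -(ltr_pM2l G1); apply: (le_lt_trans h2).
  by rewrite ltr_pM2r// ltrDl.
have t2 : t < 2.
  rewrite lt_neqAle al2 andbT; apply/negP => /eqP tE.
  have : M * pospart (t - 1) ^+ 2 <= 2 * G0.
    by move: Fle aLB bLB cLB k0 Vd G00; rewrite Fxy /G0; atom_lra.
  rewrite tE /pospart (_ : 2 - 1 = 1 :> R); last by ring.
  rewrite normr1 (_ : (1 + 1) / 2 = 1 :> R); last by field.
  by rewrite expr1n mulr1 /M; clear; lra.
have r'r : r' <= r := le_trans r'R (ltW R0r).
have lxy : graph_pt r x (lag x y) y :=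
  And4 (le_lt_trans xR R0r) (le_lt_trans vR R0r) (erefl _) xysub.
have t0 : 0 < t.
  rewrite lt_neqAle al0 andbT eq_sym; apply/negP => /eqP tE.
  have qa : enorm (q x y) = ac.
    rewrite (across_dec e (q x y)) -/t tE scale0r addr0.
    by rewrite /ac.
  have hyp2 := hypomonotone st lxy (graph_pt_le r'r loc2).
  have [h1 h2] := hL _ _ hyp2.
  have E : x - x2 + lam *: (lag x y - v2) = q x y.
    by rewrite /q /z2 scalerBr; apply/rowP => i; rewrite !mxE; ring.
  rewrite E qa in h1 h2.
  have act : ac < tau.
    by apply: (ltr_of_sqr (ltW tau0)); apply: (lt_le_trans acb); rewrite ge_min lexx orbT.
  have i1 : - (A * (L * ac)) <= inner a (lag x y) - inner a v2.
    rewrite -innerNr -innerDr; apply: le_trans (inner_ge _ _).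
    by rewrite lerN2 ler_wpM2l.
  have i2 : - (B * (L * ac)) <= inner b x - inner b x2.
    rewrite -innerNr -innerDr; apply: le_trans (inner_ge _ _).
    by rewrite lerN2 ler_wpM2l.
  have i3 : L * (A + B) * ac <= L * (A + B) * tau.
    by rewrite ler_wpM2l ?(ltW act)// mulr_ge0 ?addr_ge0// ltW.
  move: Fle; rewrite Fxy tE mulr0 => Fle; rewrite tE in p0.
  by move: Fle i1 i2 i3 tauE p0 k0; rewrite /V2; atom_lra.
have acE : ac < enorm e.
  by apply: (ltr_of_sqr (ltW en0)); apply: (lt_le_trans acb); rewrite ge_min lexx.
have xx0 : enorm (xbar - xbar) < r by rewrite subrr enorm0.
have vv0 : enorm (0 : 'rV[R]_n) < r by rewrite enorm0.
have y0loc : graph_pt r xbar 0 y0 := And4 xx0 vv0 y0E y0sub.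
have qe : enorm (q x y) <= 3 * enorm e.
  have h := sqr_enorm_dec e0 (q x y); rewrite -/ac -/t in h.
  have E9 : (3 * enorm e) ^+ 2 = 9 * N by rewrite /N; ring.
  rewrite -ler_sqr ?nnegrE ?mulr_ge0 ?enorm_ge0// h E9.
  have : t ^+ 2 * N <= 2 ^+ 2 * N.
    by rewrite ler_wpM2r ?(ltW N0)// ler_sqr ?nnegrE.
  by move: acN N0; rewrite /N; clear; lra.
have zb : enorm (x - xbar + lam *: (lag x y - 0)) < 7 * (1 + lam) * r'.
  have -> : x - xbar + lam *: (lag x y - 0) = q x y + (x2 + lam *: v2 - xbar).
    by rewrite subr0 /q /z2; apply/rowP => i; rewrite !mxE; ring.
  apply: (le_lt_trans (enormD _ _)); move: qe en z2n; atom_lra.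
have [h1 h2] := hL _ _ (hypomonotone st lxy y0loc); rewrite subr0 in h1 h2 zb.
have hz : L * enorm (x - xbar + lam *: lag x y) < R0.
  by apply: lt_trans r'L; rewrite ltr_pM2l.
have xR' : enorm (x - xbar) < R0 := le_lt_trans h1 hz.
have vR' : enorm (lag x y) < R0 := le_lt_trans h2 hz.
exists M, K, x, y => q'; split=> //.
clear hL h1 h2 hz zb qe acb p0 k0 Vd cLB bLB aLB Fxy Fle.
pose C1 := CL * (1 + enorm y).
have C10 : 0 <= C1 by rewrite mulr_ge0// addr_ge0// enorm_ge0.
pose BB := 1 + C1 + lam * C1.
have lC : 0 <= lam * C1 by rewrite mulr_ge0// ltW.
have BB0 : 0 < BB by rewrite /BB; move: C10 lC; clear; lra.
(* The least slack among the constraints of the region, all of them strict at this point: the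
   minimizer is a local one over the whole graph. *)
pose gam := Num.min (R0 - enorm (x - xbar)) (Num.min (R0 - enorm (lag x y))
  (Num.min (t * enorm e) (Num.min ((2 - t) * enorm e) (enorm e - ac)))).
have gam0 : 0 < gam.
  have tt : 0 < 2 - t by rewrite subr_gt0.
  rewrite /gam !lt_min !subr_gt0 xR' vR' acE.
  by rewrite (mulr_gt0 t0 en0) (mulr_gt0 tt en0).
exists (gam / (2 * BB)); first by rewrite divr_gt0// mulr_gt0.
move=> x' y' sub' xr yr.
pose S := enorm (x' - x) + enorm (y' - y).
have S0 : 0 <= S by rewrite addr_ge0 ?enorm_ge0.
have BS : BB * S < gam.
  have : S < gam / BB.
    have -> : gam / BB = gam / (2 * BB) + gam / (2 * BB) by field; rewrite gt_eqF.
    exact: ltrD.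
  by rewrite ltr_pdivlMr// mulrC.
have xS : enorm (x' - x) <= BB * S.
  apply: (@le_trans _ _ (1 * S)); first by rewrite mul1r lerDl enorm_ge0.
  by rewrite ler_wpM2r// /BB; move: C10 lC; clear; lra.
move: BS; rewrite /gam !lt_min => /and5P[g1 g2 g3 g4 g5].
have x'R : enorm (x' - xbar) < R0.
  apply: (le_lt_trans (enorm_dist _ x _)); move: xS g1; atom_lra.
have vS : enorm (lag x' y' - lag x y) <= C1 * S.
  by apply: hLip; [exact: lt_trans xR' _|exact: lt_trans x'R _].
have vBS : enorm (lag x' y' - lag x y) <= BB * S.
  by apply: (le_trans vS); rewrite ler_wpM2r// /BB; move: lC; clear; lra.
pose h := x' - x + lam *: (lag x' y' - lag x y).
have hS : enorm h <= BB * S.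
  apply: (le_trans (enormD _ _)); rewrite enormZ gtr0_norm//.
  have h1 : enorm (x' - x) <= S by rewrite lerDl enorm_ge0.
  have h2 := ler_wpM2l (ltW l0) vS.
  have h3 := mulr_ge0 C10 S0.
  by rewrite /BB; move: h1 h2 h3; atom_lra.
have qh : q x' y' = q x y + h := shift_affine _ _ _ _ _ _.
have alh : `|along e h| * enorm e <= enorm h := along_le e0 h.
apply: (hmin x' y' sub' (ltW x'R)).
  by apply/ltW/(le_lt_trans (enorm_le_sub _ (lag x y))); move: vBS g2; atom_lra.
rewrite /Q qh alongD acrossD -/t.
have th : `|along e h| * enorm e <= BB * S := le_trans alh hS.
have t1 : `|along e h| < t by rewrite -(ltr_pM2r en0); exact: le_lt_trans th g3.
have t3 : `|along e h| < 2 - t by rewrite -(ltr_pM2r en0); exact: le_lt_trans th g4.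
move: t1 t3; rewrite !ltr_norml => /andP[t1 _] /andP[_ t3]; split.
- by move: t1; clear; lra.
- by move: t3; clear; lra.
- rewrite /N ler_sqr ?nnegrE ?enorm_ge0//.
  apply: (le_trans (enormD _ _)); rewrite -/ac.
  have := enorm_across_le e0 h; move: hS g5; atom_lra.
Qed.

End MeanValueNormal.

Lemma inner_shift {R : realType} {n} (p x x' v v' : 'rV[R]_n) (lam : R) :
  inner p (x' - x + lam *: (v' - v)) =
  inner p x' - inner p x + lam * (inner p v' - inner p v).
Proof. by rewrite !innerE. Qed.

(** * Monotonicity and metric regularity of the subgradient graph *)

Section Consequences.
Context {R : realType} {n m : nat} (pb : problem R n m).
Notation g := (pg pb).
Notation psi := (ppsi pb).
Notation xbar := (pxbar pb).
Notation lag := (lag_grad pb).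
Notation xi := (lag_hess pb).
Notation graph_pt := (graph_pt pb).
Notation prox_reg := (prox_reg pb).

Opaque inner enorm lag_grad lag_hess along across tube_fun tube_grad.

(* A mean value inequality for the localized subgradient graph: the increment
   [<a, Y> + <b, X>] is bounded below through a coderivative element. *)
Lemma mean_value_normal (s lam r : R) : 0 < r -> prox_reg s r -> 0 < lam -> lam * s < 1 ->
  exists2 r' : R, 0 < r' &
  forall (x1 v1 : 'rV[R]_n) (y1 : 'rV[R]_m) (x2 v2 : 'rV[R]_n) (y2 : 'rV[R]_m),
    graph_pt r' x1 v1 y1 -> graph_pt r' x2 v2 y2 ->
  x1 - x2 != 0 -> forall (a b : 'rV[R]_n) (d : R), 0 < d -> exists x y p u,
  [/\ graph_pt r x (lag x y) y,
      - inner a (v1 - v2) - inner b (x1 - x2) - d <= inner p (x1 - x2 + lam *: (v1 - v2)),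
      second_subdiff psi (g x) y (jac g x (a + lam *: p)) u &
      b + p + xi x y (a + lam *: p) + jac_adj g x u = 0].
Proof.
move=> r0 st l0 ls.
have [rM rM0 hM] := multiplier_rule pb.
have [rL [CL [rL0 CL0 hLip]]] := lag_lipschitz pb.
pose r1 := Num.min r (Num.min rM rL).
have r10 : 0 < r1 by rewrite !lt_min r0 rM0.
have r1r : r1 <= r by rewrite ge_min lexx.
have r1M : r1 <= rM by rewrite !ge_min lexx !orbT.
have r1L : r1 <= rL by rewrite !ge_min lexx !orbT.
have [r' r'0 H] := tube_minimizer r10 (prox_reg_le r1r st) l0 ls.
exists r' => // x1 v1 y1 x2 v2 y2 loc1 loc2 X0 a b d d0.
have := H _ _ _ _ _ _ loc1 loc2 X0 a b d d0.
set e := x1 - x2 + _; set c := - inner a _ - _ - d.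
move=> [M [K [x [y [[e0 M0 K0] lxy [rho rho0 hmin]]]]]].
pose q x' y' := x' + lam *: lag x' y' - (x2 + lam *: v2).
pose p := tube_grad e c M K (q x y).
have [xr vr _ xysub] := lxy.
have xL : enorm (x - xbar) < rL := lt_le_trans xr r1L.
pose C1 := CL * (1 + enorm y).
have C10 : 0 <= C1 by rewrite mulr_ge0// addr_ge0// enorm_ge0.
pose B := 1 + lam * C1.
have B0 : 0 <= B by rewrite addr_ge0// mulr_ge0// ltW.
pose C2 := M / enorm e ^+ 2 + K / 2.
have C20 : 0 <= C2 by rewrite addr_ge0 ?divr_ge0// sqr_ge0.
pose rho' := Num.min rho (rL - enorm (x - xbar)).
have rho'0 : 0 < rho' by rewrite lt_min rho0 subr_gt0.
have C0 : 0 <= C2 * (2 * B ^+ 2) by rewrite !mulr_ge0// sqr_ge0.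
(* The tube function is replaced by its linearization [p], and its quadratic error fits the
   tolerance of the multiplier rule. Since the argument is [x + lam *: v], the slope [p] is added to
   [b] and [lam *: p] to [a]. *)
have [|u hu1 hu2] := hM x y (a + lam *: p) (b + p) (C2 * (2 * B ^+ 2)) rho'
    (lt_le_trans xr r1M) (lt_le_trans vr r1M) xysub C0 rho'0; last first.
  by exists x, y, p, u; split=> //; [exact: graph_pt_le lxy|exact: tube_grad_ge].
move=> x' y' sub'; rewrite lt_min => /andP[xrho xrL] yr.
have {}yr : enorm (y' - y) < rho by move: yr; rewrite lt_min => /andP[].
have x'L : enorm (x' - xbar) < rL := enorm_lt_trans xrL.
pose S := enorm (x' - x) + enorm (y' - y).
have S0 : 0 <= S by rewrite addr_ge0 ?enorm_ge0.
pose h := x' - x + lam *: (lag x' y' - lag x y).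
have hS : enorm h <= B * S.
  apply: (le_trans (enormD _ _)); rewrite enormZ gtr0_norm//.
  have h1 : enorm (x' - x) <= S by rewrite lerDl enorm_ge0.
  have h2 := ler_wpM2l (ltW l0) (hLip x x' y y' xL x'L).
  by rewrite /B mulrDl mul1r -mulrA lerD.
have : inner a (lag x y) + inner b x + tube_fun e c M K (q x y) <=
  inner a (lag x' y') + inner b x' + tube_fun e c M K (q x' y') := hmin x' y' sub' xrho yr.
have -> : q x' y' = q x y + h := shift_affine _ _ _ _ _ _.
have := tube_fun_le c e0 M0 K0 (q x y) h; rewrite -/p -/C2.
have hh : enorm h ^+ 2 <= 2 * B ^+ 2 * (enorm (x' - x) ^+ 2 + enorm (y' - y) ^+ 2).
  apply: (@le_trans _ _ ((B * S) ^+ 2)).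
    by rewrite ler_sqr ?nnegrE ?enorm_ge0 ?mulr_ge0.
  have E T : 2 * B ^+ 2 * T = B ^+ 2 * (2 * T) by ring.
  by rewrite E exprMn (ler_wpM2l (sqr_ge0 B))// sqr_sum_le.
have := ler_wpM2l C20 hh.
rewrite (inner_shift p) (mulrA C2).
move: (C2 * (2 * B ^+ 2) * (enorm (x' - x) ^+ 2 + enorm (y' - y) ^+ 2)) (C2 * enorm h ^+ 2)
  (tube_fun e c M K (q x y + h)) (tube_fun e c M K (q x y)) => T1 T2 T3 T4.
clearbody p; move: (lag x y) (lag x' y') => v v'.
have E z : inner (a + lam *: p) z = inner a z + lam * inner p z by rewrite innerDl innerZl.
have E' z : inner (b + p) z = inner b z + inner p z by rewrite innerDl.
rewrite !E !E'; atom_lra.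
Qed.

(** With [Z = Y - sig X] and [k = 1 + lam * sig], the Minty vector is [X + lam Y = k (X + l Z)]:
    thus [l] is the Minty parameter of the shifted map, and [a = X - l Z] is the reflected vector.
    Inserting the bound on [pa] leaves [XY - sig * XX >= l |Z - k p|^2 - d], and the first
    inequality assumed says that this square is nonnegative. *)
Lemma cocoercive_algebra (lam sig XX XY YY pp pX pY d : R) : 0 < lam -> 0 <= sig -> 0 <= pp ->
  0 <= pp * (1 + lam * sig) ^+ 2 - 2 * (1 + lam * sig) * (pY - sig * pX) +
    (YY - 2 * sig * XY + sig ^+ 2 * XX) ->
  let l := lam / (1 + lam * sig) in
  (* [a = X - l (Y - sig X)] and [b = - sig a] *)
  let pa := pX - l * (pY - sig * pX) in
  let aY := XY - l * (YY - sig * XY) in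
  let aX := XX - l * (XY - sig * XX) in
  - aY + sig * aX - d <= pX + lam * pY ->
  pa + lam * pp <= 0 ->
  - d <= XY - sig * XX.
Proof.
move=> l0 s0 pp0; set k := 1 + lam * sig.
have k0 : 0 < k by rewrite ltr_wpDr// mulr_ge0// ltW.
move=> sq l pa aY aX h1 h2.
have lk : l * k = lam by rewrite /l divfK// gt_eqF.
have l1 : 0 < l by rewrite divr_gt0.
have e1 : pX + lam * pY = k * pa + 2 * lam * (pY - sig * pX).
  have -> : k * pa = k * pX - l * k * (pY - sig * pX) by rewrite /pa; ring.
  by rewrite lk /k; ring.
have e2 : k * pa <= - (lam * k * pp) by move: (ler_wpM2l (ltW k0) h2); lra.
have e3 : 0 <= l * (pp * k ^+ 2 - 2 * k * (pY - sig * pX) +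
    (YY - 2 * sig * XY + sig ^+ 2 * XX)).
  by rewrite mulr_ge0// ltW.
have e4 : l * (pp * k ^+ 2 - 2 * k * (pY - sig * pX) +
    (YY - 2 * sig * XY + sig ^+ 2 * XX)) =
  lam * k * pp - 2 * lam * (pY - sig * pX) + l * (YY - 2 * sig * XY + sig ^+ 2 * XX).
  by rewrite -lk; ring.
have e5 : - aY + sig * aX = - (XY - sig * XX) + l * (YY - 2 * sig * XY + sig ^+ 2 * XX).
  by rewrite /aY /aX; ring.
by move: h1 e1 e2 e3; rewrite e4 e5; clear; lra.
Qed.

(** For [b = - sig *: a] the stationarity equation turns the pointwise estimate at
    [w = a + lam *: p] into [inner p a + lam * inner p p <= 0], after division by [1 + lam * sig].
    The choice of [a] in [cocoercive_algebra] then gives the claim up to [d], which is arbitrary. *)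
Lemma local_strong_monotonicity (sig r : R) : 0 <= sig -> 0 < r ->
  (forall x y u w, graph_pt r x (lag x y) y -> second_subdiff psi (g x) y (jac g x w) u ->
    sig * enorm w ^+ 2 <= inner (xi x y w + jac_adj g x u) w) ->
  exists2 r' : R, 0 < r' &
  forall (x1 v1 : 'rV[R]_n) (y1 : 'rV[R]_m) (x2 v2 : 'rV[R]_n) (y2 : 'rV[R]_m),
    graph_pt r' x1 v1 y1 -> graph_pt r' x2 v2 y2 ->
    sig * enorm (x1 - x2) ^+ 2 <= inner (x1 - x2) (v1 - v2).
Proof.
move=> sig0 r0 psd.
have [rs [s [rs0 s0 st]]] := prox_reg_exists pb.
pose r1 := Num.min r rs.
have r10 : 0 < r1 by rewrite lt_min r0.
have r1r : r1 <= r by rewrite ge_min lexx.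
have r1s : r1 <= rs by rewrite ge_min lexx orbT.
pose lam := (2 * s)^-1.
have l0 : 0 < lam by rewrite invr_gt0 mulr_gt0.
have ls : lam * s < 1 by rewrite /lam invfM mulfVK ?gt_eqF// invf_lt1// ltr1n.
have [r' r'0 H] := mean_value_normal r10 (prox_reg_le r1s st) l0 ls.
exists r' => // x1 v1 y1 x2 v2 y2 loc1 loc2.
have [X0|X0] := eqVneq (x1 - x2) 0; first by rewrite X0 inner0l enorm0 expr0n/= mulr0.
apply/ler_addgt0Pr => d d0.
set X := x1 - x2 in X0 *; set Y := v1 - v2.
pose l := lam / (1 + lam * sig).
pose a := X - l *: (Y - sig *: X).
have [x [y [p [u [lxy h1 h2 h3]]]]] := H _ _ _ _ _ _ loc1 loc2 X0 a (- sig *: a) d d0.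
have := psd x y u _ (graph_pt_le r1r lxy) h2.
have -> : xi x y (a + lam *: p) + jac_adj g x u = - (- sig *: a + p).
  by apply/eqP; rewrite -addr_eq0 addrC addrA h3.
move=> h4; rewrite -/X -/Y in h1; clearbody X Y.
have h5 := inner_ge0 ((1 + lam * sig) *: p - (Y - sig *: X)).
have l1 : 0 < 1 + lam * sig by rewrite ltr_wpDr// mulr_ge0// ltW.
have h6 : inner p a + lam * inner p p <= 0.
  rewrite -(pmulr_rle0 _ l1); move: h4.
  rewrite sqr_enorm; move: (inner_ge0 p); clear -l0; move: a => a.
  rewrite !innerE (innerC p a); generalize (inner a a) (inner a p) (inner p p); clear; intros; lra.
rewrite sqr_enorm.
have h7 := @cocoercive_algebra lam sig (inner X X) (inner X Y) (inner Y Y) (inner p p)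
  (inner p X) (inner p Y) d l0 sig0 (inner_ge0 p).
suff : - d <= inner X Y - sig * inner X X by atom_lra.
apply: h7.
- move: h5; rewrite !innerE (innerC X p) (innerC Y p) (innerC Y X).
  by generalize (inner X X) (inner X Y) (inner Y Y) (inner p p) (inner p X) (inner p Y);
    clear; intros; lra.
- by move: h1; rewrite /a /l !innerE (innerC Y X) !mulNr opprK.
- by move: h6; rewrite /a /l !innerE.
Qed.

(** With [a = 0] and [b = - X] the mean value inequality bounds [|X|^2 - d], and [w = lam *: p]. For
    [lam] inverse to [s + ep] the vector to be estimated collapses to [X - (lam * ep) *: p], so
    [ep = c0 / 4] gives [3 * ep * lam * |p| <= |X|]. The shift by [ep], needed for [lam * s < 1],
    costs one [ep] at the end and leaves [2 * ep = c0 / 2]. *)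
Lemma metric_regularity (c0 s r : R) : 0 < c0 -> 0 <= s -> 0 < r -> prox_reg s r ->
  (forall x y u w, graph_pt r x (lag x y) y -> second_subdiff psi (g x) y (jac g x w) u ->
    c0 * enorm w <= enorm (xi x y w + jac_adj g x u + s *: w)) ->
  exists2 r' : R, 0 < r' &
  forall (x1 v1 : 'rV[R]_n) (y1 : 'rV[R]_m) (x2 v2 : 'rV[R]_n) (y2 : 'rV[R]_m),
    graph_pt r' x1 v1 y1 -> graph_pt r' x2 v2 y2 ->
    c0 * enorm (x1 - x2) <= 2 * enorm (v1 - v2 + s *: (x1 - x2)).
Proof.
move=> c00 s0 r0 st reg.
pose ep := c0 / 4; have ep0 : 0 < ep by rewrite divr_gt0.
have se : 0 < s + ep by rewrite ltr_wpDl.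
pose lam := (s + ep)^-1; have l0 : 0 < lam by rewrite invr_gt0.
have lse : lam * (s + ep) = 1 by rewrite mulVf// gt_eqF.
have ls : lam * s < 1 by rewrite -lse ltr_pM2l// ltrDl.
have [r' r'0 H] := mean_value_normal r0 st l0 ls.
exists r' => // x1 v1 y1 x2 v2 y2 loc1 loc2.
have [X0|X0] := eqVneq (x1 - x2) 0; first by rewrite X0 enorm0 mulr0 mulr_ge0 ?enorm_ge0.
have main (d : R) : 0 < d -> (3 * ep) * (enorm (x1 - x2) ^+ 2 - d) <=
    enorm (x1 - x2) * enorm (v1 - v2 + (s + ep) *: (x1 - x2)).
  move=> d0.
  have [x [y [p [u [lxy]]]]] := H _ _ _ _ _ _ loc1 loc2 X0 0 (- (x1 - x2)) d d0.
  rewrite inner0l oppr0 sub0r add0r; set X := x1 - x2; set Y := v1 - v2 => h1 h2 h3.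
  clearbody X Y.
  have := reg x y u _ lxy h2.
  have -> : xi x y (lam *: p) + jac_adj g x u + s *: (lam *: p) = X - (lam * ep) *: p.
    have -> : xi x y (lam *: p) + jac_adj g x u = X - p.
      by apply/eqP; rewrite -[X - p]opprK -addr_eq0 addrC opprB [p - X]addrC addrA h3.
    have -> : lam * ep = 1 - lam * s by rewrite -lse; ring.
    by clear; apply/rowP => i; rewrite !mxE; ring.
  rewrite enormZ gtr0_norm// => h4.
  have h5 : c0 * (lam * enorm p) <= enorm X + lam * ep * enorm p.
    apply: (le_trans h4); apply: (le_trans (enormD _ _)).
    by rewrite enormN enormZ gtr0_norm// mulr_gt0.
  have h6 : 3 * ep * (lam * enorm p) <= enorm X by move: h5; rewrite /ep; atom_lra.
  have eE : X + lam *: Y = lam *: (Y + (s + ep) *: X).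
    by rewrite scalerDr scalerA lse scale1r addrC.
  have h7 : enorm X ^+ 2 - d <= enorm p * (lam * enorm (Y + (s + ep) *: X)).
    have -> : lam * enorm (Y + (s + ep) *: X) = enorm (X + lam *: Y) by rewrite eE enormZ gtr0_norm.
    apply: le_trans (inner_le _ _); move: h1; by rewrite innerNl opprK sqr_enorm.
  have e30 : 0 <= 3 * ep by rewrite mulr_ge0// ltW.
  apply: (le_trans (ler_wpM2l e30 h7)).
  have -> : 3 * ep * (enorm p * (lam * enorm (Y + (s + ep) *: X))) =
    3 * ep * (lam * enorm p) * enorm (Y + (s + ep) *: X) by ring.
  by rewrite ler_wpM2r// enorm_ge0.
have Xn : 0 < enorm (x1 - x2) by rewrite enorm_gt0.
have e30 : 0 < 3 * ep by rewrite mulr_gt0.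
have : 3 * ep * enorm (x1 - x2) <= enorm (v1 - v2 + (s + ep) *: (x1 - x2)).
  rewrite -(ler_pM2l Xn); apply/ler_addgt0Pr => d d0.
  have d1 : 0 < d / (3 * ep) by rewrite divr_gt0.
  have := main _ d1; rewrite mulrBr (mulrC (3 * ep) (d / _)) divfK ?gt_eqF//.
  by rewrite expr2; atom_lra.
have : enorm (v1 - v2 + (s + ep) *: (x1 - x2)) <= enorm (v1 - v2 + s *: (x1 - x2)) + ep * enorm (x1 - x2).
  by rewrite scalerDl addrA (le_trans (enormD _ _))// lerD2l enormZ gtr0_norm.
by rewrite /ep; atom_lra.
Qed.

End Consequences.

(** A tilt of curvature [- sig] and a prox term of weight [Lam] merge into one prox term of weight
    [Lam - sig] around [c], up to a constant that cancels in differences. *)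
Lemma complete_square {R : realType} {n} (mu sig Lam : R) (x w c v' x' z : 'rV[R]_n) :
  mu = Lam - sig -> mu *: c = v' - sig *: x' + Lam *: z ->
  mu / 2 * enorm (x - c) ^+ 2 - mu / 2 * enorm (w - c) ^+ 2 =
  - inner v' (x - w) - sig / 2 * (enorm (x - x') ^+ 2 - enorm (w - x') ^+ 2)
  + Lam / 2 * (enorm (x - z) ^+ 2 - enorm (w - z) ^+ 2).
Proof.
move=> muE cE.
have D (a b : 'rV[R]_n) : enorm (a - b) ^+ 2 = inner a a - 2 * inner a b + inner b b.
  by rewrite sqr_enorm !innerE (innerC b a); ring.
have hx a : mu * inner a c = inner a v' - sig * inner a x' + Lam * inner a z.
  by rewrite -innerZr cE !innerE.
rewrite !D.
have -> : mu / 2 * (inner x x - 2 * inner x c + inner c c) -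
    mu / 2 * (inner w w - 2 * inner w c + inner c c) =
    mu / 2 * (inner x x - inner w w) - mu * inner x c + mu * inner w c by field.
rewrite !hx !innerE (innerC v' x) (innerC v' w) muE; lra.
Qed.

(** * Quadratic growth *)

Section Prox.
Context {R : realType} {n m : nat} (pb : problem R n m).
Notation phi0 := (pphi0 pb).
Notation g := (pg pb).
Notation psi := (ppsi pb).
Notation xbar := (pxbar pb).
Notation phi := (composite phi0 g psi).
Notation zbar := (g xbar).
Notation graph_pt := (graph_pt pb).
Notation prox_reg := (prox_reg pb).
Notation phir := (phi_real pb).
Let psiN := (ppsi_proper pb).1.
Let fl := ppsi_lsc pb.

Opaque inner enorm lag_grad lag_hess.

Lemma graph_pt_xbar : exists y, forall r, 0 < r -> graph_pt r xbar 0 y.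
Proof.
have [y [ysub yE]] := exists_multiplier pb; exists y => r r0.
by split; rewrite ?subrr ?enorm0.
Qed.

(** Minimality against [xbar], combined with prox-regularity at [(xbar, 0)], gives
    [|x - xbar| <= L * |c - xbar|] with [L = 2 * mu / (mu - s)]. The minimizer is thus interior,
    [mu *: (c - x)] is a regular subgradient there, and the chain rule supplies its multiplier. *)
Lemma prox_exists (s mu r : R) : 0 < r -> prox_reg s r -> 0 < mu -> s < mu ->
  exists2 r0 : R, 0 < r0 & forall eta : R, 0 < eta -> exists2 rho : R, 0 < rho &
  forall c : 'rV[R]_n, enorm (c - xbar) < rho -> exists (x : 'rV[R]_n) (y : 'rV[R]_m),
    graph_pt eta x (mu *: (c - x)) y /\
    forall x' : 'rV[R]_n, enorm (x' - xbar) < r0 -> (psi (g x') < +oo)%E ->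
      phir x + mu / 2 * enorm (x - c) ^+ 2 <= phir x' + mu / 2 * enorm (x' - c) ^+ 2.
Proof.
move=> r0 st mu0 smu.
have [rC rC0 hC] := chain_rule pb.
have [y0 y0loc] := graph_pt_xbar.
have fbar : (psi zbar < +oo)%E by have [_ _ _ []] := y0loc r r0.
pose r1 := r / 2; have r10 : 0 < r1 by rewrite divr_gt0.
have r1r : r1 < r by rewrite /r1 ltr_pdivrMr// ltr_pMr// ltr1n.
exists r1 => // eta eta0.
have ms0 : 0 < mu - s by rewrite subr_gt0.
pose L := 2 * mu / (mu - s); have L0 : 0 < L by rewrite divr_gt0// mulr_gt0.
pose B := L + 1 + mu * (L + 1).
have B1 : L <= B by rewrite /B -addrA lerDl addr_ge0// mulr_ge0// ?addr_ge0 ?(ltW mu0)// ltW.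
have B2 : mu * (L + 1) <= B by rewrite /B lerDr addr_ge0// ltW.
have B0 : 0 < B := lt_le_trans L0 B1.
pose k := Num.min r1 (Num.min rC eta); have k0 : 0 < k by rewrite !lt_min r10 rC0.
exists (k / B); first by rewrite divr_gt0.
move=> c cr; pose dl := enorm (c - xbar).
have dl0 : 0 <= dl := enorm_ge0 _.
have Bd : B * dl < k by rewrite mulrC -ltr_pdivlMr.
pose P (x : 'rV[R]_n) := enorm (x - xbar) <= r1 /\ (psi (g x) < +oo)%E.
pose f (x : 'rV[R]_n) := phir x + mu / 2 * enorm (x - c) ^+ 2.
have Pbar : P xbar by split=> //; rewrite subrr enorm0 ltW.
have [||x [xr fx] hmin] := @exists_minimizer R _ P f; first by exists xbar.
  move=> a_ Pa.
  have [|x' xx xr] := @bounded_cvg_ultra R n (fun k => a_ k - xbar) r1.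
    by apply: nearW => j; have [] := Pa j.
  have {}xx := cvg_of_sub xx; set x := x' + xbar in xx.
  have gcv : (fun k => g (a_ k)) @ ultra --> g x.
    by apply: (cvg_comp a_ g xx); exact: cvg_g (pg_C2 pb) _.
  have pcv : (fun k => phi0 (a_ k)) @ ultra --> phi0 x.
    apply: (cvg_comp a_ phi0 xx).
    exact: has_grad_continuous (C2_has_grad x (pphi0_C2 pb)).
  have qcv : (fun k => mu / 2 * enorm (a_ k - c) ^+ 2) @ ultra --> mu / 2 * enorm (x - c) ^+ 2.
    by apply: cvgM; [exact: cvg_cst|apply/cvg_sqr_enorm/cvg_sub_cst].
  have key l : (\forall j \near ultra, f (a_ j) <= l) ->
      (psi (g x) <= (l - phi0 x - mu / 2 * enorm (x - c) ^+ 2)%:E)%E.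
    move=> hl; apply: (lsc_cvg fl gcv (r := fun j =>
        l - phi0 (a_ j) - mu / 2 * enorm (a_ j - c) ^+ 2)).
      by apply: cvgB => //; apply: cvgB => //; exact: cvg_cst.
    apply: filterS hl => j; have [_ fin] := Pa j.
    by rewrite (fin_domE (psiN _) fin) lee_fin /f /phi_real; lra.
  have [psia|npsia] := boolP (psi (g x) < +oo)%E.
    exists x; first by split=> //; rewrite addrK.
    by move=> l /key; rewrite (fin_domE (psiN _) psia) lee_fin /f /phi_real; lra.
  exists xbar => // l /key; move: npsia; rewrite -leNgt leye_eq => /eqP ->.
  by rewrite leye_eq.
pose D := enorm (x - xbar); have D0 : 0 <= D := enorm_ge0 _.
have base := st xbar 0 y0 x (y0loc r r0) (le_lt_trans xr r1r) fx.
have DL : D <= L * dl.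
  have h1 := hmin xbar Pbar.
  have h2 : enorm (x - c) ^+ 2 >= D ^+ 2 - 2 * (D * dl) + dl ^+ 2.
    have := inner_le (x - xbar) (c - xbar).
    have -> : x - c = (x - xbar) - (c - xbar) by rewrite opprB addrA subrK.
    rewrite /D /dl !sqr_enorm; move: (x - xbar) (c - xbar) => s1 s2.
    by rewrite !innerE (innerC s2 s1); atom_lra.
  have h3 : enorm (xbar - c) = dl by rewrite enormB.
  move: h1 base; rewrite /f h3 inner0l addr0 -/D => h1 base.
  have h4 := ler_wpM2l (ltW mu0) h2.
  have h5 : D * ((mu - s) * D) <= D * (2 * mu * dl).
    move: h1 base h4; rewrite !expr2.
    generalize (phir x) (phir xbar) (enorm (x - c) * enorm (x - c)); clear; intros; lra.
  have [->|Dn] := eqVneq D 0; first by rewrite mulr_ge0// ltW.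
  have Dp : 0 < D by rewrite lt_neqAle eq_sym Dn.
  move: h5; rewrite ler_pM2l// => h5.
  by rewrite /L mulrAC ler_pdivlMr// mulrC.
have Dk : D < k.
  by apply: le_lt_trans Bd; apply: (le_trans DL); rewrite ler_wpM2r.
pose v := mu *: (c - x).
have vk : enorm v < k.
  apply: le_lt_trans Bd; rewrite /v enormZ gtr0_norm//.
  apply: (@le_trans _ _ (mu * ((L + 1) * dl))); last by rewrite mulrA ler_wpM2r.
  rewrite ler_pM2l// mulrDl mul1r.
  apply: (le_trans (enorm_dist _ xbar _)); rewrite addrC (enormB xbar).
  by rewrite lerD.
move: Dk vk; rewrite /k !lt_min => /and3P[D1 D2 D3] /and3P[_ v2 v3].
have fphi : (phi x < +oo)%E by rewrite phi_fin.
have reg : regular_subdiff phi x v.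
  apply: (@regular_of_quad _ _ _ _ _ (mu / 2) (r1 - D) (phiN pb) fphi).
  - by rewrite divr_ge0// ltW.
  - by rewrite subr_gt0.
  - move=> x' x'r fx'; rewrite !fine_phi//; have fx'2 : (psi (g x') < +oo)%E by rewrite -phi_fin.
    have x'R : enorm (x' - xbar) <= r1 := ltW (enorm_lt_trans x'r).
    have := hmin x' (conj x'R fx'2); rewrite /f /phi_real.
    have E : enorm (x' - c) ^+ 2 = enorm (x - c) ^+ 2 - 2 * inner (c - x) (x' - x) + enorm (x' - x) ^+ 2.
      have -> : x' - c = (x' - x) - (c - x) by rewrite opprB addrA subrK.
      rewrite (enormB x c) !sqr_enorm; move: (x' - x) (c - x) => s1 s2.
      by rewrite !innerE (innerC s2 s1); ring.
    rewrite E /v innerZl.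
    generalize (phi0 x + fine (psi (g x))) (phi0 x' + fine (psi (g x'))); atom_lra.
have [y ysub yE] := hC x v D2 v2 (regular_limiting (phiN pb) reg).
exists x, y; split; first exact: And4.
by move=> x' x'r fx'; apply: hmin; split=> //; exact: ltW.
Qed.

(** Growth of modulus [sig] at [(x', v')] is minimality of this function at [x'], where its value is
    [phir x']. *)
Definition zeta (sig : R) (v' x' x : 'rV[R]_n) : R :=
  phir x - inner v' (x - x') - sig / 2 * enorm (x - x') ^+ 2.

(** A prox step for [zeta], reduced by [complete_square] to one for [phi]. The equation for [v] is
    its optimality condition, ready to be paired with an estimate between [(x, v)] and
    [(x', v')]. *)
Lemma prox_localized (s sig Lam r : R) : 0 < r -> prox_reg s r -> 0 < Lam -> 0 < Lam - sig ->
  s < Lam - sig -> exists2 r0 : R, 0 < r0 & forall eta : R, 0 < eta -> exists2 rho : R, 0 < rho &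
  forall x' v' z : 'rV[R]_n, enorm (x' - xbar) < rho -> enorm v' < rho -> enorm (z - xbar) < rho ->
  exists (x v : 'rV[R]_n) (y : 'rV[R]_m), [/\ graph_pt eta x v y, v - v' - sig *: (x - x') = Lam *: (z - x) &
    forall w : 'rV[R]_n, enorm (w - xbar) < r0 -> (psi (g w) < +oo)%E ->
      zeta sig v' x' x + Lam / 2 * enorm (x - z) ^+ 2 <=
      zeta sig v' x' w + Lam / 2 * enorm (w - z) ^+ 2].
Proof.
move=> r0 st L0 mu0 smu; set mu := Lam - sig in mu0 smu.
have [r1 r10 H] := prox_exists r0 st mu0 smu; exists r1 => // eta eta0.
have [rho rho0 {}H] := H eta eta0.
pose B := 1 + `|sig| + Lam; have B0 : 0 < B by rewrite addr_gt0// ltr_wpDr.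
exists (rho * mu / B); first by rewrite divr_gt0// mulr_gt0.
move=> x' v' z hx hv hz.
pose c := mu^-1 *: (v' - sig *: x' + Lam *: z).
have cE : mu *: c = v' - sig *: x' + Lam *: z by rewrite /c scalerA divff ?gt_eqF// scale1r.
have cx : enorm (c - xbar) < rho.
  rewrite -(ltr_pM2l mu0).
  have -> : mu * enorm (c - xbar) = enorm (v' - sig *: (x' - xbar) + Lam *: (z - xbar)).
    rewrite -[mu in LHS]gtr0_norm// -enormZ scalerBr cE; congr enorm.
    by rewrite /mu; apply/rowP => i; rewrite !mxE; ring.
  apply: (@le_lt_trans _ _ (enorm v' + `|sig| * enorm (x' - xbar) + Lam * enorm (z - xbar))).
    apply: (le_trans (enormD _ _)); rewrite enormZ gtr0_norm// lerD2r.
    by apply: (le_trans (enormD _ _)); rewrite enormN enormZ.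
  have -> : mu * rho = rho * mu / B * B by rewrite divfK ?gt_eqF// mulrC.
  set q := rho * mu / B; rewrite /B !mulrDr mulr1 (mulrC q Lam) (mulrC q `|sig|).
  apply: ltr_leD; last by rewrite ler_wpM2l ?ltW//.
  by apply: ltr_leD => //; rewrite ler_wpM2l// ltW.
have [x [y [lx hmin]]] := H c cx.
exists x, (mu *: (c - x)), y; split=> //.
  by rewrite scalerBr cE /mu; apply/rowP => i; rewrite !mxE; ring.
move=> w wr fw; have := hmin w wr fw.
have := complete_square w x (erefl : mu = Lam - sig) cE; rewrite /zeta.
have -> : inner v' (w - x) = inner v' (w - x') - inner v' (x - x') by rewrite !innerE; ring.
generalize (phir x) (phir w); atom_lra.
Qed.

(** A prox step for [zeta (- s)] with weight [c0 / 2], centred at the test point [x1]. Metric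
    regularity turns its optimality condition into [|x - x'| <= |x1 - x|], hence
    [|x1 - x'| <= 2 * |x1 - x|]. The prox gain [c0 / 4 * |x1 - x|^2] is then at least
    [c0 / 16 * |x1 - x'|^2], which lowers [s / 2] by [c0 / 16]. *)
Lemma prox_reg_step (c0 s r r' : R) : 0 < c0 -> 0 <= s -> 0 < r -> prox_reg s r -> 0 < r' ->
  (forall (x1 v1 : 'rV[R]_n) (y1 : 'rV[R]_m) (x2 v2 : 'rV[R]_n) (y2 : 'rV[R]_m),
    graph_pt r' x1 v1 y1 -> graph_pt r' x2 v2 y2 ->
    c0 * enorm (x1 - x2) <= 2 * enorm (v1 - v2 + s *: (x1 - x2))) ->
  exists2 r2 : R, 0 < r2 & prox_reg (s - c0 / 8) r2.
Proof.
move=> c00 s0 r0 st r'0 reg.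
pose c' := c0 / 2; have c'0 : 0 < c' by rewrite divr_gt0.
have mu0 : 0 < c' - - s by rewrite opprK ltr_wpDr.
have smu : s < c' - - s by rewrite opprK ltrDr.
have [r1 r10 H] := prox_localized r0 st c'0 mu0 smu.
pose eta := Num.min r r'; have eta0 : 0 < eta by rewrite lt_min r0.
have [rho rho0 {}H] := H eta eta0.
pose r2 := Num.min (Num.min r r') (Num.min r1 rho).
exists r2; first by rewrite !lt_min r0 r'0 r10.
have h1 : r2 <= r by rewrite /r2 !ge_min lexx.
have h2 : r2 <= r' by rewrite /r2 !ge_min lexx !orbT.
have h3 : r2 <= r1 by rewrite /r2 !ge_min lexx !orbT.
have h4 : r2 <= rho by rewrite /r2 !ge_min lexx !orbT.
move=> x' v' y' x1 l1 x1r fx1; have [x'r v'r _ _] := l1.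
have [x [v [y [lx vE hmin]]]] := H x' v' x1 (lt_le_trans x'r h4) (lt_le_trans v'r h4)
  (lt_le_trans x1r h4).
have er : eta <= r by rewrite ge_min lexx.
have er' : eta <= r' by rewrite ge_min lexx orbT.
have [xr _ _ [fx _]] := lx.
have z0 := st _ _ _ x (graph_pt_le h1 l1) (lt_le_trans xr er) fx.
have := hmin x1 (lt_le_trans x1r h3) fx1.
have := reg _ _ _ _ _ _ (graph_pt_le er' lx) (graph_pt_le h2 l1).
have -> : v - v' + s *: (x - x') = c' *: (x1 - x) by rewrite -vE scaleNr opprK.
rewrite enormZ gtr0_norm// subrr enorm0 expr0n/= mulr0 addr0 => g1 g2.
have g3 : enorm (x - x') <= enorm (x1 - x).
  by rewrite -(ler_pM2l c00); move: g1; rewrite /c'; atom_lra.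
have g4 : enorm (x1 - x') <= 2 * enorm (x1 - x).
  by apply: (le_trans (enorm_dist _ x _)); move: g3; atom_lra.
have g5 : enorm (x1 - x') ^+ 2 <= 4 * enorm (x1 - x) ^+ 2.
  have -> : 4 * enorm (x1 - x) ^+ 2 = (2 * enorm (x1 - x)) ^+ 2 by ring.
  by rewrite ler_sqr ?nnegrE ?mulr_ge0 ?enorm_ge0.
have g6 := ler_wpM2l (ltW c00) g5.
move: g2 z0 g6; rewrite /zeta (enormB x x1) /c'.
generalize (phir x) (phir x') (phir x1); atom_lra.
Qed.

(** While the prox centre stays at [x'], the weight [Lam > s + sig] makes the bound a consequence of
    prox-regularity. Moving the centre by [hh = d / N] costs only the square
    [Lam / 2 * |hh|^2 = D / N^2], since monotonicity gives the first-order term a favourable sign.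
    At the last centre, [x1] itself, the prox term vanishes at [x1] and the total loss is
    [D / N]. *)
Lemma prox_reg_of_monotone (s sig r r' : R) : 0 < s -> 0 <= sig -> 0 < r -> prox_reg s r -> 0 < r' ->
  (forall (x1 v1 : 'rV[R]_n) (y1 : 'rV[R]_m) (x2 v2 : 'rV[R]_n) (y2 : 'rV[R]_m),
    graph_pt r' x1 v1 y1 -> graph_pt r' x2 v2 y2 ->
    sig * enorm (x1 - x2) ^+ 2 <= inner (x1 - x2) (v1 - v2)) ->
  exists2 r2 : R, 0 < r2 & prox_reg (- sig) r2.
Proof.
move=> s0 sig0 r0 st r'0 mono.
pose Lam := s + sig + 1; have L0 : 0 < Lam by rewrite addr_gt0// ltr_wpDr.
have muE : Lam - sig = s + 1 by rewrite /Lam; ring.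
have mu0 : 0 < Lam - sig by rewrite muE addr_gt0.
have smu : s < Lam - sig by rewrite muE ltrDl.
have [r1 r10 H] := prox_localized r0 st L0 mu0 smu.
pose eta := Num.min r' (Num.min r r1); have eta0 : 0 < eta by rewrite !lt_min r0 r'0.
have [rho rho0 {}H] := H eta eta0.
pose r2 := Num.min (Num.min r r') (Num.min r1 (rho / 3)).
exists r2; first by rewrite !lt_min r0 r'0 r10 divr_gt0.
have h1 : r2 <= r by rewrite /r2 !ge_min lexx.
have h2 : r2 <= r' by rewrite /r2 !ge_min lexx !orbT.
have h3 : r2 <= r1 by rewrite /r2 !ge_min lexx !orbT.
have h4 : r2 <= rho / 3 by rewrite /r2 !ge_min lexx !orbT.
have h5 : rho / 3 <= rho by rewrite ler_pdivrMr// ler_peMr ?(ltW rho0)// ler1n.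
have h6 : r2 <= rho := le_trans h4 h5.
move=> x' v' y' x1 l1 x1r fx1; have [x'r v'r _ _] := l1.
pose d := x1 - x'.
pose D := Lam / 2 * enorm d ^+ 2.
have D0 : 0 <= D by rewrite mulr_ge0 ?sqr_ge0// divr_ge0// ltW.
(* [z_i = x' + (i / N) d] runs from [x'] to [x1]. *)
have claim (N i : nat) : (0 < N)%N -> (i <= N)%N -> forall w : 'rV[R]_n, enorm (w - xbar) < Num.min r r1 ->
    (psi (g w) < +oo)%E ->
    phir x' - i%:R * (D / N%:R ^+ 2) <=
    zeta sig v' x' w + Lam / 2 * enorm (w - (x' + (i%:R / N%:R) *: d)) ^+ 2.
  move=> N0; have NR : 0 < N%:R :> R by rewrite ltr0n.
  elim: i => [|i IH] iN w; rewrite lt_min => /andP[wr wr1] fw.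
    have := st _ _ _ w (graph_pt_le h1 l1) wr fw.
    rewrite !mul0r scale0r addr0 subr0 /zeta /Lam; have := sqr_ge0 (enorm (w - x')).
    generalize (phir w) (phir x'); atom_lra.
  pose t : R := i.+1%:R / N%:R.
  have t0 : 0 < t by rewrite divr_gt0// ltr0n.
  have t1 : t <= 1 by rewrite ler_pdivrMr// mul1r ler_nat.
  pose z := x' + t *: d.
  have zr : enorm (z - xbar) < rho.
    have -> : z - xbar = (x' - xbar) + t *: ((x1 - xbar) - (x' - xbar)).
      by rewrite /z /d; apply/rowP => j; rewrite !mxE; ring.
    apply: (le_lt_trans (enormD _ _)); rewrite enormZ gtr0_norm//.
    have k1 := enormD (x1 - xbar) (- (x' - xbar)); rewrite enormN in k1.
    have k2 : t * enorm (x1 - xbar - (x' - xbar)) <= enorm (x1 - xbar - (x' - xbar)).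
      by rewrite ler_piMl ?enorm_ge0.
    by move: k1 k2 x'r x1r h4; atom_lra.
  have [x [v [y [lx vE hmin]]]] := H x' v' z (lt_le_trans x'r h6) (lt_le_trans v'r h6) zr.
  have er : eta <= r by rewrite /eta !ge_min lexx !orbT.
  have er1 : eta <= r1 by rewrite /eta !ge_min lexx !orbT.
  have er' : eta <= r' by rewrite /eta !ge_min lexx.
  have [xr _ _ [fx _]] := lx.
  have xrr : enorm (x - xbar) < Num.min r r1.
    by rewrite lt_min (lt_le_trans xr er) (lt_le_trans xr er1).
  have ih := IH (ltnW iN) x xrr fx.
  apply: le_trans (hmin w wr1 fw).
  have m1 := mono _ _ _ _ _ _ (graph_pt_le er' lx) (graph_pt_le h2 l1).
  pose hh := N%:R^-1 *: d.
  have zE : x' + (i%:R / N%:R) *: d = z - hh.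
    have tE : t = i%:R / N%:R + N%:R^-1 by rewrite /t -natr1 mulrDl mul1r.
    by rewrite /z /hh tE scalerDl addrA addrK.
  have zx : z - x' = i.+1%:R *: hh by rewrite /z /hh /t scalerA addrAC subrr add0r.
  have DE : D / N%:R ^+ 2 = Lam / 2 * enorm hh ^+ 2.
    rewrite /hh enormZ ger0_norm ?invr_ge0 ?ltW// exprMn exprVn /D.
    by rewrite mulrAC -mulrA.
  pose q := z - x.
  (* [Lam *: q] equals [v - v' - sig *: (x - x')], whose pairing with [x - x'] is nonnegative by
     monotonicity. As [i.+1%:R *: hh = q + (x - x')], the sign carries over to the cross term in
     [q2]. *)
  have q1 : 0 <= inner q (x - x').
    rewrite -(pmulr_rge0 _ L0) -innerZl -vE.
    move: m1; rewrite sqr_enorm; move: (x - x') (v - v') => X Y.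
    by rewrite (innerC X Y) innerDl innerNl innerZl; atom_lra.
  have q2 : 0 <= inner q hh.
    have i0 : 0 < i.+1%:R :> R by rewrite ltr0n.
    rewrite -(pmulr_rge0 _ i0) -innerZr -zx.
    have -> : z - x' = q + (x - x') by rewrite /q addrA subrK.
    by rewrite innerDr addr_ge0 ?inner_ge0.
  have E1 : enorm (x - (z - hh)) ^+ 2 = enorm (x - z) ^+ 2 - 2 * inner q hh + enorm hh ^+ 2.
    rewrite (enormB x z) (enormB x) -/q !sqr_enorm.
    have -> : z - hh - x = q - hh by rewrite /q addrAC.
    by move: (q) (hh) => a b; rewrite !innerE (innerC b a); ring.
  move: ih; rewrite zE E1 DE => ih.
  have q3 := mulr_ge0 (ltW L0) q2.
  rewrite -natr1 mulrDl mul1r; move: ih q3.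
  generalize (i%:R * (Lam / 2 * enorm hh ^+ 2)) (zeta sig v' x' x) (phir x'); atom_lra.
have key (N : nat) : (0 < N)%N -> phir x' - zeta sig v' x' x1 <= D / N%:R.
  move=> N0; have NR : N%:R != 0 :> R by rewrite pnatr_eq0 -lt0n.
  have x1c : enorm (x1 - xbar) < Num.min r r1 by rewrite lt_min (lt_le_trans x1r h1) (lt_le_trans x1r h3).
  have := claim N N N0 (leqnn N) x1 x1c fx1.
  rewrite divff// scale1r /d (addrC x') subrK subrr enorm0 expr0n/= mulr0 addr0.
  have -> : N%:R * (D / N%:R ^+ 2) = D / N%:R by field.
  generalize (phir x') (zeta sig v' x' x1) (D / N%:R); clear; intros; lra.
have fin : phir x' <= zeta sig v' x' x1.
  rewrite -subr_le0 leNgt; apply/negP => p0.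
  have [N N0 ND] : exists2 N : nat, (0 < N)%N & D / N%:R < phir x' - zeta sig v' x' x1.
    exists (Num.truncn (D / (phir x' - zeta sig v' x' x1))).+1 => //.
    by rewrite ltr_pdivrMr ?ltr0n// mulrC -ltr_pdivrMr// truncnS_gt.
  by have := lt_le_trans ND (key N N0); rewrite ltxx.
by move: fin; rewrite /zeta; generalize (phir x') (phir x1); atom_lra.
Qed.

End Prox.

(** * Strict positivity at the reference point *)

Section Nondegenerate.
Context {R : realType} {n m : nat} (pb : problem R n m).
Notation phi0 := (pphi0 pb).
Notation g := (pg pb).
Notation psi := (ppsi pb).
Notation xbar := (pxbar pb).
Notation lag := (lag_grad pb).
Notation xi := (lag_hess pb).
Notation zbar := (g xbar).
Notation graph_pt := (graph_pt pb).
Notation prox_reg := (prox_reg pb).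
Let fp := ppsi_proper pb.
Let fl := ppsi_lsc pb.
Let fc := ppsi_convex pb.

Opaque inner enorm lag_grad lag_hess.

(** Compactness with unit [w]. If [u] stays bounded, pairing the vanishing vector with [w] and
    dropping the term in [s >= 0] makes the form nonpositive in the limit. If [u] is unbounded,
    division by its norm removes [w] and the Hessian terms, and a unit vector violating the
    second-order condition remains. *)
Lemma uniform_nondegeneracy (S : R) : 0 <= S ->
  (forall (ybar u : 'rV[R]_m) (w : 'rV[R]_n), multipliers phi0 g psi xbar 0 ybar ->
    second_subdiff psi zbar ybar (jac g xbar w) u -> w != 0 ->
    0 < inner (xi xbar ybar w + jac_adj g xbar u) w) ->
  exists r c0 : R, [/\ 0 < r, 0 < c0 & forall (s : R) x y u w, 0 <= s <= S ->
    graph_pt r x (lag x y) y -> second_subdiff psi (g x) y (jac g x w) u ->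
    c0 * enorm w <= enorm (xi x y w + jac_adj g x u + s *: w)].
Proof.
move=> S0 pd; apply: contrapT => H.
have [rB [K [rB0 K0 hB]]] := bounded_multipliers pb.
have /choice[a Ha] : forall k : nat, exists a : R * 'rV[R]_n * ('rV[R]_m * 'rV[R]_m * 'rV[R]_n),
   [/\ 0 <= a.1.1 <= S, graph_pt k.+1%:R^-1 a.1.2 (lag a.1.2 a.2.1.1) a.2.1.1,
    second_subdiff psi (g a.1.2) a.2.1.1 (jac g a.1.2 a.2.2) a.2.1.2, enorm a.2.2 = 1
    & enorm (xi a.1.2 a.2.1.1 a.2.2 + jac_adj g a.1.2 a.2.1.2 + a.1.1 *: a.2.2) < k.+1%:R^-1].
  move=> k; apply: contrapT => Hk; apply: H; exists k.+1%:R^-1, k.+1%:R^-1.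
  have k0 : 0 < (k.+1%:R^-1 : R) by rewrite invr_gt0.
  split=> // s x y u w sS l sub; rewrite leNgt; apply/negP => h; apply: Hk.
  have w0 : 0 < enorm w.
    by rewrite -(pmulr_rgt0 _ k0); apply: le_lt_trans h; exact: enorm_ge0.
  pose t := (enorm w)^-1; have t0 : 0 < t by rewrite invr_gt0.
  exists ((s, x), ((y, t *: u), t *: w)); apply: And5; cbn [fst snd].
  - exact: sS.
  - exact: l.
  - by rewrite jacZ; exact: second_subdiffZ.
  - by rewrite enormZ gtr0_norm// mulVf// gt_eqF.
  - rewrite xiZ jac_adjZ (scalerA s) (mulrC s) -(scalerA t) -!scalerDr enormZ gtr0_norm//.
    by rewrite mulrC ltr_pdivrMr.
pose s_ k := (a k).1.1; pose x_ k := (a k).1.2; pose y_ k := (a k).2.1.1.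
pose u_ k := (a k).2.1.2; pose w_ k := (a k).2.2.
pose E k := xi (x_ k) (y_ k) (w_ k) + jac_adj g (x_ k) (u_ k) + s_ k *: w_ k.
have sS k : 0 <= s_ k <= S by have [] := Ha k.
have w1 k : enorm (w_ k) = 1 by have [] := Ha k.
have Ek k : enorm (E k) < k.+1%:R^-1 by have [] := Ha k.
have sub k : second_subdiff psi (g (x_ k)) (y_ k) (jac g (x_ k) (w_ k)) (u_ k) by have [] := Ha k.
have xx : x_ @ ultra --> xbar by apply: cvg_harmonic_vec => k; have [_ []] := Ha k.
have ll : (fun k => lag (x_ k) (y_ k)) @ ultra --> (0 : 'rV[R]_n).
  by apply: cvg_harmonic_vec => k; rewrite subr0; have [_ []] := Ha k.
have gg : (fun k => g (x_ k)) @ ultra --> zbar.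
  by apply: (cvg_comp x_ g xx); exact: cvg_g (pg_C2 pb) _.
have [rg rg0 hg] := g_near pb rB0.
have yK : \forall k \near ultra, enorm (y_ k) <= K.
  apply: filterS (filterI (cvg_real_near (@ultra_invn R) rB0) (cvg_enorm_near gg rB0)) => k.
  move=> [/= kr gr]; rewrite subr0 in kr.
  have {}kr : k.+1%:R^-1 < rB by apply: le_lt_trans kr; exact: ler_norm.
  have [_ [h1 h2 _ h3] _ _ _] := Ha k.
  by apply: (hB (x_ k) (g (x_ k))) => //; exact: lt_trans kr.
have [y0 yy _] := bounded_cvg_ultra yK.
have mult : multipliers phi0 g psi xbar 0 y0.
  apply/multipliersP; split; last first.
    by apply: (csub_cvg fp fl gg yy); apply: nearW => k; have [_ []] := Ha k.
  exact: (@cvg_unique_vec R n _ 0 (lag xbar y0) ll (@cvg_lag R n m pb _ _ _ _ xx yy)).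
have [w0 ww _] : exists2 w : 'rV[R]_n, w_ @ ultra --> w & enorm w <= 1.
  by apply: bounded_cvg_ultra; apply: nearW => k; rewrite w1.
have w01 : enorm w0 = 1.
  apply: (@cvg_unique_real _ (fun k => enorm (w_ k))); first exact: cvg_enorm.
  by rewrite (_ : (fun k => _) = cst 1); [exact: cvg_cst|apply/funext].
have w0n : w0 != 0 by apply: contra_eq_neq w01 => ->; rewrite enorm0 eq_sym oner_neq0.
have jj : (fun k => jac g (x_ k) (w_ k)) @ ultra --> jac g xbar w0.
  exact: (cvg_jac (pg_C2 pb)).
have E0 : E @ ultra --> (0 : 'rV[R]_n) by apply: cvg_harmonic_vec => k; rewrite subr0.
have [[C uC]|uinf] := ultra_bounded_or (fun k => enorm (u_ k)).
  have [u0 uu _] := bounded_cvg_ultra uC.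
  have sub0 := second_subdiff_closed fp fl fc gg yy uu jj sub.
  have := pd _ _ _ mult sub0 w0n; apply/negP; rewrite -leNgt.
  have cF : (fun k => inner (xi (x_ k) (y_ k) (w_ k) + jac_adj g (x_ k) (u_ k)) (w_ k))
      @ ultra --> inner (xi xbar y0 w0 + jac_adj g xbar u0) w0.
    apply: (cvg_inner _ ww); apply: cvgD; [exact: (cvg_xi xx yy ww)|exact: (cvg_jac_adj (pg_C2 pb) xx uu)].
  have cE : (fun k => inner (E k) (w_ k)) @ ultra --> (0 : R).
    by rewrite -(inner0l w0); exact: cvg_inner.
  apply: (ultra_le_cvg cF cE) => k.
  have /andP[sk _] := sS k.
  by rewrite [leRHS]innerDl lerDl innerZl mulr_ge0 ?inner_ge0.
have uinv := cvg_inv_infty uinf.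
have un : \forall k \near ultra, 0 < enorm (u_ k) by exact: uinf.
have [|d dd d1] := @cvg_normalized R m u_.
  by apply: filterS un => k; apply: contraTneq => ->; rewrite enorm0 ltxx.
pose t_ k := (enorm (u_ k))^-1.
have tw : (fun k => t_ k *: w_ k) @ ultra --> (0 : 'rV[R]_n).
  by rewrite -(scale0r w0); exact: cvg_scale.
have tE : (fun k => t_ k *: E k) @ ultra --> (0 : 'rV[R]_n).
  by rewrite -(scale0r (0 : 'rV[R]_n)); exact: cvg_scale.
have tsw : (fun k => t_ k *: (s_ k *: w_ k)) @ ultra --> (0 : 'rV[R]_n).
  apply: (cvg_enorm0 (e := fun k => t_ k * S)).
    move=> k; have /andP[sk sk'] := sS k.
    rewrite subr0 enormZ enormZ w1 mulr1 (ger0_norm sk) ger0_norm ?invr_ge0 ?enorm_ge0//.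
    by rewrite ler_wpM2l// invr_ge0 enorm_ge0.
  by rewrite -(mul0r S); apply: cvgM => //; exact: cvg_cst.
have txi : (fun k => t_ k *: xi (x_ k) (y_ k) (w_ k)) @ ultra --> (0 : 'rV[R]_n).
  by rewrite -(scale0r (xi xbar y0 w0)); exact: (cvg_scale uinv (cvg_xi xx yy ww)).
have Ad : jac_adj g xbar d = 0.
  apply: (@cvg_unique_vec _ _ (fun k => jac_adj g (x_ k) (t_ k *: u_ k))).
    exact: (cvg_jac_adj (pg_C2 pb)).
  rewrite (_ : (fun k => _) = fun k => t_ k *: E k - t_ k *: (s_ k *: w_ k)
      - t_ k *: xi (x_ k) (y_ k) (w_ k)).
    by pose proof (cvgB (cvgB tE tsw) txi) as h; rewrite !subr0 in h.
  apply/funext => k; rewrite jac_adjZ /E !scalerDr.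
  by rewrite addrK addrAC subrr add0r.
have tj : (fun k => t_ k *: jac g (x_ k) (w_ k)) @ ultra --> (0 : 'rV[R]_m).
  by rewrite -(scale0r (jac g xbar w0)); exact: cvg_scale.
have : (second_subdiff psi zbar y0 0 `&` ker_jac_adj g xbar) d.
  split=> //; apply/(second_subdiffP _ _ _ _ fp fl fc); split; first by have /multipliersP[] := mult.
  move=> e e0; have e2 : 0 < e / 2 by rewrite divr_gt0.
  have tri (b1 b2 b3 : 'rV[R]_m) : enorm (b1 - b2) < e / 2 -> enorm (b2 - b3) < e / 2 ->
      enorm (b1 - b3) < e.
    by have := enorm_dist b1 b2 b3; atom_lra.
  case: (filter_ex (filterI (filterI un (filterI (cvg_enorm_near gg e2) (cvg_enorm_near yy e2)))
    (filterI (cvg_enorm_near dd e2) (cvg_enorm_near tj e2)))).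
  move=> k [[h0 [h1 h2]] [h3 h4]].
  have {}h3 : enorm (t_ k *: u_ k - d) < e / 2 := h3.
  have {}h4 : enorm (t_ k *: jac g (x_ k) (w_ k) - 0) < e / 2 := h4.
  have tk0 : 0 < t_ k by rewrite invr_gt0.
  have /(second_subdiffP _ _ _ _ fp fl fc)[_ /(_ _ e2)[p [q [u' [w' [k1 k2 k3 k4 k5]]]]]] :=
    second_subdiffZ fp fl fc tk0 (sub k).
  exists p, q, u', w'; split=> //.
  - exact: tri k1 h1.
  - exact: tri k2 h2.
  - exact: tri k4 h3.
  - exact: tri k5 h4.
by rewrite (psoqc pb _ mult) => /= d0; move: d1; rewrite d0 enorm0 => /eqP; rewrite eq_sym oner_eq0.
Qed.

(** The constant [c0] serves all moduli in [[0, S]], so every step subtracts the same [h = c0 / 8].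
    As a step requires [s >= 0], the iteration stops at the first negative modulus. *)
Lemma prox_reg_negative :
  (forall (ybar u : 'rV[R]_m) (w : 'rV[R]_n), multipliers phi0 g psi xbar 0 ybar ->
    second_subdiff psi zbar ybar (jac g xbar w) u -> w != 0 ->
    0 < inner (xi xbar ybar w + jac_adj g xbar u) w) ->
  exists sigma r : R, [/\ 0 < sigma, 0 < r & prox_reg (- sigma) r].
Proof.
move=> pd; have [rs [S [rs0 S0 st]]] := prox_reg_exists pb.
have [r [c0 [r0 c00 nd]]] := uniform_nondegeneracy (ltW S0) pd.
pose h := c0 / 8; have h0 : 0 < h by rewrite divr_gt0.
have step (s r1 : R) : 0 <= s <= S -> 0 < r1 -> prox_reg s r1 -> exists2 r2 : R, 0 < r2 & prox_reg (s - h) r2.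
  move=> /andP[s0 sS] r10 st1; pose r3 := Num.min r r1.
  have r30 : 0 < r3 by rewrite lt_min r0.
  have st3 : prox_reg s r3.
    by apply: prox_reg_le st1; rewrite ?ge_min ?lexx ?orbT.
  have [|r' r'0 reg] := @metric_regularity _ _ _ pb c0 s r3 c00 s0 r30 st3.
    move=> x y u w l; apply: nd; first by rewrite s0.
    by apply: graph_pt_le l; rewrite ge_min lexx.
  exact: (prox_reg_step c00 s0 r30 st3 r'0 reg).
have iter k : (exists sigma r1 : R, [/\ 0 < sigma, 0 < r1 & prox_reg (- sigma) r1]) \/
    exists2 r1 : R, 0 < r1 & prox_reg (S - k%:R * h) r1.
  elim: k => [|k [ih|[r1 r10 ih]]]; [|by left|].
    by right; exists rs => //; rewrite mul0r subr0.
  have [neg|pos] := ltP (S - k%:R * h) 0.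
    by left; exists (- (S - k%:R * h)), r1; rewrite oppr_gt0 opprK.
  have [|r2 r20 st2] := step _ r1 _ r10 ih.
    by rewrite pos gerBl mulr_ge0// ltW.
  by right; exists r2 => //; rewrite -natr1 mulrDl mul1r opprD addrA.
have [N SN] : exists N : nat, S < N%:R * h.
  by exists (Num.truncn (S / h)).+1; rewrite -ltr_pdivrMr// truncnS_gt.
have [//|[r1 r10 st1]] := iter N.
by exists (- (S - N%:R * h)), r1; rewrite opprK; split=> //; rewrite opprB subr_gt0.
Qed.

End Nondegenerate.

Lemma csub_monotone {R : realType} {n} (f : 'rV[R]_n -> \bar R) (x v x' v' : 'rV[R]_n) :
  (forall z, f z != -oo%E) -> csub f x v -> csub f x' v' -> 0 <= inner (v - v') (x - x').
Proof.
move=> fN [fx h] [fx' h']; have := h' x; have := h x'.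
rewrite (fin_domE (fN _) fx) (fin_domE (fN _) fx') -!EFinD !lee_fin.
generalize (fine (f x)) (fine (f x')); intros; move: H H0.
by rewrite !innerE; atom_lra.
Qed.

Lemma enorm_ball_convex {R : realType} {n} (c : 'rV[R]_n) (r : R) :
  convex_set [set x : 'rV[R]_n | enorm (x - c) < r].
Proof.
apply/convex_setW => x y; rewrite !inE /= => xr yr k k0 k1; rewrite inE /=.
change (enorm (k%:num *: x + (1 - k%:num) *: y - c) < r).
have -> : k%:num *: x + (1 - k%:num) *: y - c = k%:num *: (x - c) + (1 - k%:num) *: (y - c).
  by apply/rowP => i; rewrite !mxE; ring.
have k1' : 0 < 1 - k%:num by rewrite subr_gt0.
apply: (le_lt_trans (enormD _ _)); rewrite !enormZ !gtr0_norm//.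
have -> : r = k%:num * r + (1 - k%:num) * r by ring.
by rewrite ltrD// ltr_pM2l.
Qed.

(** * The convex envelope *)

Section Theta.
Context {R : realType} {n m : nat} (pb : problem R n m).
Notation phi0 := (pphi0 pb).
Notation g := (pg pb).
Notation psi := (ppsi pb).
Notation xbar := (pxbar pb).
Notation phi := (composite phi0 g psi).
Notation zbar := (g xbar).
Notation graph_pt := (graph_pt pb).
Notation prox_reg := (prox_reg pb).
Notation phir := (phi_real pb).
Let psiN := (ppsi_proper pb).1.
Variables (sigma r : R).
Hypotheses (sigma0 : 0 <= sigma) (r0 : 0 < r) (st : prox_reg (- sigma) r).

Opaque inner enorm lag_grad lag_hess.

Definition minorant (x' v' x : 'rV[R]_n) : R :=
  phir x' + inner v' (x - x') + sigma / 2 * enorm (x - x') ^+ 2.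

(* The convex function [theta] of variational convexity. *)
Definition envelope (x : 'rV[R]_n) : \bar R :=
  ereal_sup [set (minorant a.1 a.2 x)%:E | a in [set a | exists y, graph_pt r a.1 a.2 y]].

Lemma envelope_ge x' v' y x : graph_pt r x' v' y -> ((minorant x' v' x)%:E <= envelope x)%E.
Proof. by move=> l; apply: ereal_sup_ubound; exists (x', v') => //; exists y. Qed.

Lemma envelope_le x c :
  (forall x' v' y, graph_pt r x' v' y -> ((minorant x' v' x)%:E <= c)%E) -> (envelope x <= c)%E.
Proof. by move=> h; apply: ge_ereal_sup => _ [[x' v'] /= [y l] <-]; exact: h l. Qed.

Lemma phi_phir x : (psi (g x) < +oo)%E -> phi x = (phir x)%:E.
Proof. by move=> fx; rewrite /composite (fin_domE (psiN _) fx) -EFinD. Qed.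

Lemma envelope_le_phi x : enorm (x - xbar) < r -> (envelope x <= phi x)%E.
Proof.
move=> xr; have [fx|nfx] := boolP (psi (g x) < +oo)%E; last first.
  by rewrite /composite; move: nfx; rewrite -leNgt leye_eq => /eqP ->; rewrite addey// leey.
apply: envelope_le => x' v' y l; rewrite phi_phir// lee_fin.
by have := st l xr fx; rewrite /minorant !mulNr opprK.
Qed.

Lemma envelopeE x v y : graph_pt r x v y -> envelope x = (phir x)%:E.
Proof.
move=> l; have [xr _ _ [fx _]] := l.
apply/eqP; rewrite eq_le -{1}phi_phir// envelope_le_phi//=.
by have := envelope_ge x l; rewrite /minorant subrr inner0r enorm0 expr0n/= mulr0 !addr0.
Qed.

Lemma csub_envelope x v y : graph_pt r x v y -> csub envelope x v.
Proof.
move=> l; split; first by rewrite (envelopeE l) ltry.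
move=> z; rewrite (envelopeE l) -EFinD; apply: le_trans (envelope_ge z l).
by rewrite lee_fin /minorant lerDl mulr_ge0 ?sqr_ge0// divr_ge0.
Qed.

Lemma envelope_proper : proper_fun envelope.
Proof.
have [y0 /(_ r r0) l0] := graph_pt_xbar pb; split; last first.
  by exists xbar; rewrite (envelopeE l0) ltry.
by move=> x; rewrite -ltNye; apply: lt_le_trans (envelope_ge x l0); rewrite ltNyr.
Qed.

Lemma envelope_lsc : lower_semicontinuous envelope.
Proof.
move=> x a /ereal_sup_gt[_ [[x' v'] /= [y l] <-]]; rewrite lte_fin => ax.
have cvx (b : 'rV[R]_n) : (fun z : 'rV[R]_n => z - b) @ x --> x - b.
  exact: (cvgB (FF := nbhs_filter x) (@cvg_id _ _) (@cvg_cst _ b _ (nbhs x) (nbhs_filter x))).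
have cm : minorant x' v' @ x --> minorant x' v' x.
  have cst0 (T : topologicalType) (b : T) := @cvg_cst _ b _ (nbhs x) (nbhs_filter x).
  apply: (cvgD (FF := nbhs_filter x)).
    apply: (cvgD (FF := nbhs_filter x)); first exact: cst0.
    by apply: (@cvg_inner R _ (nbhs x) (nbhs_filter x)) => //; exact: cst0.
  rewrite (_ : (fun z => _) = fun z => sigma / 2 * inner (z - x') (z - x')); last first.
    by apply/funext => z; rewrite sqr_enorm.
  rewrite sqr_enorm; apply: (cvgM (FF := nbhs_filter x)); first exact: cst0.
  exact: (@cvg_inner R _ (nbhs x) (nbhs_filter x)).
have e0 : 0 < minorant x' v' x - a by rewrite subr_gt0.
exists [set z | a < minorant x' v' z] => [|z /= az].
  apply: filterS (cvg_real_near cm e0) => z; rewrite ltr_norml => /andP[+ _].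
  by rewrite opprB ltrBlDr subrK.
by apply: lt_le_trans (envelope_ge z l); rewrite lte_fin.
Qed.

(** Each minorant minus the quadratic has curvature [sigma - kap >= 0], and suprema preserve
    convexity. The value [kap = 0] yields convexity, [kap = sigma] strong convexity. *)
Lemma envelope_convex (U : set 'rV[R]_n) (kap : R) : kap <= sigma ->
  convex_fun_on U (fun x => envelope x - (kap / 2 * enorm x ^+ 2)%:E)%E.
Proof.
move=> ks x y t _ _ /andP[t0 t1]; rewrite leeBlDr//; apply: envelope_le => x' v' w l.
have t1' : 0 <= 1 - t by rewrite subr_ge0.
rewrite -leeBlDr// -EFinB.
apply: (@le_trans _ _ (t%:E * (minorant x' v' x - kap / 2 * enorm x ^+ 2)%:E +
  (1 - t)%:E * (minorant x' v' y - kap / 2 * enorm y ^+ 2)%:E)%E); last first.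
  by rewrite !EFinB; apply: leeD; rewrite lee_wpmul2l ?lee_fin// leeB// (envelope_ge _ l).
rewrite -!EFinM -EFinD lee_fin /minorant.
have D (a b : 'rV[R]_n) : enorm (a - b) ^+ 2 = inner a a - 2 * inner a b + inner b b.
  by rewrite sqr_enorm !innerE (innerC b a); ring.
have h : 0 <= (sigma - kap) / 2 * (t * (1 - t)) * enorm (x - y) ^+ 2.
  apply: mulr_ge0; last exact: sqr_ge0.
  by apply: mulr_ge0; [rewrite divr_ge0 ?subr_ge0|exact: mulr_ge0].
rewrite -subr_ge0; apply: le_trans h _; rewrite le_eqVlt; apply/orP; left; apply/eqP.
rewrite !D !sqr_enorm !innerE (innerC y x) !(innerC v'); clear; lra.
Qed.

(** A maximality argument. The prox step at [x] with tilt [v] and weight [1] finds a graph point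
    with [v1 - v = x - x1]; monotonicity of [csub envelope] between it and [(x, v)] forces the two
    to coincide. *)
Lemma envelope_graph : exists2 rho : R, 0 < rho & forall x v : 'rV[R]_n,
  enorm (x - xbar) < rho -> enorm v < rho -> csub envelope x v -> exists y, graph_pt r x v y.
Proof.
have s1 : - sigma < 1 - 0 by rewrite subr0; apply: (@le_lt_trans _ _ 0); rewrite ?oppr_le0.
have m1 : 0 < (1 : R) - 0 by rewrite subr0.
have [r1 r10 H] := prox_localized r0 st ltr01 m1 s1.
have [rho rho0 {}H] := H r r0; exists rho => // x v xr vr xv.
have [x1 [v1 [y [l vE _]]]] := H x v x xr vr xr.
have vE' : v1 - v = x - x1 by move: vE; rewrite scale0r subr0 scale1r.
have := csub_monotone envelope_proper.1 xv (csub_envelope l).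
rewrite -(opprB v1) vE' innerNl oppr_ge0 => le0.
have x0 : x - x1 = 0 by apply/inner_eq0/eqP; rewrite eq_le le0 inner_ge0.
have xE := subr0_eq x0; have vE2 : v1 = v by apply/eqP; rewrite -subr_eq0 vE' x0.
by exists y; rewrite -vE2 {1}xE.
Qed.

Lemma variational_witness_exists : exists (U V : set 'rV[R]_n) (theta : 'rV[R]_n -> \bar R) (eps : R),
  variational_witness phi xbar 0 U V theta eps /\
  convex_fun_on U (fun x => theta x - (sigma / 2 * enorm x ^+ 2)%:E)%E.
Proof.
have [rC rC0 hC] := chain_rule pb.
have [rho rho0 hrho] := envelope_graph.
have [y0 /(_ r r0) l0] := graph_pt_xbar pb.
(* The bound [1 / 2] handles the level set with [eps = 1]: growth tested at [xbar] gives
   [phir x <= phir xbar + |v| * |x - xbar|], and the product is at most [1 / 4]. *)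
pose k := Num.min (Num.min r rC) (Num.min rho (1 / 2)).
have k0 : 0 < k by rewrite !lt_min r0 rC0 rho0 divr_gt0.
have kr : k <= r by rewrite !ge_min lexx.
have krC : k <= rC by rewrite !ge_min lexx !orbT.
have krho : k <= rho by rewrite !ge_min lexx !orbT.
have k2 : k <= 1 / 2 by rewrite !ge_min lexx !orbT.
have convE : convex_fun_on setT envelope.
  have := envelope_convex (U := setT) sigma0; congr (convex_fun_on _ _).
  by apply/funext => x; rewrite mul0r mul0r sube0.
have thetaE := convex_limiting_subdiffE envelope_proper envelope_lsc convE.
have phibar : phi xbar = (phir xbar)%:E by apply: phi_phir; have [_ _ _ []] := l0.
pose U := [set x : 'rV[R]_n | enorm (x - xbar) < k].
pose V := [set v : 'rV[R]_n | enorm (v - 0) < k].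
have nU : nbhs xbar U by apply/nbhs_enormP; exists k.
have nV : nbhs (0 : 'rV[R]_n) V by apply/nbhs_enormP; exists k.
have locP x v : U x -> V v -> limiting_subdiff envelope x v -> exists y, graph_pt r x v y.
  rewrite thetaE /U /V /= subr0 => xk vk; apply: hrho.
    exact: lt_le_trans krho.
  exact: lt_le_trans krho.
exists U, V, envelope, 1; split; last exact: envelope_convex.
apply: And5.
- by split=> //; exact: enorm_ball_convex.
- by split=> //; exact: enorm_ball_convex.
- split=> //; [exact: envelope_proper|exact: envelope_lsc|].
  by move=> x xk; apply: envelope_le_phi; exact: lt_le_trans kr.
- split=> //; apply/seteqP; split=> -[x v] [[/= xU vV] sub].
  + have [xk _] := xU; split; first by split.
    move: vV sub; rewrite /V /gph /= subr0 => vk sub.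
    have [y ysub vE] := hC x v (lt_le_trans xk krC) (lt_le_trans vk krC) sub.
    rewrite thetaE; apply: (@csub_envelope x v y).
    by apply: And4 => //; exact: lt_le_trans kr.
  + have [y l] := locP x v xU vV sub.
    have [xr vr vE [fx hy]] := l; have fbar : (psi zbar < +oo)%E by have [_ _ _ []] := l0.
    split; last by rewrite /gph /= vE; apply: (regular_limiting (phiN pb)); exact: lag_regular.
    split=> //; split=> //=; rewrite phibar (phi_phir fx) -EFinD lte_fin.
    have xx0 : enorm (xbar - xbar) < r by rewrite subrr enorm0.
    have := st l xx0 fbar.
    have h1 := inner_ge v (xbar - x).
    have h2 : enorm v * enorm (xbar - x) <= 1 / 2 * (1 / 2).
      rewrite (enormB xbar); move: vV; rewrite /V /= subr0 => vk.
      by apply: ler_pM; rewrite ?enorm_ge0//; apply: ltW; apply: lt_le_trans k2.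
    have h3 : 0 <= sigma / 2 * enorm (xbar - x) ^+ 2.
      by rewrite mulr_ge0 ?sqr_ge0// divr_ge0.
    rewrite !mulNr opprK => h4.
    have {h4} : phir x + inner v (xbar - x) <= phir xbar by apply: le_trans h4; rewrite lerDl.
    move: h1 h2; generalize (phir x) (phir xbar) (enorm v * enorm (xbar - x)); atom_lra.
- move=> x v [[/= xU vV] sub]; have [y l] := locP x v xU vV sub.
  by rewrite (envelopeE l) phi_phir//; have [_ _ _ []] := l.
Qed.

Lemma prox_reg_variational : variational_sufficiency phi xbar /\
  (0 < sigma -> strong_variational_sufficiency sigma phi xbar).
Proof.
have [U [V [theta [eps [w sc]]]]] := variational_witness_exists.
have base := (phi_proper pb, @phi_lsc _ _ _ pb, pstationary pb).
split=> [|s0]; [|split=> //]; case: base => [[h1 h2] h3].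
  by split=> //; exists U, V, theta, eps.
by split=> //; exists U, V, theta, eps.
Qed.

End Theta.

Theorem theorem6p5 (R : realType) (n m : nat)
    (phi0 : 'rV[R]_n -> R) (g : 'rV[R]_n -> 'rV[R]_m)
    (psi : 'rV[R]_m -> \bar R) (xbar : 'rV[R]_n)
    (phi0_C2 : C2 phi0) (g_C2 : C2_map g)
    (psi_proper : proper_fun psi) (psi_lsc : lower_semicontinuous psi)
    (psi_convex : convex_fun_on setT psi)
    (xbar_stationary : limiting_subdiff (composite phi0 g psi) xbar 0)
    (first_order_qc :
      singular_subdiff psi (g xbar) `&` ker_jac_adj g xbar = [set 0])
    (second_order_qc : forall ybar : 'rV[R]_m,
      multipliers phi0 g psi xbar 0 ybar ->
      second_subdiff psi (g xbar) ybar 0 `&` ker_jac_adj g xbar = [set 0]) :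
  [/\ (exists (U V : set 'rV[R]_n),
         [/\ nbhs xbar U, nbhs (0 : 'rV[R]_n) V &
             forall (x v : 'rV[R]_n) (y u : 'rV[R]_m) (w : 'rV[R]_n),
               U x -> V v -> multipliers phi0 g psi x v y ->
               second_subdiff psi (g x) y (jac g x w) u ->
               0 <= second_order_form phi0 g x y u w]) ->
      variational_sufficiency (composite phi0 g psi) xbar,
      forall sigma : R, 0 < sigma ->
      (exists (U V : set 'rV[R]_n),
         [/\ nbhs xbar U, nbhs (0 : 'rV[R]_n) V &
             forall (x v : 'rV[R]_n) (y u : 'rV[R]_m) (w : 'rV[R]_n),
               U x -> V v -> multipliers phi0 g psi x v y ->
               second_subdiff psi (g x) y (jac g x w) u ->
               sigma * enorm w ^+ 2 <= second_order_form phi0 g x y u w]) ->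
      strong_variational_sufficiency sigma (composite phi0 g psi) xbar &
      (forall (ybar u : 'rV[R]_m) (w : 'rV[R]_n),
         multipliers phi0 g psi xbar 0 ybar ->
         second_subdiff psi (g xbar) ybar (jac g xbar w) u -> w != 0 ->
         0 < second_order_form phi0 g xbar ybar u w) ->
      exists sigma : R,
        strong_variational_sufficiency sigma (composite phi0 g psi) xbar].
Proof.
pose pb := Problem phi0_C2 g_C2 psi_proper psi_lsc psi_convex xbar_stationary
  first_order_qc second_order_qc.
(* Admitting [sigma = 0] lets one claim serve both (i) and (ii). *)
have main (sigma : R) : 0 <= sigma -> (exists (U V : set 'rV[R]_n),
    [/\ nbhs xbar U, nbhs (0 : 'rV[R]_n) V &
        forall (x v : 'rV[R]_n) (y u : 'rV[R]_m) (w : 'rV[R]_n),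
          U x -> V v -> multipliers phi0 g psi x v y ->
          second_subdiff psi (g x) y (jac g x w) u ->
          sigma * enorm w ^+ 2 <= second_order_form phi0 g x y u w]) ->
    exists2 r : R, 0 < r & prox_reg pb (- sigma) r.
  move=> s0 [U [V [/nbhs_enormP[rU rU0 hU] /nbhs_enormP[rV rV0 hV] psd]]].
  have [rs [s [rs0 s_gt0 st]]] := prox_reg_exists pb.
  have m0 : 0 < Num.min rU rV by rewrite lt_min rU0.
  have [|r r0 mono] := @local_strong_monotonicity _ _ _ pb sigma _ s0 m0.
    move=> x y u w [xr vr vE ysub] sub; rewrite -(@second_order_formE _ _ _ pb).
    apply: (psd x (lag_grad pb x y)) sub.
    - by apply: hU; apply: lt_le_trans xr _; rewrite ge_min lexx.
    - by apply: hV; rewrite subr0; apply: lt_le_trans vr _; rewrite ge_min lexx orbT.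
    - exact/(@multipliersP _ _ _ pb).
  exact: (prox_reg_of_monotone s_gt0 s0 rs0 st r0 mono).
split.
- move=> h; have [|r r0 st] := main 0 (lexx _).
    by have [U [V [nU nV psd]]] := h; exists U, V; split=> // *; rewrite mul0r; apply: psd; eassumption.
  exact: (prox_reg_variational (lexx 0) r0 st).1.
- move=> sigma s0 h; have [r r0 st] := main sigma (ltW s0) h.
  exact: (prox_reg_variational (ltW s0) r0 st).2.
- move=> pd; have [|sigma [r [s0 r0 st]]] := @prox_reg_negative _ _ _ pb.
    by move=> ybar u w mu sub w0; rewrite -(@second_order_formE _ _ _ pb); exact: pd mu sub w0.
  by exists sigma; exact: (prox_reg_variational (ltW s0) r0 st).2.
Qed.
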